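(* Inner quasidiagonality is a separably inheritable (SI) property of C*-algebras; that is: (i) if $A$ is an inner quasidiagonal C*-algebra and $B$ is a separable C*-subalgebra of $A$, then there is a separable inner quasidiagonal C*-subalgebra $\tilde B$ of $A$ with $B\subseteq\tilde B$; and (ii) if $(A_n,\phi_n)$ is a sequential inductive system of separable inner quasidiagonal C*-algebras with injective connecting maps $\phi_n:A_n\to A_{n+1}$, then the inductive limit $\lim_{\rightarrow}(A_n,\phi_n)$ is inner quasidiagonal.
   Context: Inner quasidiagonal: a C*-algebra $A$ is inner quasidiagonal if for every $x_1,\dots,x_n\in A$ and $\epsilon>0$ there are a representation $\pi$ of $A$ on a Hilbert space $\mathcal{H}$ and a finite-rank projection $P\in\pi(A)''$ (the bicommutant of $\pi(A)$ in $\mathcal{L}(\mathcal{H})$) such that $\|P\pi(x_j)-\pi(x_j)P\|<\epsilon$ and $\|P\pi(x_j)P\|>\|x_j\|-\epsilon$ for $1\le j\le n$. A property of C*-algebras is an (SI) property (separably inheritable, in Blackadar's sense) if (i) whenever $A$ has the property and $B$ is a separable C*-subalgebra of $A$, there is a separable C*-subalgebra of $A$ containing $B$ which has the property, and (ii) the property passes to inductive limits of sequences of separable C*-algebras having the property with injective connecting $*$-homomorphisms. *)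

(* Defs.v *)
From HB Require Import structures.
From mathcomp Require Import all_boot all_order all_algebra.
From mathcomp Require Import sesquilinear complex.
From mathcomp Require Import boolp classical_sets functions cardinality.
From mathcomp Require Import reals topology normedtype sequences.

Set Implicit Arguments.
Unset Strict Implicit.
Unset Printing Implicit Defensive.

Import Order.TTheory GRing.Theory Num.Theory.
Import numFieldNormedType.Exports.

Local Open Scope classical_set_scope.
Local Open Scope ring_scope.

(* Norms in a normedModType over R[i] take their values in R[i]; [rnorm] is
   the same number seen in R. *)
Definition rnorm (R : realType) (V : normedModType R[i]) (x : V) : R :=
  complex.Re `|x|.

(* C*-algebras are not assumed to be unital, hence the multiplication is not
   the one of the ring hierarchy. *)
HB.mixin Record isCstarAlgebra (R : realType) A
    & CompleteNormedModule R[i] A := {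
  cmul : A -> A -> A;
  cstar : A -> A;
  cmulA : associative cmul;
  cmulDl : left_distributive cmul +%R;
  cmulDr : right_distributive cmul +%R;
  cmulZl : forall (k : R[i]) (x y : A), cmul (k *: x) y = k *: cmul x y;
  cmulZr : forall (k : R[i]) (x y : A), cmul x (k *: y) = k *: cmul x y;
  cstarK : involutive cstar;
  cstarD : {morph cstar : x y / x + y};
  cstarZ : forall (k : R[i]) (x : A), cstar (k *: x) = Num.conj k *: cstar x;
  cstarM : forall x y : A, cstar (cmul x y) = cmul (cstar y) (cstar x);
  cnormM : forall x y : A, `|cmul x y| <= `|x| * `|y|;
  cnorm_star : forall x : A, `|cmul (cstar x) x| = `|x| ^+ 2
}.

#[short(type="cstarAlgType")]
HB.structure Definition CstarAlgebra (R : realType) :=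
  {A of isCstarAlgebra R A & CompleteNormedModule R[i] A}.

HB.mixin Record isHilbert (R : realType) H & CompleteNormedModule R[i] H := {
  hdot : {dot H for Num.conj};
  hdot_norm : forall u : H, `|u| ^+ 2 = hdot u u
}.

#[short(type="hilbertType")]
HB.structure Definition Hilbert (R : realType) :=
  {H of isHilbert R H & CompleteNormedModule R[i] H}.

Record starHom (R : realType) (A B : cstarAlgType R) := StarHom {
  starHom_fun :> {linear A -> B};
  starHomM : {morph starHom_fun : x y / cmul x y};
  starHom_star : {morph starHom_fun : x / cstar x}
}.

Section Operators.
Variables (R : realType) (H : hilbertType R).
Implicit Types (T P : H -> H) (M : set (H -> H)).

Definition bounded_operator T := linear T /\ continuous T.

(* Only meaningful on bounded operators: [sup] is 0 on unbounded sets. *)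
Definition opnorm T : R := sup [set rnorm (T u) | u in [set u | rnorm u <= 1]].

Definition commutant M : set (H -> H) :=
  [set T | bounded_operator T /\ forall S, M S -> T \o S = S \o T].

Definition bicommutant M : set (H -> H) := commutant (commutant M).

Definition projection P :=
  [/\ bounded_operator P, P \o P = P
    & forall u v, hdot (P u) v = hdot u (P v)].

Definition finite_rank T :=
  exists (n : nat) (b : 'I_n -> H),
    forall u, exists c : 'I_n -> R[i], T u = \sum_i c i *: b i.

End Operators.

(* A representation need not be faithful nor nondegenerate. *)
Record representation (R : realType) (A : cstarAlgType R) (H : hilbertType R) :=
  Representation {
  rep_op :> A -> H -> H;
  rep_bounded : forall x, bounded_operator (rep_op x);
  repD : forall x y u, rep_op (x + y) u = rep_op x u + rep_op y u;
  repZ : forall (k : R[i]) x u, rep_op (k *: x) u = k *: rep_op x u;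
  repM : forall x y, rep_op (cmul x y) = rep_op x \o rep_op y;
  rep_star : forall x u v,
    hdot (rep_op x u) v = hdot u (rep_op (cstar x) v)
}.

Definition inner_quasidiagonal (R : realType) (A : cstarAlgType R) : Prop :=
  forall (n : nat) (x : 'I_n -> A) (eps : R), 0 < eps ->
  exists (H : hilbertType R) (pi : representation A H) (P : H -> H),
    [/\ projection P, finite_rank P, bicommutant (range pi) P
      & forall j,
        opnorm (fun u => P (pi (x j) u) - pi (x j) (P u)) < eps /\
        opnorm (P \o pi (x j) \o P) > rnorm (x j) - eps].

Definition separable (T : topologicalType) : Prop :=
  exists D : set T, countable D /\ dense D.

Record cstarSubalg (R : realType) (A : cstarAlgType R) := CstarSubalg {
  subalg_set :> set A;
  subalg0 : subalg_set 0;
  subalgD : forall x y, subalg_set x -> subalg_set y -> subalg_set (x + y);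
  subalgZ : forall (k : R[i]) x, subalg_set x -> subalg_set (k *: x);
  subalgM : forall x y, subalg_set x -> subalg_set y -> subalg_set (cmul x y);
  subalg_star : forall x, subalg_set x -> subalg_set (cstar x);
  subalg_closed : closed subalg_set
}.

Definition subalg_pred (R : realType) (A : cstarAlgType R)
  (B : cstarSubalg A) : A -> bool := fun x => x \in subalg_set B.

(* The elements of B, made into a C*-algebra by the operations and the norm
   of A. *)
Record subalg_type (R : realType) (A : cstarAlgType R) (B : cstarSubalg A) :=
  SubalgType { subalg_val : A; subalg_valP : subalg_pred B subalg_val }.

Section SubalgebraType.
Variables (R : realType) (A : cstarAlgType R) (B : cstarSubalg A).

Lemma subalg_predP x : reflect (subalg_set B x) (subalg_pred B x).
Proof. by apply: (iffP idP) => [/set_mem|/mem_set]. Qed.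

Lemma subalg_submod : subsemimod_closed (subalg_pred B).
Proof.
split; first split.
- exact/subalg_predP/subalg0.
- by move=> x y /subalg_predP Bx /subalg_predP By; exact/subalg_predP/subalgD.
- by move=> k x /subalg_predP Bx; exact/subalg_predP/subalgZ.
Qed.

HB.instance Definition _ :=
  GRing.isSubmodClosed.Build R[i] A (subalg_pred B) subalg_submod.

Local Notation subB := (subalg_type B).

HB.instance Definition _ := [isSub for @subalg_val R A B].
HB.instance Definition _ := [Choice of subB by <:].
HB.instance Definition _ := [SubChoice_isSubZmodule of subB by <:].
HB.instance Definition _ := [SubZmodule_isSubLmodule of subB by <:].

Let subnorm (x : subB) : R[i] := `|\val x|.

Let subnormD x y : subnorm (x + y) <= subnorm x + subnorm y.
Proof. exact: ler_normD. Qed.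

Let subnormZ (k : R[i]) x : subnorm (k *: x) = `|k| * subnorm x.
Proof. exact: normrZ. Qed.

Let subnorm_eq0 x : subnorm x = 0 -> x = 0.
Proof. by move=> /normr0_eq0 x0; exact/val_inj. Qed.

HB.instance Definition _ :=
  Lmodule_isNormed.Build R[i] subB subnormD subnormZ subnorm_eq0.

Lemma subalg_val_ball (x y : subB) (e : R[i]) :
  ball x e y <-> ball (\val x) e (\val y).
Proof. by rewrite -!ball_normE. Qed.

Let subalg_complete (F : set_system subB) :
  ProperFilter F -> cauchy F -> cvg F.
Proof.
move=> FF /cauchy_ballP cF.
pose G := (\val : subB -> A) @ F.
have /cauchy_cvg/cvg_ex[l Gl] : cauchy G.
  apply/cauchy_ballP => e e0.
  have [[U V] /= [FU FV] UV] := cF e e0.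
  exists (\val @` U, \val @` V) => /=.
    split; first by apply: filterS FU => x Ux; exists x.
    by apply: filterS FV => x Vx; exists x.
  move=> [_ _] [/= [x Ux <-] [y Vy <-]].
  exact/subalg_val_ball/(UV (x, y)).
have Bl : subalg_set B l.
  apply: (@closed_cvg _ _ F _ \val (subalg_set B)) Gl.
  - exact: subalg_closed.
  - by apply: nearW => x; exact/subalg_predP/(valP x).
apply/cvg_ex; exists (SubalgType (introT (subalg_predP l) Bl)).
apply/cvg_ballP => e e0; move/cvg_ballP: Gl => /(_ e e0).
by apply: filterS => x lx; exact/subalg_val_ball.
Qed.

HB.instance Definition _ := Uniform_isComplete.Build subB subalg_complete.

Let sub_mul (x y : subB) : subB :=
  SubalgType (introT (subalg_predP _)
    (subalgM (elimT (subalg_predP _) (valP x))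
             (elimT (subalg_predP _) (valP y)))).

Let sub_star (x : subB) : subB :=
  SubalgType (introT (subalg_predP _)
    (subalg_star (elimT (subalg_predP _) (valP x)))).

Let sub_mulA : associative sub_mul.
Proof. by move=> x y z; apply/val_inj; exact: cmulA. Qed.

Let sub_mulDl : left_distributive sub_mul +%R.
Proof. by move=> x y z; apply/val_inj; exact: cmulDl. Qed.

Let sub_mulDr : right_distributive sub_mul +%R.
Proof. by move=> x y z; apply/val_inj; exact: cmulDr. Qed.

Let sub_mulZl (k : R[i]) x y : sub_mul (k *: x) y = k *: sub_mul x y.
Proof. by apply/val_inj; exact: cmulZl. Qed.

Let sub_mulZr (k : R[i]) x y : sub_mul x (k *: y) = k *: sub_mul x y.
Proof. by apply/val_inj; exact: cmulZr. Qed.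

Let sub_starK : involutive sub_star.
Proof. by move=> x; apply/val_inj; exact: cstarK. Qed.

Let sub_starD : {morph sub_star : x y / x + y}.
Proof. by move=> x y; apply/val_inj; exact: cstarD. Qed.

Let sub_starZ (k : R[i]) x : sub_star (k *: x) = Num.conj k *: sub_star x.
Proof. by apply/val_inj; exact: cstarZ. Qed.

Let sub_starM x y : sub_star (sub_mul x y) = sub_mul (sub_star y) (sub_star x).
Proof. by apply/val_inj; exact: cstarM. Qed.

Let sub_normM x y : `|sub_mul x y| <= `|x| * `|y|.
Proof. exact: cnormM. Qed.

Let sub_norm_star x : `|sub_mul (sub_star x) x| = `|x| ^+ 2.
Proof. exact: cnorm_star. Qed.

HB.instance Definition _ := isCstarAlgebra.Build R subB
  sub_mulA sub_mulDl sub_mulDr sub_mulZl sub_mulZr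
  sub_starK sub_starD sub_starZ sub_starM sub_normM sub_norm_star.

End SubalgebraType.

Section InductiveLimit.
Variables (R : realType) (A : nat -> cstarAlgType R).
Variable phi : forall n, starHom (A n) (A n.+1).

Fixpoint connecting (n m : nat) : A n -> A (m + n)%N :=
  if m is m'.+1 then fun a => phi (m' + n) (connecting m' a) else id.

(* The C*-algebra L, with the maps psi n : A n -> L, is the completion of the
   algebraic inductive limit of (A, phi) for the limit norm
   lim_m ||(phi_{n+m-1} o ... o phi_n)(a)||, elements of limit norm 0 being
   identified with 0. *)
Definition is_inductive_limit (L : cstarAlgType R)
    (psi : forall n, starHom (A n) L) : Prop :=
  [/\ forall n a, psi n.+1 (phi n a) = psi n a,
      forall n (a : A n),
        (fun m => rnorm (connecting m a)) @ \oo --> rnorm (psi n a)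
    & dense (\bigcup_n range (psi n))].

End InductiveLimit.

Definition separably_inheritable (R : realType)
    (Q : cstarAlgType R -> Prop) : Prop :=
  (forall (A : cstarAlgType R) (B : cstarSubalg A),
     Q A -> separable (subalg_type B) ->
     exists B' : cstarSubalg A,
       [/\ separable (subalg_type B'), Q (subalg_type B')
         & subalg_set B `<=` subalg_set B']) /\
  (forall (A : nat -> cstarAlgType R)
      (phi : forall n, starHom (A n) (A n.+1))
      (L : cstarAlgType R) (psi : forall n, starHom (A n) L),
     (forall n, separable (A n)) -> (forall n, Q (A n)) ->
     (forall n, injective (phi n)) ->
     is_inductive_limit phi psi -> Q L).

(* Main.v *)
Require Import Defs.
From HB Require Import structures.
From mathcomp Require Import all_boot all_order all_algebra.
From mathcomp Require Import sesquilinear complex.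
From mathcomp Require Import boolp classical_sets functions cardinality.
From mathcomp Require Import reals topology normedtype.
From mathcomp Require Import ring lra.

Set Implicit Arguments.
Unset Strict Implicit.
Unset Printing Implicit Defensive.

Import Order.TTheory GRing.Theory Num.Theory.
Import numFieldNormedType.Exports.

Local Open Scope classical_set_scope.
Local Open Scope ring_scope.

(** Both parts move a finite-rank projection [P] of a bicommutant [pi(A)''] from
    one algebra to another, keeping the commutators with finitely many elements
    small and their compressions large.

    Subalgebras.  Let [B] be separable in [A].  Start from a dense sequence of
    [B] and close it under rational linear combinations, products, adjoints and
    one more countable family of operations: for each finite list of elements,
    choose [pi] and [P] witnessing inner quasidiagonality of [A] on that list,
    and add elements [a] such that [pi a] and its adjoint are as close to [P] as
    desired on finitely many vectors of the form [pi(d) b], where [b] ranges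
    over a basis of the range of [P].  Such elements exist because [P] lies in
    the bicommutant ([strong_star_density]).  The set obtained is still
    countable ([countable_closure]); let [B'] be its closure.  Restrict [pi] to
    [B'] and cut it down to the closed span of the vectors [pi(d) b].  There [P]
    is a strong-star limit of elements of [B'], hence commutes with the
    commutant of [B'] ([restrict_bicommutant]), and neither the commutators nor
    the compressions have become worse.

    Limits.  Finitely many elements of the limit [L] are approximated by
    elements [x j] of a single [A n], where a witness [pi], [P] is available; but
    [pi] need not extend to [L].  Since [P] has finite rank, for each [j] there is
    an irreducible summand of [pi], generated by a vector [xi], in which the
    compression of [x j] by [P] is still large ([irreducible_summand]).  The
    vector state of [xi] extends to a state of [L], and an extension that is
    extreme among all extensions gives an irreducible representation of [L]
    whose restriction contains the summand ([irreducible_extension]).  A direct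
    sum of pairwise inequivalent irreducible representations has a commutative,
    diagonal commutant, so that a projection acting diagonally lies in the
    bicommutant; a corner of [P] is placed in each ([assembly_ex]).  Summands
    equivalent over [A n] share one corner; corners of inequivalent ones whose
    extensions to [L] happen to be equivalent are put side by side in the same
    space.  The resulting projection has finite rank and, as it is made of pieces
    of [P] lying in orthogonal invariant subspaces, its defects of invariance do
    not exceed those of [P] ([defect_sum]).

    What is needed about the algebras comes from representations.  Inner
    quasidiagonality shows that representations determine the norm of [A n].
    Hence injective morphisms between the [A n] are isometric, and the [A n] have
    approximate units and the order estimate [pos_contr]; isometry, approximate
    units and the estimate pass to [L] by density.  The square root of [1 - b],
    obtained by an explicit iteration, takes the place of functional calculus. *)

(** * Complex numbers, norms and sequences *)

Local Notation Re := complex.Re.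
Local Notation Im := complex.Im.
Local Notation "x %:C" := (real_complex _ x) (format "x %:C") : ring_scope.

Section ComplexNumbers.
Variable R : realType.
Implicit Types (z w : R[i]) (r s : R).

Definition cabs z : R := Re `|z|.

Lemma cabsE z : `|z| = (cabs z)%:C.
Proof. by rewrite /cabs RRe_real // normr_real. Qed.

Lemma cabs_ge0 z : 0 <= cabs z.
Proof. by rewrite -lecR -cabsE; exact: normr_ge0. Qed.

Lemma cabsM z w : cabs (z * w) = cabs z * cabs w.
Proof. by apply: (@complexI R); rewrite -cabsE normrM !cabsE rmorphM. Qed.

Lemma cabsN z : cabs (- z) = cabs z.
Proof. by rewrite /cabs normrN. Qed.

Lemma cabsR r : cabs r%:C = `|r|.
Proof. by rewrite /cabs normc_def /= expr0n addr0 sqrtr_sqr. Qed.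

Lemma cabsD z w : cabs (z + w) <= cabs z + cabs w.
Proof. by rewrite -lecR rmorphD /= -!cabsE ler_normD. Qed.

Lemma cabsB z w : cabs (z - w) = cabs (w - z).
Proof. by rewrite -cabsN opprB. Qed.

Lemma cabs_eq0 z : cabs z = 0 -> z = 0.
Proof. by move=> z0; apply/normr0_eq0; rewrite cabsE z0. Qed.

Lemma cabs0 : cabs 0 = 0.
Proof. by rewrite /cabs normr0. Qed.

Lemma conjE z : Num.conj z = conjc z.
Proof. by []. Qed.

Lemma cabs_conj z : cabs (Num.conj z) = cabs z.
Proof. by rewrite /cabs norm_conjC. Qed.

Lemma Re_conj z : Re (Num.conj z) = Re z.
Proof. by case: z. Qed.

Lemma Im_conj z : Im (Num.conj z) = - Im z.
Proof. by case: z. Qed.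

Lemma ReD z w : Re (z + w) = Re z + Re w. Proof. by case: z; case: w. Qed.
Lemma ImD z w : Im (z + w) = Im z + Im w. Proof. by case: z; case: w. Qed.
Lemma ReN z : Re (- z) = - Re z. Proof. by case: z. Qed.
Lemma ImN z : Im (- z) = - Im z. Proof. by case: z. Qed.
Lemma ReB z w : Re (z - w) = Re z - Re w. Proof. by rewrite ReD ReN. Qed.
Lemma ReM z w : Re (z * w) = Re z * Re w - Im z * Im w.
Proof. by case: z; case: w. Qed.
Lemma ImM z w : Im (z * w) = Re z * Im w + Im z * Re w.
Proof. by case: z; case: w. Qed.
Lemma ReZ r z : Re (r%:C * z) = r * Re z.
Proof. by rewrite ReM /= mul0r subr0. Qed.

Lemma Re_sum (I : finType) (F : I -> R[i]) : Re (\sum_i F i) = \sum_i Re (F i).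
Proof. by elim/big_rec2: _ => [|i x y _ <-] //; rewrite ReD. Qed.

Lemma eqC z w : Re z = Re w -> Im z = Im w -> z = w.
Proof. by case: z => a b; case: w => c d /= -> ->. Qed.

Lemma cabs_sqr z : cabs z ^+ 2 = Re z ^+ 2 + Im z ^+ 2.
Proof. by rewrite /cabs normc_def /= sqr_sqrtr // addr_ge0 // sqr_ge0. Qed.

Lemma mulJc z : z * Num.conj z = (cabs z ^+ 2)%:C.
Proof. by rewrite -normCK cabsE rmorphXn. Qed.

Lemma Re_le_cabs z : `|Re z| <= cabs z.
Proof. by rewrite -lecR -cabsE normc_ge_Re. Qed.

Lemma Re_lec z : Re z <= cabs z.
Proof. exact: le_trans (ler_norm _) (Re_le_cabs z). Qed.

Lemma Im_le_cabs z : `|Im z| <= cabs z.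
Proof.
rewrite -(@ler_pXn2r _ 2) ?nnegrE ?cabs_ge0 // cabs_sqr real_normK ?num_real //.
by rewrite lerDr sqr_ge0.
Qed.

Lemma cabs_le z : cabs z <= `|Re z| + `|Im z|.
Proof.
rewrite -(@ler_pXn2r _ 2) ?nnegrE ?cabs_ge0 ?addr_ge0 // cabs_sqr sqrrD.
rewrite !real_normK ?num_real //.
have : 0 <= `|Re z| * `|Im z| *+ 2 by rewrite mulrn_wge0 // mulr_ge0.
lra.
Qed.

Lemma phase z : exists w, cabs w = 1 /\ w * z = (cabs z)%:C.
Proof.
have [->|z0] := eqVneq z 0.
  by exists 1; rewrite mulr0 cabs0; split=> //; rewrite -(rmorph1 (real_complex R)) cabsR normr1.
have cz0 : cabs z != 0 by apply/eqP => /cabs_eq0 /eqP; rewrite (negPf z0).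
exists ((cabs z)^-1%:C * Num.conj z); split.
  by rewrite cabsM cabsR cabs_conj ger0_norm ?invr_ge0 ?cabs_ge0 // mulVf.
rewrite -mulrA [_ * z]mulrC mulJc -rmorphM /=; congr (_%:C).
by rewrite expr2 mulrA mulVf // mul1r.
Qed.

Lemma ge0_real z : 0 <= z -> z = (Re z)%:C.
Proof. by move=> z0; rewrite RRe_real // ger0_real. Qed.

Lemma ge0_Re z : 0 <= z -> 0 <= Re z.
Proof. by rewrite lecE => /andP[]. Qed.

End ComplexNumbers.

Lemma half_gt0 (R : realType) (e : R) : 0 < e -> 0 < e / 2.
Proof. by move=> e0; rewrite divr_gt0. Qed.

Lemma cvgS_le0 (R : realType) (x : R) : (forall e, 0 < e -> x <= e) -> x <= 0.
Proof.
move=> h; rewrite leNgt; apply/negP => x0.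
have := h (x / 2) (half_gt0 x0); lra.
Qed.

Section Norms.
Variables (R : realType) (V : normedModType R[i]).
Implicit Types (x y : V) (u : nat -> V).

Lemma rnormE x : `|x| = (rnorm x)%:C.
Proof. exact: ge0_real. Qed.

Lemma rnorm_ge0 x : 0 <= rnorm x.
Proof. exact: ge0_Re. Qed.

Lemma rnorm0 : rnorm (0 : V) = 0.
Proof. by rewrite /rnorm normr0. Qed.

Lemma rnorm_eq0 x : rnorm x = 0 -> x = 0.
Proof. by move=> x0; apply/normr0_eq0; rewrite rnormE x0. Qed.

Lemma rnormD x y : rnorm (x + y) <= rnorm x + rnorm y.
Proof. by rewrite -lecR rmorphD /= -!rnormE ler_normD. Qed.

Lemma rnormN x : rnorm (- x) = rnorm x.
Proof. by rewrite /rnorm normrN. Qed.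

Lemma rnormC x y : rnorm (x - y) = rnorm (y - x).
Proof. by rewrite -rnormN opprB. Qed.

Lemma rnormB x y : rnorm (x - y) <= rnorm x + rnorm y.
Proof. by rewrite -(rnormN y) rnormD. Qed.

Lemma rnorm_tri z x y : rnorm (x - y) <= rnorm (x - z) + rnorm (z - y).
Proof. by apply: le_trans (rnormD _ _); rewrite addrA subrK. Qed.

Lemma rnorm_leB x y : rnorm x <= rnorm (x - y) + rnorm y.
Proof. by apply: le_trans (rnormD _ _); rewrite subrK. Qed.

Lemma rnormZ (k : R[i]) x : rnorm (k *: x) = cabs k * rnorm x.
Proof. by apply: (@complexI R); rewrite rmorphM /= -cabsE -!rnormE normrZ. Qed.

Lemma rnormZR (r : R) x : rnorm (r%:C *: x) = `|r| * rnorm x.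
Proof. by rewrite rnormZ cabsR. Qed.

Lemma rnorm_small x : (forall e, 0 < e -> rnorm x <= e) -> x = 0.
Proof.
by move=> h; apply/rnorm_eq0/le_anti; rewrite rnorm_ge0 andbT cvgS_le0.
Qed.

(** Convergence with real radii: the norm itself takes its values in [R[i]]. *)
Definition ecvg u (l : V) :=
  forall e : R, 0 < e -> exists N, forall n, (N <= n)%N -> rnorm (u n - l) < e.
Definition ecauchy u :=
  forall e : R, 0 < e -> exists N, forall m n, (N <= m)%N -> (N <= n)%N ->
  rnorm (u m - u n) < e.

Lemma ball_rnorm x y (r : R) : ball x r%:C y <-> rnorm (x - y) < r.
Proof. by rewrite -ball_normE /ball_ /= rnormE ltcR. Qed.

Lemma gt0_real (e : R[i]) : 0 < e -> exists2 r : R, 0 < r & e = r%:C.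
Proof.
by move=> e0; exists (Re e); rewrite -?ge0_real ?ltW //; move: e0; rewrite ltcE => /andP[].
Qed.

Lemma nbhs_rnorm x (A : set V) :
  nbhs x A <-> exists2 r : R, 0 < r & forall y, rnorm (x - y) < r -> A y.
Proof.
rewrite -nbhs_ballE; split.
  move=> [e /= e0 eA]; have [r r0 er] := gt0_real e0.
  by exists r => // y xy; apply: eA; rewrite er; apply/ball_rnorm.
move=> [r r0 rA]; exists r%:C => /=; first by rewrite ltcR.
by move=> y /ball_rnorm /rA.
Qed.

Lemma dense_rnorm (D : set V) :
  dense D <-> forall x (e : R), 0 < e -> exists2 y, D y & rnorm (x - y) < e.
Proof.
split=> [dD x e e0|h O [x Ox] oO].
  have [||y [/ball_rnorm xy Dy]] := dD (ball x e%:C).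
  - by exists x; apply: ballxx; rewrite ltcR.
  - by apply: ball_open; rewrite ltcR.
  - by exists y.
move: oO; rewrite openE => /(_ x Ox) /nbhs_rnorm[r r0 rO].
by have [y Dy xy] := h x r r0; exists y; split=> //; exact: rO.
Qed.

Lemma closed_rnorm (D : set V) : closed D <->
  forall x, (forall e : R, 0 < e -> exists2 y, D y & rnorm (x - y) < e) -> D x.
Proof.
split=> [cD x h|h x cx].
  apply: cD => B /nbhs_rnorm[r r0 rB].
  by have [y Dy xy] := h r r0; exists y; split=> //; exact: rB.
apply: h => e e0; have [|y [Dy yB]] := cx (fun y => rnorm (x - y) < e).
  by apply/nbhs_rnorm; exists e.
by exists y.
Qed.

Lemma ecvg_uniq u l l' : ecvg u l -> ecvg u l' -> l = l'.
Proof.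
move=> ul ul'; apply/eqP; rewrite -subr_eq0; apply/eqP/rnorm_small => e e0.
have [N1 h1] := ul (e / 2) (half_gt0 e0).
have [N2 h2] := ul' (e / 2) (half_gt0 e0).
have := h1 (maxn N1 N2) (leq_maxl _ _); have := h2 (maxn N1 N2) (leq_maxr _ _).
have := rnorm_tri (u (maxn N1 N2)) l l'; rewrite (rnormC l (u _)); lra.
Qed.

Lemma ecvg_le u l y (M : R) : ecvg u l ->
  (exists N, forall n, (N <= n)%N -> rnorm (u n - y) <= M) -> rnorm (l - y) <= M.
Proof.
move=> ul [N hN]; rewrite -subr_le0; apply: cvgS_le0 => e /ul [N1 h1].
have := h1 (maxn N N1) (leq_maxr _ _); have := hN (maxn N N1) (leq_maxl _ _).
have := rnorm_tri (u (maxn N N1)) l y; rewrite (rnormC l (u _)); lra.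
Qed.

End Norms.

Lemma inv_small (R : realType) (e : R) : 0 < e ->
  exists N, forall n, (N <= n)%N -> n.+1%:R^-1 < e.
Proof.
move=> e0; have [N hN] : exists N, e^-1 < N.+1%:R :> R.
  by exists (Num.truncn e^-1); rewrite truncnS_gt.
exists N => n Nn; rewrite -(invrK e) ltf_pV2 ?posrE ?invr_gt0 ?ltr0n //.
by apply: lt_le_trans hN _; rewrite ler_nat.
Qed.

Section Completeness.
Variable R : realType.

Lemma complete_seq (V : completeNormedModType R[i]) (u : nat -> V) :
  ecauchy u -> exists l, ecvg u l.
Proof.
move=> cu; have /cauchy_cvg/cvg_ex[l ul] : cauchy (u @ \oo).
  apply/cauchy_ballP => _ /gt0_real [e e0 ->].
  have [N hN] := cu e e0.
  exists (u @` [set n | (N <= n)%N], u @` [set n | (N <= n)%N]) => /=.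
    by split; exists N => // n /= Nn; exists n.
  move=> [_ _] [/= [m Nm <-] [n Nn <-]]; apply/ball_rnorm; exact: hN.
exists l => e e0; have [N _ hN] : \forall n \near \oo, rnorm (l - u n) < e.
  by apply: (ul (fun y => rnorm (l - y) < e)); apply/nbhs_rnorm; exists e.
by exists N => n Nn; rewrite rnormC; exact: hN.
Qed.

(** A Cauchy filter contains sets of arbitrarily small diameter; points picked
    in the successive intersections of such sets form a Cauchy sequence, whose
    limit is that of the filter. *)
Lemma seq_complete (V : normedModType R[i]) :
  (forall u : nat -> V, ecauchy u -> exists l, ecvg u l) ->
  forall F : set_system V, ProperFilter F -> cauchy F -> cvg F.
Proof.
move=> cV F FF /cauchy_ballP cF.
have hU n : exists U, F U /\ forall x y, U x -> U y -> rnorm (x - y) < n.+1%:R^-1.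
  have [|[U W] /= [FU FW] UW] := cF (n.+1%:R^-1 / 2)%:C.
    by rewrite ltcR divr_gt0 ?invr_gt0 ?ltr0n.
  exists (U `&` W); split; first exact: filterI.
  move=> x y [Ux _] [_ Wy]; have /ball_rnorm xy := UW (x, y) (conj Ux Wy).
  have n0 : 0 < n.+1%:R^-1 :> R by rewrite invr_gt0 ltr0n.
  by apply: lt_trans xy _; rewrite ltr_pdivrMr // ltr_pMr // ltr1n.
have [U hU'] := choice hU.
pose W := fix W n := if n is m.+1 then W m `&` U m.+1 else U 0%N.
have FW n : F (W n).
  by elim: n => [|n IH] /=; [exact: (hU' 0%N).1 | apply: filterI => //; exact: (hU' n.+1).1].
have [u hu] := choice (fun n => filter_ex (FW n)).
have WU m n x : (n <= m)%N -> W m x -> U n x.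
  elim: m n => [|m IH] n; first by rewrite leqn0 => /eqP ->.
  rewrite leq_eqVlt => /orP[/eqP -> [] //|]; rewrite ltnS => nm [Wx _]; exact: IH Wx.
have uU m n : (n <= m)%N -> U n (u m) by move=> nm; exact: WU nm (hu m).
have [|l ul] := cV u.
  move=> e e0; have [N hN] := inv_small e0; exists N => m n Nm Nn.
  apply: lt_trans (hN N (leqnn _)); exact: (hU' N).2 (uU _ _ Nm) (uU _ _ Nn).
apply/cvg_ex; exists l => B /nbhs_rnorm[r r0 rB].
have [N1 h1] := inv_small (half_gt0 r0); have [N2 h2] := ul _ (half_gt0 r0).
pose N := maxn N1 N2; apply: filterS (hU' N).1 => x Ux; apply: rB.
have := lt_trans ((hU' N).2 _ _ (uU _ _ (leqnn N)) Ux) (h1 N (leq_maxl _ _)).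
have := h2 N (leq_maxr _ _).
have := rnorm_tri (u N) l x; rewrite (rnormC l (u _)); lra.
Qed.

End Completeness.

(** * Semidefinite forms and bounded operators *)

Section Forms.
Variables (R : realType) (E : lmodType R[i]).

(** Positive semidefinite hermitian forms, linear in the first variable; they
    are the common source of every inner product built below. *)
Record psd (s : E -> E -> R[i]) : Prop := Psd {
  psdDl : forall x y z, s (x + y) z = s x z + s y z;
  psdZl : forall k x z, s (k *: x) z = k * s x z;
  psdC : forall x y, s x y = Num.conj (s y x);
  psd_ge0 : forall x, 0 <= Re (s x x)
}.

Variables (s : E -> E -> R[i]) (ps : psd s).

Lemma psd0l z : s 0 z = 0.
Proof. by rewrite -(scale0r (0 : E)) (psdZl ps) mul0r. Qed.
Lemma psdNl x z : s (- x) z = - s x z.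
Proof. by rewrite -scaleN1r (psdZl ps) mulN1r. Qed.
Lemma psdBl x y z : s (x - y) z = s x z - s y z.
Proof. by rewrite (psdDl ps) psdNl. Qed.
Lemma psdDr x y z : s x (y + z) = s x y + s x z.
Proof. by rewrite !(psdC ps x) (psdDl ps) rmorphD. Qed.
Lemma psdZr k x z : s x (k *: z) = Num.conj k * s x z.
Proof. by rewrite !(psdC ps x) (psdZl ps) rmorphM. Qed.
Lemma psdNr x z : s x (- z) = - s x z.
Proof. by rewrite -scaleN1r psdZr rmorphN1 mulN1r. Qed.
Lemma psdBr x y z : s x (y - z) = s x y - s x z.
Proof. by rewrite psdDr psdNr. Qed.
Lemma psd0r z : s z 0 = 0.
Proof. by rewrite (psdC ps) psd0l rmorph0. Qed.
Lemma psdReC x y : Re (s x y) = Re (s y x).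
Proof. by rewrite (psdC ps) Re_conj. Qed.
Lemma psd_real x : s x x = (Re (s x x))%:C.
Proof.
apply: eqC => //=; have := congr1 (@complex.Im R) (psdC ps x x).
by rewrite Im_conj; lra.
Qed.

Lemma psd_sqD x y :
  Re (s (x + y) (x + y)) = Re (s x x) + 2 * Re (s x y) + Re (s y y).
Proof. by rewrite (psdDl ps) !psdDr !ReD (psdReC y x); ring. Qed.

Lemma psd_sqB x y :
  Re (s (x - y) (x - y)) = Re (s x x) - 2 * Re (s x y) + Re (s y y).
Proof. by rewrite psd_sqD psdNr psdNl psdNr opprK ReN; ring. Qed.

Lemma psd_sqZ k x : Re (s (k *: x) (k *: x)) = cabs k ^+ 2 * Re (s x x).
Proof. by rewrite (psdZl ps) psdZr mulrA mulJc ReZ. Qed.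

End Forms.

(** The discriminant of a nonnegative polynomial.  The witness is its minimum
    [b / c], or, when [c = 0], a [t] at which the affine function is negative. *)
Lemma quad_ge0 (R : realType) (a b c : R) : 0 <= c ->
  (forall t, 0 <= a - 2 * t * b + t ^+ 2 * c) -> b ^+ 2 <= a * c.
Proof.
rewrite le_eqVlt => /orP[/eqP <-|c0] h.
  have [->|b0] := eqVneq b 0; first by rewrite expr0n mulr0.
  have := h ((a + 1) / (2 * b)); rewrite mulr0 addr0.
  have -> : 2 * ((a + 1) / (2 * b)) * b = a + 1 by field.
  lra.
have := h (b / c).
have -> : a - 2 * (b / c) * b + (b / c) ^+ 2 * c = (a * c - b ^+ 2) / c.
  by field; rewrite gt_eqF.
by rewrite pmulr_lge0 ?invr_gt0 // subr_ge0.
Qed.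

(** Rotating [x] by the phase of [s x y] reduces to a real quadratic in [t]. *)
Lemma psd_CS (R : realType) (E : lmodType R[i]) (s : E -> E -> R[i]) (ps : psd s) x y :
  cabs (s x y) ^+ 2 <= Re (s x x) * Re (s y y).
Proof.
have [w [w1 ws]] := phase (s x y).
apply: quad_ge0; first exact: (psd_ge0 ps).
move=> t; have := psd_ge0 ps (w *: x - t%:C *: y).
rewrite (psd_sqB ps) !(psd_sqZ ps) w1 cabsR (psdZl ps) (psdZr ps) mulrCA ws.
rewrite conjE conjc_real ReZ /= real_normK ?num_real //.
by move=> h; apply: le_trans h _; rewrite le_eqVlt; apply/orP; left; apply/eqP; ring.
Qed.

Section LinearMaps.
Variables (R : realType) (V W : lmodType R[i]) (T : V -> W) (lT : linear T).

Lemma linD u v : T (u + v) = T u + T v.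
Proof. by rewrite -[u in LHS]scale1r lT scale1r. Qed.
Lemma lin0 : T 0 = 0.
Proof. by apply: (addrI (T 0)); rewrite -linD !addr0. Qed.
Lemma linZ k u : T (k *: u) = k *: T u.
Proof. by rewrite -[_ *: u]addr0 lT lin0 addr0. Qed.
Lemma linN u : T (- u) = - T u.
Proof. by rewrite -scaleN1r linZ scaleN1r. Qed.
Lemma linB u v : T (u - v) = T u - T v.
Proof. by rewrite linD linN. Qed.
Lemma lin_sum I (r : seq I) (F : I -> V) :
  T (\sum_(i <- r) F i) = \sum_(i <- r) T (F i).
Proof.
elim: r => [|i r IH]; first by rewrite !big_nil lin0.
by rewrite !big_cons linD IH.
Qed.

End LinearMaps.

Definition bop (R : realType) (V W : normedModType R[i]) (T : V -> W) :=
  linear T /\ exists M : R, forall u, rnorm (T u) <= M * rnorm u.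

Section BoundedMaps.
Variable R : realType.
Implicit Types V W : normedModType R[i].

Lemma bop_bound V W (T : V -> W) : bop T ->
  exists2 M : R, 0 < M & forall u, rnorm (T u) <= M * rnorm u.
Proof.
move=> [_ [M hM]]; exists (`|M| + 1); first by rewrite ltr_wpDl.
move=> u; apply: le_trans (hM u) _; apply: ler_wpM2r; first exact: rnorm_ge0.
by have := ler_norm M; lra.
Qed.

Lemma bop_comp V W (X : normedModType R[i]) (T : V -> W) (S : W -> X) :
  bop T -> bop S -> bop (S \o T).
Proof.
move=> bT bS; split; first by move=> k u v /=; rewrite bT.1 bS.1.
have [M M0 hM] := bop_bound bT; have [N N0 hN] := bop_bound bS.
exists (N * M) => u /=; apply: le_trans (hN _) _.
by rewrite -mulrA ler_pM2l.
Qed.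

Lemma bopD V W (T S : V -> W) : bop T -> bop S -> bop (fun u => T u + S u).
Proof.
move=> [lT [M hM]] [lS [N hN]]; split.
  by move=> k u v; rewrite lT lS scalerDr addrACA.
exists (M + N) => u; apply: le_trans (rnormD _ _) _.
by rewrite mulrDl lerD.
Qed.

Lemma bopZ V W (k : R[i]) (T : V -> W) : bop T -> bop (fun u => k *: T u).
Proof.
move=> [lT [M hM]]; split.
  by move=> a u v; rewrite lT scalerDr !scalerA mulrC.
exists (cabs k * M) => u.
by rewrite rnormZ -mulrA ler_wpM2l // cabs_ge0.
Qed.

Lemma bopB V W (T S : V -> W) : bop T -> bop S -> bop (fun u => T u - S u).
Proof.
move=> bT bS; have -> : (fun u => T u - S u) = (fun u => T u + (-1) *: S u).
  by apply/funext => u; rewrite scaleN1r.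
exact: bopD (bopZ _ _).
Qed.

Lemma bop_id V : bop (@id V).
Proof. by split=> //; exists 1 => u; rewrite mul1r. Qed.

Lemma bop0 V W : bop (fun _ : V => 0 : W).
Proof.
by split=> [k u v|]; [rewrite scaler0 addr0 | exists 0 => u; rewrite rnorm0 mul0r].
Qed.

Lemma bop_ext V W (T S : V -> W) (D : set V) : bop T -> bop S ->
  (forall x, D x -> T x = S x) ->
  forall x, (forall e : R, 0 < e -> exists2 y, D y & rnorm (x - y) < e) -> T x = S x.
Proof.
move=> bT bS h x hx; apply/eqP; rewrite -subr_eq0; apply/eqP/rnorm_small => e e0.
have bTS := bopB bT bS; have [M M0 hM] := bop_bound bTS.
have [|y Dy xy] := hx (e / M); first by rewrite divr_gt0.
rewrite -[T x - S x]/((fun u => T u - S u) x) -[_ x]subr0.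
have <- : (fun u => T u - S u) y = 0 by rewrite /= h // subrr.
rewrite -(linB bTS.1); apply: le_trans (hM _) _.
by rewrite mulrC -ler_pdivlMr // ltW.
Qed.

Lemma bop_continuous V W (T : V -> W) : linear T -> (continuous T <-> bop T).
Proof.
move=> lT; split=> [cT|[_ [M hM]]].
  split=> //; have : nbhs (T 0) (fun y => rnorm (T 0 - y) < 1).
    by apply/nbhs_rnorm; exists 1.
  move=> /cT /nbhs_rnorm[r r0 hr].
  have {}hr u : rnorm u < r -> rnorm (T u) < 1.
    by have /= := hr u; rewrite (lin0 lT) !sub0r !rnormN.
  exists (2 / r) => u; have [u0|u0] := eqVneq (rnorm u) 0.
    by rewrite u0 (rnorm_eq0 u0) (lin0 lT) rnorm0 mulr0.
  have up : 0 < rnorm u by rewrite lt_def u0 rnorm_ge0.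
  have rp : 0 < r / (2 * rnorm u) by rewrite divr_gt0 // mulr_gt0.
  have := hr ((r / (2 * rnorm u))%:C *: u); rewrite (linZ lT) !rnormZR (ger0_norm (ltW rp)).
  have -> : r / (2 * rnorm u) * rnorm u = r / 2 by field.
  move=> /(_ _)/ltW h; rewrite -(ler_pM2l rp); apply: le_trans (h _) _; first lra.
  have -> // : r / (2 * rnorm u) * (2 / r * rnorm u) = 1.
  by field; rewrite u0 gt_eqF.
move=> x A /nbhs_rnorm[r r0 hr]; apply/nbhs_rnorm.
have M0 : 0 < `|M| + 1 by rewrite ltr_wpDl.
exists (r / (`|M| + 1)); first by rewrite divr_gt0.
move=> y xy; apply: hr; rewrite -(linB lT); apply: le_lt_trans (hM _) _.
apply: (@le_lt_trans _ _ ((`|M| + 1) * rnorm (x - y))).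
  apply: ler_wpM2r; first exact: rnorm_ge0.
  by have := ler_norm M; lra.
by rewrite mulrC -ltr_pdivlMr.
Qed.

End BoundedMaps.

Section HilbertSpace.
Variables (R : realType) (H : hilbertType R).
Implicit Types (u v w : H) (T P : H -> H).

Lemma hdot_sq u : hdot u u = (rnorm u ^+ 2)%:C.
Proof. by rewrite -hdot_norm rnormE rmorphXn. Qed.

Lemma hdot_psd : psd (@hdot R H).
Proof.
split.
- by move=> x y z; rewrite linearDl.
- by move=> k x z; rewrite linearZl_LR.
- by move=> x y; rewrite (@hermitian_subproof _ _ _ _ (@hdot R H)) expr0 mul1r.
- by move=> x; rewrite hdot_sq /= sqr_ge0.
Qed.

Definition hdotDl := psdDl hdot_psd.
Definition hdotDr := psdDr hdot_psd.
Definition hdotBl := psdBl hdot_psd.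
Definition hdotBr := psdBr hdot_psd.
Definition hdotNl := psdNl hdot_psd.
Definition hdotNr := psdNr hdot_psd.
Definition hdotZl := psdZl hdot_psd.
Definition hdotZr := psdZr hdot_psd.
Definition hdot0l := psd0l hdot_psd.
Definition hdot0r := psd0r hdot_psd.
Definition hdotC := psdC hdot_psd.

Lemma rnorm_sq u : rnorm u ^+ 2 = Re (hdot u u).
Proof. by rewrite hdot_sq. Qed.

Lemma rnorm_sqD u v :
  rnorm (u + v) ^+ 2 = rnorm u ^+ 2 + 2 * Re (hdot u v) + rnorm v ^+ 2.
Proof. by rewrite !rnorm_sq (psd_sqD hdot_psd). Qed.

Lemma rnorm_sqB u v :
  rnorm (u - v) ^+ 2 = rnorm u ^+ 2 - 2 * Re (hdot u v) + rnorm v ^+ 2.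
Proof. by rewrite !rnorm_sq (psd_sqB hdot_psd). Qed.

Lemma hdot_eq0 u : hdot u u = 0 -> u = 0.
Proof.
rewrite hdot_sq => /(@complexI R) /eqP; rewrite sqrf_eq0 => /eqP; exact: rnorm_eq0.
Qed.

Lemma hdot_CS u v : cabs (hdot u v) <= rnorm u * rnorm v.
Proof.
rewrite -(@ler_pXn2r _ 2) ?nnegrE ?cabs_ge0 ?mulr_ge0 ?rnorm_ge0 // exprMn.
by rewrite !rnorm_sq (psd_CS hdot_psd).
Qed.

Lemma hdot_orthC u v : hdot u v = 0 -> hdot v u = 0.
Proof. by move=> h; rewrite hdotC h rmorph0. Qed.

Lemma hdot_ext u v : (forall w, hdot u w = hdot v w) -> u = v.
Proof.
by move=> h; apply/eqP; rewrite -subr_eq0; apply/eqP/hdot_eq0; rewrite hdotBl h subrr.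
Qed.

Lemma hdot_lim x l v : ecvg x l ->
  forall e, 0 < e -> exists N, forall n, (N <= n)%N -> cabs (hdot (x n) v - hdot l v) < e.
Proof.
move=> xl e e0; have v0 : 0 < rnorm v + 1 by rewrite ltr_wpDl ?rnorm_ge0.
have [|N hN] := xl (e / (rnorm v + 1)); first by rewrite divr_gt0.
exists N => n /hN; rewrite ltr_pdivlMr // => h; rewrite -hdotBl.
apply: le_lt_trans (hdot_CS _ _) (le_lt_trans _ h).
by rewrite ler_wpM2l ?rnorm_ge0 //; lra.
Qed.

Lemma hdot_small u v (M : R) :
  (forall e : R, 0 < e -> exists2 u', cabs (hdot u' v) <= M * e & rnorm (u - u') < e) ->
  hdot u v = 0.
Proof.
move=> h; apply/cabs_eq0/le_anti; rewrite cabs_ge0 andbT; apply: cvgS_le0 => e e0.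
have M0 : 0 < `|M| + rnorm v + 1 by rewrite ltr_wpDl // addr_ge0 ?rnorm_ge0.
have [|u' hu' uu'] := h (e / (`|M| + rnorm v + 1)); first by rewrite divr_gt0.
have -> : hdot u v = hdot (u - u') v + hdot u' v by rewrite hdotBl subrK.
apply: le_trans (cabsD _ _) _; have h1 := hdot_CS (u - u') v.
have hM : M * (e / (`|M| + rnorm v + 1)) <= `|M| * (e / (`|M| + rnorm v + 1)).
  by rewrite ler_wpM2r ?ler_norm // divr_ge0 ?ltW.
have h2 : rnorm (u - u') * rnorm v <= (e / (`|M| + rnorm v + 1)) * rnorm v.
  by rewrite ler_wpM2r ?rnorm_ge0 // ltW.
have he : e = (`|M| + rnorm v + 1) * (e / (`|M| + rnorm v + 1)) by field; rewrite gt_eqF.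
have q0 : 0 < e / (`|M| + rnorm v + 1) by rewrite divr_gt0.
rewrite [in leRHS]he !mulrDl mul1r; lra.
Qed.

(** Nearest point: minimize the distance; a minimizing sequence is Cauchy by
    the parallelogram law.  Real subspaces are allowed because the strong-star
    density argument below needs one that is not complex. *)
Lemma nearest_point (G : set H) v : G 0 ->
  (forall (r : R) x y, G x -> G y -> G (x + r%:C *: y)) ->
  exists z, (forall e : R, 0 < e -> exists2 g, G g & rnorm (z - g) < e) /\
            (forall g, G g -> Re (hdot (v - z) g) = 0).
Proof.
move=> G0 GL; pose D := [set rnorm (v - g) ^+ 2 | g in G].
have iD : has_inf D.
  split; first by exists (rnorm (v - 0) ^+ 2), 0.
  by exists 0 => _ [g _ <-]; rewrite sqr_ge0.
pose d := inf D.
have dle g : G g -> d <= rnorm (v - g) ^+ 2.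
  by move=> Gg; apply: ge_inf; [exact: iD.2 | exists g].
have hg n : exists g, G g /\ rnorm (v - g) ^+ 2 < d + n.+1%:R^-1.
  have [_ [g Gg <-] hg] := @inf_adherent _ D n.+1%:R^-1 (ltac:(by rewrite invr_gt0 ltr0n)) iD.
  by exists g.
have [g hg'] := choice hg.
have par m n : rnorm (g m - g n) ^+ 2 <=
    2 * (rnorm (v - g m) ^+ 2 - d) + 2 * (rnorm (v - g n) ^+ 2 - d).
  have Gh : G ((1 / 2)%:C *: (g m + g n)).
    rewrite -[X in G X]add0r; apply: (GL _ _ _) => //.
    by rewrite -[g n]scale1r; rewrite -(rmorph1 (real_complex R)); exact: (GL 1 _ _ (hg' m).1 (hg' n).1).
  have := dle _ Gh.
  have e1 : g m - g n = (v - g n) - (v - g m).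
    by rewrite opprB [RHS]addrC addrA subrK.
  have e2 : v - (1 / 2)%:C *: (g m + g n) = (1 / 2)%:C *: ((v - g n) + (v - g m)).
    have hv : v = (1 / 2)%:C *: v + (1 / 2)%:C *: v.
      rewrite -scalerDl -rmorphD /=; have -> : 1 / 2 + 1 / 2 = 1 :> R by field.
      by rewrite rmorph1 scale1r.
    by rewrite !scalerDr !scalerN {1}hv opprD [- _ - _]addrC addrACA.
  rewrite e2 rnormZR exprMn (rnorm_sqD (v - g n)) e1 (rnorm_sqB (v - g n)) real_normK ?num_real //; lra.
have cg : ecauchy g.
  move=> e e0; have e20 : 0 < e ^+ 2 / 4 by rewrite divr_gt0 // exprn_gt0.
  have [N hN] := inv_small e20.
  exists N => m n Nm Nn; rewrite -(@ltr_pXn2r _ 2) ?nnegrE ?rnorm_ge0 ?ltW //.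
  apply: le_lt_trans (par m n) _.
  have := lt_trans (hg' m).2 (ler_ltD (lexx d) (hN _ Nm)).
  have := lt_trans (hg' n).2 (ler_ltD (lexx d) (hN _ Nn)).
  lra.
have [z zg] := complete_seq cg.
exists z; split.
  by move=> e /zg[N hN]; exists (g N); [exact: (hg' N).1 | rewrite rnormC hN].
move=> w Gw.
have near t : d <= rnorm (v - z - t%:C *: w) ^+ 2.
  rewrite -subr_ge0 leNgt; apply/negP => neg.
  set r := rnorm _ in neg.
  have r0 : 0 <= r := rnorm_ge0 _.
  have dd : 0 <= d by apply: lb_le_inf; [exact: iD.1 | move=> _ [y _ <-]; rewrite sqr_ge0].
  have e0 : 0 < Num.sqrt d - r.
    by rewrite subr_gt0 -(@ltr_pXn2r _ 2) ?nnegrE ?sqrtr_ge0 // sqr_sqrtr //; lra.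
  have [N hN] := zg _ e0; have := hN N (leqnn _).
  have := dle _ (GL t _ _ (hg' N).1 Gw).
  rewrite -(@ler_sqrt _ _ (rnorm _ ^+ 2)) ?sqr_ge0 // sqrtr_sqr ger0_norm ?rnorm_ge0 //.
  have := rnormD (v - z - t%:C *: w) (z - g N); rewrite -/r (rnormC z).
  have -> : v - z - t%:C *: w + (z - g N) = v - (g N + t%:C *: w).
    by rewrite addrAC addrA subrK opprD addrA.
  lra.
have zd : rnorm (v - z) ^+ 2 <= d.
  have h0 : forall e, 0 < e -> rnorm (v - z) <= Num.sqrt d + e.
    move=> e e0; have e2 : 0 < (e / 2) ^+ 2 by rewrite exprn_gt0 // half_gt0.
    have [N1 h1] := inv_small e2; have [N2 h2] := zg _ (half_gt0 e0).
    pose N := maxn N1 N2; have := h2 N (leq_maxr _ _).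
    have := lt_trans (hg' N).2 (ler_ltD (lexx d) (h1 N (leq_maxl _ _))).
    have dd : 0 <= d by apply: lb_le_inf; [exact: iD.1 | move=> _ [y _ <-]; rewrite sqr_ge0].
    move=> h3; have : rnorm (v - g N) <= Num.sqrt d + e / 2.
      rewrite -(@ler_pXn2r _ 2) ?nnegrE ?rnorm_ge0 ?addr_ge0 ?sqrtr_ge0 ?ltW ?half_gt0 //.
      rewrite sqrrD sqr_sqrtr //.
      have : 0 <= Num.sqrt d * (e / 2) *+ 2.
        by rewrite mulrn_wge0 // mulr_ge0 ?sqrtr_ge0 // ltW // half_gt0.
      lra.
    have := rnorm_tri (g N) v z; lra.
  have dd : 0 <= d by apply: lb_le_inf; [exact: iD.1 | move=> _ [y _ <-]; rewrite sqr_ge0].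
  rewrite -[d]sqr_sqrtr // ler_pXn2r ?nnegrE ?rnorm_ge0 ?sqrtr_ge0 //.
  by rewrite -subr_le0; apply: cvgS_le0 => e /h0; lra.
have /eqP : Re (hdot (v - z) w) ^+ 2 <= 0 * rnorm w ^+ 2.
  apply: quad_ge0; first exact: sqr_ge0.
  move=> t; have := near t; rewrite rnorm_sqB hdotZr conjE conjc_real ReZ rnormZR.
  rewrite exprMn real_normK ?num_real // => h; rewrite -subr_ge0 in h; lra.
rewrite mul0r => /eqP h; apply/eqP; rewrite -sqrf_eq0; apply/eqP/le_anti.
by rewrite h sqr_ge0.
Qed.

End HilbertSpace.

(** * Orthogonal projections and adjoints *)

Section Projections.
Variables (R : realType) (H : hilbertType R).
Implicit Types (u v w : H) (S : set H).

Definition ocompl S : set H := [set w | forall s, S s -> hdot s w = 0].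
(** The closed linear span, as a double orthogonal complement. *)
Definition cspan S : set H := [set v | forall w, ocompl S w -> hdot v w = 0].

Lemma cspan_sub S s : S s -> cspan S s.
Proof. by move=> Ss w; apply. Qed.

Lemma cspan0 S : cspan S 0.
Proof. by move=> w _; rewrite hdot0l. Qed.

Lemma cspanD S (k : R[i]) u v : cspan S u -> cspan S v -> cspan S (u + k *: v).
Proof. by move=> Su Sv w ow; rewrite hdotDl hdotZl Su // Sv // mulr0 addr0. Qed.

Lemma cspan_closed S u :
  (forall e : R, 0 < e -> exists2 v, cspan S v & rnorm (u - v) < e) -> cspan S u.
Proof.
move=> h w ow; apply: (@hdot_small _ _ _ _ 0) => e /h[v Sv uv].
by exists v => //; rewrite Sv // cabs0 mul0r.
Qed.

Lemma hdot_Re0 u v : Re (hdot u v) = 0 -> Re (hdot u ('i%C *: v)) = 0 -> hdot u v = 0.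
Proof.
rewrite hdotZr conjE /= => h1; rewrite ReM /= => h2; apply: eqC => //=; lra.
Qed.

Lemma proj_ex S v : exists z, cspan S z /\ ocompl S (v - z).
Proof.
have [||z [hz hz']] := @nearest_point _ H (cspan S) v.
- exact: cspan0.
- by move=> r x y; exact: cspanD.
exists z; split; first exact: cspan_closed.
move=> s /cspan_sub Ss; apply: hdot_orthC; apply: hdot_Re0; apply: hz' => //.
by rewrite -[_ *: _]add0r; apply: cspanD => //; exact: cspan0.
Qed.

Definition oproj S v : H := projT1 (cid (proj_ex S v)).

Lemma oproj_in S v : cspan S (oproj S v).
Proof. by rewrite /oproj; case: cid => z /= []. Qed.

Lemma oproj_perp S v : ocompl S (v - oproj S v).
Proof. by rewrite /oproj; case: cid => z /= []. Qed.

Lemma oproj_uniq S v z : cspan S z -> ocompl S (v - z) -> oproj S v = z.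
Proof.
move=> Sz oz; apply/eqP; rewrite -subr_eq0; apply/eqP/hdot_eq0.
have S1 : cspan S (oproj S v - z).
  by rewrite -scaleN1r; apply: cspanD => //; exact: oproj_in.
apply: S1 => s Ss; have -> : oproj S v - z = (v - z) - (v - oproj S v).
  by rewrite opprB [RHS]addrC addrA subrK.
by rewrite hdotBr oz // (oproj_perp v) // subrr.
Qed.

Lemma oproj_id S v : cspan S v -> oproj S v = v.
Proof. by move=> Sv; apply: oproj_uniq => // s _; rewrite subrr hdot0r. Qed.

Lemma oproj_linear S : linear (oproj S).
Proof.
move=> k u v; apply: oproj_uniq.
  by rewrite addrC; apply: cspanD; exact: oproj_in.
move=> s Ss; have -> : k *: u + v - (k *: oproj S u + oproj S v) =
   k *: (u - oproj S u) + (v - oproj S v) by rewrite scalerBr opprD addrACA.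
by rewrite hdotDr hdotZr !oproj_perp // mulr0 addr0.
Qed.

Lemma oproj_sa S u v : hdot (oproj S u) v = hdot u (oproj S v).
Proof.
have h x y : hdot (oproj S x) (y - oproj S y) = 0.
  by apply: oproj_in; exact: oproj_perp.
rewrite -[v in LHS](subrK (oproj S v)) hdotDr h add0r.
by rewrite -[u in RHS](subrK (oproj S u)) hdotDl (hdot_orthC (h v u)) add0r.
Qed.

Lemma oproj_norm S v : rnorm (oproj S v) <= rnorm v.
Proof.
rewrite -(@ler_pXn2r _ 2) ?nnegrE ?rnorm_ge0 //.
rewrite -[v in leRHS](subrK (oproj S v)) rnorm_sqD.
by rewrite (hdot_orthC (oproj_in _ (oproj_perp _))) /= mulr0 addr0 lerDr sqr_ge0.
Qed.

Lemma oproj_bop S : bop (oproj S).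
Proof.
by split; [exact: oproj_linear | exists 1 => u; rewrite mul1r oproj_norm].
Qed.

Lemma oproj_idem S v : oproj S (oproj S v) = oproj S v.
Proof. by apply: oproj_id; exact: oproj_in. Qed.

(** The closed span is invariant under [T], and so is its orthogonal complement
    because the span is also invariant under the adjoint. *)
Lemma oproj_comm S (T T' : H -> H) : (forall u v, hdot (T u) v = hdot u (T' v)) ->
  linear T -> (forall s, S s -> cspan S (T s)) -> (forall s, S s -> cspan S (T' s)) ->
  forall u, T (oproj S u) = oproj S (T u).
Proof.
move=> TT' lT hT hT' u; apply/esym/oproj_uniq.
  move=> w ow; rewrite TT'; apply: (oproj_in _) => s Ss.
  by rewrite -TT'; apply: hT.
move=> s Ss; rewrite -(linB lT); apply: hdot_orthC; rewrite TT'; apply: hdot_orthC.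
by apply: hT' => //; exact: oproj_perp.
Qed.

(** Take a vector off the kernel and subtract its nearest point in the kernel:
    a multiple of the difference represents the functional. *)
Lemma riesz (f : H -> R[i]) (M : R) :
  (forall k u v, f (k *: u + v) = k * f u + f v) ->
  (forall u, cabs (f u) <= M * rnorm u) -> exists z, forall u, f u = hdot u z.
Proof.
move=> lf bf.
have f0 : f 0 = 0 by have := lf (-1) 0 0; rewrite scaler0 addr0 mulN1r addNr.
have fD u v : f (u + v) = f u + f v by rewrite -[u in LHS]scale1r lf mul1r.
have fZ k u : f (k *: u) = k * f u by rewrite -[_ *: _]addr0 lf f0 addr0.
have fB u v : f (u - v) = f u - f v by rewrite -scaleN1r fD fZ mulN1r.
have [[v fv]|nf] := pselect (exists v, f v <> 0); last first.
  exists 0 => u; rewrite hdot0r; apply: contrapT => fu; apply: nf.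
  by exists u.
have [||z [hz hz']] := @nearest_point _ H [set u | f u = 0] v.
- exact: f0.
- by move=> r x y /= fx fy; rewrite fD fZ fx fy mulr0 addr0.
have fz : f z = 0.
  apply/cabs_eq0/le_anti; rewrite cabs_ge0 andbT; apply: cvgS_le0 => e e0.
  have M0 : 0 < `|M| + 1 by rewrite ltr_wpDl.
  have [|g fg zg] := hz (e / (`|M| + 1)); first by rewrite divr_gt0.
  have -> : f z = f (z - g) by rewrite fB fg subr0.
  apply: le_trans (bf _) _; move: zg; rewrite ltr_pdivlMr // => zg.
  apply: le_trans (ltW zg); rewrite mulrC ler_wpM2l ?rnorm_ge0 //.
  by have := ler_norm M; lra.
set w := v - z in hz'.
have fw : f w = f v by rewrite fB fz subr0.
have wk g : f g = 0 -> hdot w g = 0.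
  move=> fg; apply: hdot_Re0; apply: hz' => //=.
  by rewrite fZ fg mulr0.
have ww : hdot w w != 0.
  by apply/eqP => /hdot_eq0 w0; apply: fv; rewrite -fw w0.
have fw0 : f w != 0 by rewrite fw; apply/eqP.
exists (Num.conj (f w / hdot w w) *: w) => u.
have h : hdot (u - (f u / f w) *: w) w = 0.
  by apply: hdot_orthC; apply: wk; rewrite fB fZ divfK // subrr.
move: h; rewrite hdotBl hdotZl => /eqP; rewrite subr_eq0 => /eqP h.
by rewrite hdotZr conjCK h; field; rewrite fw0 ww.
Qed.

End Projections.

Section Adjoint.
Variable R : realType.
Implicit Types H K : hilbertType R.

Definition is_adj H K (T : H -> K) (S : K -> H) :=
  forall u v, hdot (T u) v = hdot u (S v).

Lemma is_adj_sym H K (T : H -> K) S : is_adj T S -> is_adj S T.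
Proof. by move=> h u v; rewrite hdotC -h -hdotC. Qed.

Lemma is_adj_linear H K (T : H -> K) S : is_adj T S -> linear T.
Proof.
move=> h k u v; apply: hdot_ext => w.
by rewrite h !hdotDl !hdotZl !h.
Qed.

(** Cauchy-Schwarz, applied to the square of the norm of [S v]. *)
Lemma adj_bound H K (T : H -> K) (S : K -> H) (C : R) : 0 <= C ->
  is_adj T S -> (forall u, rnorm (T u) <= C * rnorm u) -> forall v, rnorm (S v) <= C * rnorm v.
Proof.
move=> C0 h hC v.
have [s0|s0] := eqVneq (rnorm (S v)) 0; first by rewrite s0 mulr_ge0 ?rnorm_ge0.
have sp : 0 < rnorm (S v) by rewrite lt_def s0 rnorm_ge0.
rewrite -(ler_pM2l sp) -expr2 rnorm_sq -h.
apply: le_trans (Re_lec _) _; apply: le_trans (hdot_CS _ _) _.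
rewrite [leRHS]mulrA [_ * C]mulrC; apply: ler_wpM2r; first exact: rnorm_ge0.
exact: hC.
Qed.

Lemma is_adj_bop H K (T : H -> K) S : bop T -> is_adj T S -> bop S.
Proof.
move=> bT h; split; first exact: is_adj_linear (is_adj_sym h).
have [M M0 hM] := bop_bound bT; exists M; exact: adj_bound (ltW M0) h hM.
Qed.

Lemma adj_ex H K (T : H -> K) : bop T -> exists S, is_adj T S.
Proof.
move=> bT; have [M M0 hM] := bop_bound bT.
have h v : exists z, forall u, hdot (T u) v = hdot u z.
  apply: (@riesz _ _ (fun u => hdot (T u) v) (M * rnorm v)).
    by move=> k u w; rewrite bT.1 hdotDl hdotZl.
  move=> u; apply: le_trans (hdot_CS _ _) _; rewrite mulrAC.
  by rewrite ler_wpM2r ?rnorm_ge0.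
by have [S hS] := choice h; exists S.
Qed.

Definition adj H K (T : H -> K) : K -> H := xget (fun _ => 0) [set S | is_adj T S].

Lemma adjP H K (T : H -> K) : bop T -> is_adj T (adj T).
Proof. by move=> /adj_ex [S hS]; apply: (xgetI _ hS). Qed.

Lemma adj_bop H K (T : H -> K) : bop T -> bop (adj T).
Proof. by move=> bT; exact: is_adj_bop (adjP bT). Qed.

Lemma adj_uniq H K (T : H -> K) S : bop T -> is_adj T S -> adj T = S.
Proof.
move=> bT h; apply/funext => v; apply: hdot_ext => w.
by rewrite !(is_adj_sym (adjP bT)) (is_adj_sym h).
Qed.

End Adjoint.

Section OperatorNorm.
Variables (R : realType) (H : hilbertType R).
Implicit Types (T : H -> H).

Lemma bopE T : bounded_operator T <-> bop T.
Proof.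
split=> [[lT cT]|bT]; first exact/bop_continuous.
by split; [exact: bT.1 | apply/bop_continuous; [exact: bT.1|]].
Qed.

Lemma opnorm_le T (M : R) : 0 <= M -> (forall u, rnorm (T u) <= M * rnorm u) ->
  opnorm T <= M.
Proof.
move=> M0 h; apply: ge_sup; first by exists (rnorm (T 0)), 0 => //=; rewrite rnorm0.
move=> _ [u /= u1 <-]; apply: le_trans (h u) _.
by rewrite -[leRHS]mulr1 ler_wpM2l.
Qed.

Lemma opnorm_bound T u : bop T -> rnorm (T u) <= opnorm T * rnorm u.
Proof.
move=> bT; have [M M0 hM] := bop_bound bT.
have [u0|u0] := eqVneq (rnorm u) 0.
  by rewrite u0 (rnorm_eq0 u0) (lin0 bT.1) rnorm0 mulr0.
have up : 0 < rnorm u by rewrite lt_def u0 rnorm_ge0.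
rewrite -ler_pdivrMr //; apply: sup_upper_bound.
  split; first by exists (rnorm (T 0)), 0 => //=; rewrite rnorm0.
  exists M => _ [v /= v1 <-]; apply: le_trans (hM v) _.
  by rewrite -[leRHS]mulr1 ler_pM2l.
exists ((rnorm u)^-1%:C *: u) => /=.
  by rewrite rnormZR ger0_norm ?invr_ge0 ?rnorm_ge0 // mulVf.
by rewrite (linZ bT.1) rnormZR ger0_norm ?invr_ge0 ?rnorm_ge0 // mulrC.
Qed.

Lemma opnorm_gt T (c : R) : c < opnorm T ->
  exists2 u, rnorm u <= 1 & c < rnorm (T u).
Proof.
move=> cT; have [||_ [u /= u1 <-] cu] := @sup_gt R [set rnorm (T u) | u in [set u | rnorm u <= 1]] c.
- by exists (rnorm (T 0)), 0 => //=; rewrite rnorm0.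
- exact: cT.
by exists u.
Qed.

End OperatorNorm.

(** * Constructing Hilbert spaces *)

(** Data from which a norm, a topology and an inner product are derived.
    Completeness is stated with the form, since no norm exists at this stage. *)
Record preHilbert (R : realType) := PreHilbert {
  ph_sort : lmodType R[i];
  ph_dot : ph_sort -> ph_sort -> R[i];
  ph_psd : psd ph_dot;
  ph_def : forall x, ph_dot x x = 0 -> x = 0;
  ph_complete : forall u : nat -> ph_sort,
    (forall e : R, 0 < e -> exists N, forall m n, (N <= m)%N -> (N <= n)%N ->
       Re (ph_dot (u m - u n) (u m - u n)) < e) ->
    exists l, forall e : R, 0 < e -> exists N, forall n, (N <= n)%N ->
       Re (ph_dot (u n - l) (u n - l)) < e
}.

Section HilbertOf.
Variables (R : realType) (D : preHilbert R).

Definition hilbert_of : Type := ph_sort D.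

HB.instance Definition _ := GRing.Lmodule.on hilbert_of.

Local Notation X := hilbert_of.
Local Notation s := (@ph_dot R D).
Let ps := ph_psd D.

Let nrm (x : X) : R := Num.sqrt (Re (s x x)).

Let nrm_sq x : nrm x ^+ 2 = Re (s x x).
Proof. by rewrite /nrm sqr_sqrtr // (psd_ge0 ps). Qed.

Let nrm_ge0 x : 0 <= nrm x. Proof. exact: sqrtr_ge0. Qed.

Let nrmD x y : (nrm (x + y))%:C <= (nrm x)%:C + (nrm y)%:C.
Proof.
rewrite -rmorphD /= lecR -(@ler_pXn2r _ 2) ?nnegrE ?nrm_ge0 ?addr_ge0 //.
rewrite sqrrD !nrm_sq (psd_sqD ps).
have : Re (s x y) <= nrm x * nrm y.
  apply: le_trans (Re_lec _) _.
  rewrite -(@ler_pXn2r _ 2) ?nnegrE ?cabs_ge0 ?mulr_ge0 // exprMn !nrm_sq.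
  exact: (psd_CS ps).
move: (nrm x * nrm y) => a; lra.
Qed.

Let nrmZ (k : R[i]) x : (nrm (k *: x))%:C = `|k| * (nrm x)%:C.
Proof.
rewrite cabsE -rmorphM; congr (_%:C); apply/eqP.
rewrite -(@eqrXn2 _ 2) ?mulr_ge0 ?cabs_ge0 // exprMn !nrm_sq; apply/eqP.
exact: (psd_sqZ ps).
Qed.

Let nrm_eq0 x : (nrm x)%:C = 0 -> x = 0.
Proof.
move=> /(@complexI R) h; apply: (@ph_def _ D); rewrite (psd_real ps).
by rewrite -nrm_sq h expr0n.
Qed.

HB.instance Definition _ := Lmodule_isNormed.Build R[i] X nrmD nrmZ nrm_eq0.

Let rnormX (x : X) : rnorm x = nrm x. Proof. by []. Qed.

Let X_complete (F : set_system X) : ProperFilter F -> cauchy F -> cvg F.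
Proof.
apply: seq_complete => u cu.
have [|l ul] := @ph_complete _ D u.
  move=> e e0; have [|N hN] := cu (Num.sqrt e); first by rewrite sqrtr_gt0.
  exists N => m n Nm Nn; have := hN m n Nm Nn.
  by rewrite rnormX /nrm ltr_sqrt.
exists l => e e0; have [|N hN] := ul (e ^+ 2); first by rewrite exprn_gt0.
exists N => n /hN h; rewrite rnormX -(@ltr_pXn2r _ 2) ?nnegrE ?nrm_ge0 ?ltW //.
by rewrite nrm_sq.
Qed.

HB.instance Definition _ := Uniform_isComplete.Build X X_complete.

End HilbertOf.

Section HilbertOfDot.
Variables (R : realType) (D : preHilbert R).

Local Notation X := (hilbert_of D).
Local Notation ps := (ph_psd D).

Definition ph_dotX : X -> X -> R[i] := @ph_dot R D.

Let dotX_bilinear : bilinear_for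
  (GRing.Scale.Law.clone _ _ *%R _) (GRing.Scale.Law.clone _ _ (Num.conj \; *%R) _)
  ph_dotX.
Proof.
split=> [u'|u] a x y; rewrite /ph_dotX /=.
  by rewrite (psdDl ps) (psdZl ps).
by rewrite (psdDr ps) (psdZr ps).
Qed.

HB.instance Definition _ := bilinear_isBilinear.Build R[i] X X R[i] _ _ ph_dotX
  dotX_bilinear.

Let dotX_herm x y : ph_dotX x y = (-1) ^+ false * Num.conj (ph_dotX y x).
Proof. by rewrite expr0 mul1r; exact: (psdC ps). Qed.

HB.instance Definition _ := isHermitianSesquilinear.Build R[i] X false Num.conj ph_dotX
  dotX_herm.

Let dotX_pos x : x != 0 -> 0 < ph_dotX x x.
Proof.
move=> x0; rewrite /ph_dotX (psd_real ps) ltcR lt_def (psd_ge0 ps) andbT.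
apply/eqP => h; move/eqP: x0; apply; apply: (@ph_def _ D).
by rewrite (psd_real ps) h.
Qed.

HB.instance Definition _ := isDotProduct.Build R[i] X ph_dotX dotX_pos.

Let dotX_norm (u : X) : `|u| ^+ 2 = ph_dotX u u.
Proof.
rewrite /ph_dotX (psd_real ps) rnormE -rmorphXn /=; congr (_%:C).
by rewrite sqr_sqrtr // (psd_ge0 ps).
Qed.

HB.instance Definition _ := isHilbert.Build R X dotX_norm.

End HilbertOfDot.

(** * Finite sums of Hilbert spaces *)

Section FinitePower.
Variables (R : realType) (I : finType) (H : hilbertType R).

Let dotI (u v : {ffun I -> H}) : R[i] := \sum_i hdot (u i) (v i).

Let dotI_psd : psd dotI.
Proof.
split=> [x y z|k x z|x y|x]; rewrite /dotI.
- by rewrite -big_split; apply: eq_bigr => i _; rewrite ffunE hdotDl.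
- by rewrite mulr_sumr; apply: eq_bigr => i _; rewrite ffunE hdotZl.
- by rewrite rmorph_sum; apply: eq_bigr => i _; exact: hdotC.
- by rewrite Re_sum sumr_ge0 // => i _; rewrite -rnorm_sq sqr_ge0.
Qed.

Let dotI_comp (x : {ffun I -> H}) i : rnorm (x i) ^+ 2 <= Re (dotI x x).
Proof.
rewrite /dotI Re_sum (bigD1 i) //= -rnorm_sq lerDl sumr_ge0 // => j _.
by rewrite -rnorm_sq sqr_ge0.
Qed.

Let dotI_def (x : {ffun I -> H}) : dotI x x = 0 -> x = 0.
Proof.
move=> h; apply/ffunP => i; rewrite ffunE; apply: rnorm_eq0; apply/eqP.
by rewrite -sqrf_eq0; apply/eqP/le_anti; rewrite sqr_ge0 andbT (le_trans (dotI_comp x i)) // h.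
Qed.

Let dotI_complete (u : nat -> {ffun I -> H}) :
  (forall e : R, 0 < e -> exists N, forall m n, (N <= m)%N -> (N <= n)%N ->
       Re (dotI (u m - u n) (u m - u n)) < e) ->
  exists l, forall e : R, 0 < e -> exists N, forall n, (N <= n)%N ->
       Re (dotI (u n - l) (u n - l)) < e.
Proof.
move=> cu; have hl i : exists l, ecvg (fun n => u n i) l.
  apply: complete_seq => e e0; have [|N hN] := cu (e ^+ 2); first by rewrite exprn_gt0.
  exists N => m n Nm Nn; rewrite -(@ltr_pXn2r _ 2) ?nnegrE ?rnorm_ge0 ?ltW //.
  apply: le_lt_trans (hN m n Nm Nn); apply: le_trans (dotI_comp _ i).
  by rewrite !ffunE.
have [l hl'] := choice hl; exists [ffun i => l i] => e e0.
have d0 : 0 < e / (#|I|.+1%:R) by rewrite divr_gt0 // ltr0n.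
have hN i : exists N, forall n, (N <= n)%N -> rnorm (u n i - l i) ^+ 2 < e / (#|I|.+1%:R).
  have [|N hN] := hl' i (Num.sqrt (e / (#|I|.+1%:R))); first by rewrite sqrtr_gt0.
  exists N => n /hN h; rewrite -[ltRHS]sqr_sqrtr ?ltW //.
  by rewrite ltr_pXn2r ?nnegrE ?rnorm_ge0 ?sqrtr_ge0.
have [N hN'] := choice hN; exists (\max_i N i)%N => n Nn.
rewrite /dotI Re_sum.
apply: (@le_lt_trans _ _ (\sum_(i : I) e / (#|I|.+1%:R))).
  apply: ler_sum => i _; rewrite -rnorm_sq !ffunE; apply/ltW/hN'.
  exact: leq_trans (leq_bigmax i) Nn.
rewrite sumr_const -[ltLHS]mulr_natr mulrAC ltr_pdivrMr ?ltr0n //.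
by rewrite ltr_pM2l // ltr_nat.
Qed.

Definition pre_power : preHilbert R := PreHilbert dotI_psd dotI_def dotI_complete.
Definition hpower : hilbertType R := hilbert_of pre_power.

Lemma hpowerE (u v : {ffun I -> H}) :
  hdot (u : hpower) (v : hpower) = \sum_i hdot (u i) (v i).
Proof. by []. Qed.

Lemma hpower_comp (u : {ffun I -> H}) i : rnorm (u i) <= rnorm (u : hpower).
Proof.
rewrite -(@ler_pXn2r _ 2) ?nnegrE ?rnorm_ge0 //.
by rewrite [in leRHS]rnorm_sq dotI_comp.
Qed.

End FinitePower.

Section DirectSum.
Variables (R : realType) (H K : hilbertType R).

Let dotS (u v : H * K) : R[i] := hdot u.1 v.1 + hdot u.2 v.2.

Let dotS_psd : psd dotS.
Proof.
split=> [x y z|k x z|x y|x]; rewrite /dotS /=.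
- by rewrite !hdotDl addrACA.
- by rewrite !hdotZl mulrDr.
- by rewrite rmorphD /= -!hdotC.
- by rewrite ReD -!rnorm_sq addr_ge0 // sqr_ge0.
Qed.

Let dotS_sq x : Re (dotS x x) = rnorm x.1 ^+ 2 + rnorm x.2 ^+ 2.
Proof. by rewrite /dotS ReD -!rnorm_sq. Qed.

Let sqr0 (V : normedModType R[i]) (x : V) : rnorm x ^+ 2 <= 0 -> x = 0.
Proof.
move=> h; apply: rnorm_eq0; apply/eqP; rewrite -sqrf_eq0; apply/eqP/le_anti.
by rewrite h sqr_ge0.
Qed.

Let dotS_def x : dotS x x = 0 -> x = 0.
Proof.
case: x => a b /(congr1 (@complex.Re R)); rewrite dotS_sq /= => h.
have h1 := sqr_ge0 (rnorm a); have h2 := sqr_ge0 (rnorm b).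
have -> : a = 0 by apply: sqr0; lra.
have -> // : b = 0 by apply: sqr0; lra.
Qed.

Let dotS_complete (u : nat -> H * K) :
  (forall e : R, 0 < e -> exists N, forall m n, (N <= m)%N -> (N <= n)%N ->
       Re (dotS (u m - u n) (u m - u n)) < e) ->
  exists l, forall e : R, 0 < e -> exists N, forall n, (N <= n)%N ->
       Re (dotS (u n - l) (u n - l)) < e.
Proof.
move=> cu.
have [l1 hl1] : exists l, ecvg (fun n => (u n).1) l.
  apply: complete_seq => e e0; have [|N hN] := cu (e ^+ 2); first by rewrite exprn_gt0.
  exists N => m n Nm Nn; rewrite -(@ltr_pXn2r _ 2) ?nnegrE ?rnorm_ge0 ?ltW //.
  by apply: le_lt_trans (hN m n Nm Nn); rewrite dotS_sq /= lerDl sqr_ge0.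
have [l2 hl2] : exists l, ecvg (fun n => (u n).2) l.
  apply: complete_seq => e e0; have [|N hN] := cu (e ^+ 2); first by rewrite exprn_gt0.
  exists N => m n Nm Nn; rewrite -(@ltr_pXn2r _ 2) ?nnegrE ?rnorm_ge0 ?ltW //.
  by apply: le_lt_trans (hN m n Nm Nn); rewrite dotS_sq /= lerDr sqr_ge0.
exists (l1, l2) => e e0; have d0 : 0 < Num.sqrt (e / 2) by rewrite sqrtr_gt0 half_gt0.
have [N1 h1] := hl1 _ d0; have [N2 h2] := hl2 _ d0; exists (maxn N1 N2) => n.
rewrite geq_max => /andP[/h1 {}h1 /h2 {}h2]; rewrite dotS_sq /=.
have sq (V : normedModType R[i]) (x : V) : rnorm x < Num.sqrt (e / 2) -> rnorm x ^+ 2 < e / 2.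
  move=> h; rewrite -[ltRHS]sqr_sqrtr ?ltW ?half_gt0 //.
  by rewrite ltr_pXn2r ?nnegrE ?rnorm_ge0 ?sqrtr_ge0.
by move: (sq _ _ h1) (sq _ _ h2); lra.
Qed.

Definition pre_sum : preHilbert R := PreHilbert dotS_psd dotS_def dotS_complete.
Definition hsum : hilbertType R := hilbert_of pre_sum.

Lemma hsumE (u v : H * K) :
  hdot (u : hsum) (v : hsum) = hdot u.1 v.1 + hdot u.2 v.2.
Proof. by []. Qed.

Lemma hsum_sq (u : H * K) : rnorm (u : hsum) ^+ 2 = rnorm u.1 ^+ 2 + rnorm u.2 ^+ 2.
Proof. by rewrite [LHS]rnorm_sq dotS_sq. Qed.

End DirectSum.

Lemma real_seq_complete (R : realType) (u : nat -> R) :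
  (forall e, 0 < e -> exists N, forall m n, (N <= m)%N -> (N <= n)%N -> `|u m - u n| < e) ->
  exists l, forall e, 0 < e -> exists N, forall n, (N <= n)%N -> `|u n - l| < e.
Proof.
move=> cu; have /cauchy_cvg/cvg_ex[l ul] : cauchy (u @ \oo).
  apply/cauchy_ballP => e e0.
  have [N hN] := cu e e0.
  exists (u @` [set n | (N <= n)%N], u @` [set n | (N <= n)%N]) => /=.
    by split; exists N => // n /= Nn; exists n.
  by move=> [_ _] [/= [m Nm <-] [n Nn <-]]; exact: hN.
exists l => e e0; move/cvgrPdist_lt: ul => /(_ e e0) [N _ hN].
by exists N => n Nn; rewrite distrC; exact: hN.
Qed.

Lemma complex_seq_complete (R : realType) (u : nat -> R[i]) :
  (forall e, 0 < e -> exists N, forall m n, (N <= m)%N -> (N <= n)%N -> cabs (u m - u n) < e) ->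
  exists l, forall e, 0 < e -> exists N, forall n, (N <= n)%N -> cabs (u n - l) < e.
Proof.
move=> cu.
have [a ha] : exists l, forall e, 0 < e ->
    exists N, forall n, (N <= n)%N -> `|Re (u n) - l| < e.
  apply: real_seq_complete => e /cu[N hN]; exists N => m n Nm Nn.
  by apply: le_lt_trans (hN m n Nm Nn); rewrite -ReB Re_le_cabs.
have [b hb] : exists l, forall e, 0 < e ->
    exists N, forall n, (N <= n)%N -> `|Im (u n) - l| < e.
  apply: real_seq_complete => e /cu[N hN]; exists N => m n Nm Nn.
  by apply: le_lt_trans (hN m n Nm Nn); rewrite -ImN -ImD Im_le_cabs.
exists (Complex a b) => e e0.
have [N1 h1] := ha _ (half_gt0 e0); have [N2 h2] := hb _ (half_gt0 e0).
exists (maxn N1 N2) => n; rewrite geq_max => /andP[/h1 {}h1 /h2 {}h2].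
apply: le_lt_trans (cabs_le _) _; rewrite ReB ImD ImN /=; lra.
Qed.

(** * The Hilbert space of a positive semidefinite form *)

Section FormDual.
Variables (R : realType) (E : lmodType R[i]) (s : E -> E -> R[i]).

Definition form_dual_pred (h : E -> R[i]^o) : bool :=
  `[< (forall k x y, h (k *: x + y) = Num.conj k * h x + h y) /\
      exists M : R, forall x, cabs (h x) ^+ 2 <= M * Re (s x x) >].

(** The completion of the form is realized as its space of bounded antilinear
    functionals: completeness is then pointwise and no quotient is needed. *)
Record form_dual := FormDual {
  form_dual_fun : E -> R[i]^o;
  form_dualP : form_dual_pred form_dual_fun
}.

End FormDual.

Section FormDualSpace.
Variables (R : realType) (E : lmodType R[i]) (s : E -> E -> R[i]) (ps : psd s).

Lemma form_dual_submod : subsemimod_closed (form_dual_pred s).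
Proof.
split; first split.
- apply/asboolP; split; first by move=> k x y; rewrite mulr0 addr0.
  by exists 0 => x; rewrite cabs0 expr0n mul0r.
- move=> f g /asboolP[fl [M hM]] /asboolP[gl [N hN]].
  have fgE x : (f + g) x = f x + g x by [].
  apply/asboolP; split.
    by move=> k x y; rewrite !fgE fl gl mulrDr addrACA.
  exists (2 * M + 2 * N) => x; rewrite fgE.
  have := cabsD (f x) (g x); rewrite -(@ler_pXn2r _ 2) ?nnegrE ?addr_ge0 ?cabs_ge0 //.
  have := sqr_ge0 (cabs (f x) - cabs (g x)); rewrite sqrrB sqrrD.
  have := hM x; have := hN x.
  move: (cabs (f x) * cabs (g x)) => p h1 h2 h3 h4; apply: (le_trans h4).
  rewrite mulrDl -!mulrA; lra.
- move=> k f /asboolP[fl [M hM]].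
  have kfE x : (k *: f) x = k * f x by [].
  apply/asboolP; split.
    by move=> a x y; rewrite !kfE fl mulrDr mulrCA.
  exists (cabs k ^+ 2 * M) => x; rewrite kfE.
  by rewrite cabsM exprMn -mulrA ler_wpM2l ?sqr_ge0.
Qed.

HB.instance Definition _ :=
  GRing.isSubmodClosed.Build R[i] (E -> R[i]^o) (form_dual_pred s) form_dual_submod.

Local Notation X := (form_dual s).

HB.instance Definition _ := [isSub for @form_dual_fun R E s].
HB.instance Definition _ := [Choice of X by <:].
HB.instance Definition _ := [SubChoice_isSubZmodule of X by <:].
HB.instance Definition _ := [SubZmodule_isSubLmodule of X by <:].

Definition fd (h : X) (x : E) : R[i] := form_dual_fun h x.

Lemma fdD h k x : fd (h + k) x = fd h x + fd k x. Proof. by []. Qed.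
Lemma fdZ a h x : fd (a *: h) x = a * fd h x. Proof. by []. Qed.
Lemma fd0 x : fd 0 x = 0. Proof. by []. Qed.
Lemma fdB h k x : fd (h - k) x = fd h x - fd k x. Proof. by []. Qed.

Lemma fd_ext h k : (forall x, fd h x = fd k x) -> h = k.
Proof. by move=> hk; apply/val_inj/funext. Qed.

Lemma fdP h : (forall k x y, fd h (k *: x + y) = Num.conj k * fd h x + fd h y) /\
      exists M : R, forall x, cabs (fd h x) ^+ 2 <= M * Re (s x x).
Proof. by case: h => f fP; move/asboolP: (fP). Qed.

Lemma fdDr h x y : fd h (x + y) = fd h x + fd h y.
Proof. by rewrite -[x in LHS]scale1r (fdP h).1 rmorph1 mul1r. Qed.
Lemma fd0r h : fd h 0 = 0.
Proof. by apply: (addrI (fd h 0)); rewrite -fdDr !addr0. Qed.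
Lemma fdZr h k x : fd h (k *: x) = Num.conj k * fd h x.
Proof. by rewrite -[_ *: x]addr0 (fdP h).1 fd0r addr0. Qed.
Lemma fdBr h x y : fd h (x - y) = fd h x - fd h y.
Proof. by rewrite -scaleN1r fdDr fdZr rmorphN1 mulN1r. Qed.

Lemma fdNr h x : fd h (- x) = - fd h x.
Proof. by rewrite -[- x]add0r fdBr fd0r add0r. Qed.

Lemma mk_fd (f : E -> R[i]) (M : R) :
  (forall k x y, f (k *: x + y) = Num.conj k * f x + f y) ->
  (forall x, cabs (f x) ^+ 2 <= M * Re (s x x)) ->
  exists h : X, forall x, fd h x = f x.
Proof.
move=> fl fM; have fP : form_dual_pred s f by apply/asboolP; split=> //; exists M.
by exists (FormDual fP).
Qed.

Let ss x : 0 <= Re (s x x). Proof. exact: (psd_ge0 ps). Qed.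

(** The squared norm of a functional, in the variational form that makes the
    distance to the represented functionals explicit (see [qD_hat]). *)
Let Q (h : X) := [set 2 * Re (fd h b) - Re (s b b) | b in [set: E]].
Let q (h : X) : R := sup (Q h).

Let Q_ub h (M : R) : 0 <= M -> (forall x, cabs (fd h x) ^+ 2 <= M * Re (s x x)) ->
  ubound (Q h) M.
Proof.
move=> M0 hM _ [b _ <-].
have h1 : cabs (fd h b) <= Num.sqrt M * Num.sqrt (Re (s b b)).
  rewrite -(@ler_pXn2r _ 2) ?nnegrE ?mulr_ge0 ?sqrtr_ge0 ?cabs_ge0 //.
  by rewrite exprMn !sqr_sqrtr.
have := sqr_ge0 (Num.sqrt M - Num.sqrt (Re (s b b))).
rewrite sqrrB !sqr_sqrtr //.
have := Re_lec (fd h b); move: (Num.sqrt M * _) h1 => p; lra.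
Qed.

Let Q_sup h : has_sup (Q h).
Proof.
split; first by exists (2 * Re (fd h 0) - Re (s 0 0)), 0.
have [_ [M hM]] := fdP h; exists `|M|; apply: Q_ub => // x.
by apply: le_trans (hM x) _; rewrite ler_wpM2r // ler_norm.
Qed.

Let q_ub h b : 2 * Re (fd h b) - Re (s b b) <= q h.
Proof. by apply: sup_upper_bound => //; exists b. Qed.

Let q_ge0 h : 0 <= q h.
Proof. by have := q_ub h 0; rewrite fd0r (psd0l ps) /= mulr0 subr0. Qed.

Let q_min h (M : R) : 0 <= M -> (forall x, cabs (fd h x) ^+ 2 <= M * Re (s x x)) ->
  q h <= M.
Proof. by move=> M0 hM; apply: ge_sup; [exact: (Q_sup h).1 | exact: Q_ub]. Qed.

Let q_bound h x : cabs (fd h x) ^+ 2 <= q h * Re (s x x).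
Proof.
apply: quad_ge0 => // t; have [w [w1 hw]] := phase (fd h x).
have := q_ub h ((Num.conj w * t%:C) *: x).
rewrite (psd_sqZ ps) fdZr rmorphM /= conjCK conjE conjc_real mulrAC hw.
rewrite -rmorphM /= cabsM cabs_conj w1 mul1r cabsR real_normK ?num_real //.
lra.
Qed.

Let n h := Num.sqrt (q h).
Let n_ge0 h : 0 <= n h. Proof. exact: sqrtr_ge0. Qed.
Let n_sq h : n h ^+ 2 = q h. Proof. by rewrite sqr_sqrtr. Qed.

Let n_bound h x : cabs (fd h x) <= n h * Num.sqrt (Re (s x x)).
Proof.
rewrite -(@ler_pXn2r _ 2) ?nnegrE ?mulr_ge0 ?sqrtr_ge0 ?cabs_ge0 //.
by rewrite exprMn n_sq sqr_sqrtr.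
Qed.

Let n_min h (M : R) : 0 <= M -> (forall x, cabs (fd h x) <= M * Num.sqrt (Re (s x x))) ->
  n h <= M.
Proof.
move=> M0 hM; rewrite -(@ler_pXn2r _ 2) ?nnegrE // n_sq; apply: q_min => [|x].
  exact: sqr_ge0.
rewrite -[Re _]sqr_sqrtr // -exprMn ler_pXn2r ?nnegrE ?cabs_ge0 //.
by rewrite mulr_ge0 ?sqrtr_ge0.
Qed.

Let nD h k : n (h + k) <= n h + n k.
Proof.
apply: n_min => [|x]; first exact: addr_ge0.
rewrite fdD; apply: le_trans (cabsD _ _) _; rewrite mulrDl.
by rewrite lerD ?n_bound.
Qed.

Let nZ a h : n (a *: h) = cabs a * n h.
Proof.
have le a' h' : n (a' *: h') <= cabs a' * n h'.
  apply: n_min => [|x]; first by rewrite mulr_ge0 ?cabs_ge0.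
  by rewrite fdZ cabsM -mulrA ler_wpM2l ?cabs_ge0 ?n_bound.
apply/le_anti; rewrite le /=; have [->|a0] := eqVneq a 0.
  by rewrite cabs0 mul0r.
have a1 : cabs a^-1 * cabs a = 1.
  by rewrite -cabsM mulVf // -(rmorph1 (real_complex R)) cabsR normr1.
have := le a^-1 (a *: h); rewrite scalerA mulVf // scale1r => h1.
have := ler_wpM2l (cabs_ge0 a) h1.
by rewrite mulrA [_ * cabs _]mulrC a1 mul1r.
Qed.

Let nC h k : n (h - k) = n (k - h).
Proof.
by rewrite -opprB -scaleN1r nZ cabsN -(rmorph1 (real_complex R)) cabsR normr1 mul1r.
Qed.

Let n_eq0 h : n h = 0 -> h = 0.
Proof.
move=> h0; apply: fd_ext => x; rewrite fd0; apply: cabs_eq0; apply/le_anti.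
by rewrite cabs_ge0 andbT; have := n_bound h x; rewrite h0 mul0r.
Qed.

Lemma hat_ex b : exists h : X, forall x, fd h x = s b x.
Proof.
apply: (mk_fd (M := Re (s b b))) => [k x y|x].
  by rewrite (psdDr ps) (psdZr ps).
by rewrite (psd_CS ps).
Qed.

Definition hat b : X := projT1 (cid (hat_ex b)).

Lemma hatE b x : fd (hat b) x = s b x.
Proof. by rewrite /hat; case: cid. Qed.

Lemma hatD x y : hat (x + y) = hat x + hat y.
Proof. by apply: fd_ext => z; rewrite fdD !hatE (psdDl ps). Qed.
Lemma hatZ k x : hat (k *: x) = k *: hat x.
Proof. by apply: fd_ext => z; rewrite fdZ !hatE (psdZl ps). Qed.

(** Translating the variable of the supremum by [b] computes [q] exactly along
    the represented functionals; the polarization of [q] is therefore an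
    evaluation on them. *)
Let qD_hat h b : q (h + hat b) = q h + 2 * Re (fd h b) + Re (s b b).
Proof.
have le h' b' : q (h' + hat b') <= q h' + 2 * Re (fd h' b') + Re (s b' b').
  apply: ge_sup; first exact: (Q_sup _).1.
  move=> _ [c _ <-]; rewrite fdD hatE ReD.
  have := q_ub h' (c - b'); rewrite fdBr (psd_sqB ps) ReB (psdReC ps c).
  lra.
apply/le_anti; rewrite le /=.
have := le (h + hat b) (- b).
have -> : h + hat b + hat (- b) = h by rewrite -addrA -hatD subrr -(scale0r (0 : E)) hatZ scale0r addr0.
by rewrite fdD hatE fdNr (psdNl ps) !(psdNr ps) opprK ReD !ReN; lra.
Qed.

Let q0 : q 0 = 0.
Proof.
by apply/le_anti; rewrite q_ge0 andbT; apply: q_min => // x; rewrite fd0 cabs0 expr0n mul0r.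
Qed.

(** An approximate maximizer [b] of the supremum is close to [h], by [qD_hat]. *)
Let hat_dense h (e : R) : 0 < e -> exists b, n (h - hat b) < e.
Proof.
move=> e0; have e2 : 0 < e ^+ 2 by rewrite exprn_gt0.
have [_ [b _ <-] hb] := sup_adherent e2 (Q_sup h).
exists b; rewrite -(@ltr_pXn2r _ 2) ?nnegrE ?(ltW e0) // n_sq.
have -> : h - hat b = h + hat (- b) by rewrite -scaleN1r hatZ scaleN1r.
rewrite qD_hat fdNr (psdNl ps) (psdNr ps) opprK ReN.
rewrite -/(q h) in hb; lra.
Qed.

(** Polarization of the squared norm [q]; the imaginary part is the real part
    against ['i%C *: k]. *)
Let re h k : R := (q (h + k) - q h - q k) / 2.
Let ip h k : R[i] := Complex (re h k) (re h ('i%C *: k)).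

Let re_hat h b : re h (hat b) = Re (fd h b).
Proof.
rewrite /re qD_hat; have := qD_hat 0 b; rewrite add0r q0 fd0 /= => ->.
by field.
Qed.

Let ip_hat h b : ip h (hat b) = fd h b.
Proof.
apply: eqC; rewrite /= ?re_hat // -hatZ re_hat fdZr conjE ReM /=.
by ring.
Qed.

Let reC h k : re h k = re k h.
Proof. by rewrite /re [h + k]addrC addrAC. Qed.

Let re_lip h z : exists2 C : R, 0 <= C &
  forall k, n (z - k) <= 1 -> `|re h z - re h k| <= C * n (z - k).
Proof.
exists (n h + 2 * n z + 2); first by rewrite !addr_ge0 // mulr_ge0.
move=> k zk.
have lipq x y : `|q x - q y| <= n (x - y) * (n x + n y).
  rewrite -!n_sq subr_sqr normrM [X in _ * X]ger0_norm ?addr_ge0 //.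
  rewrite ler_wpM2r ?addr_ge0 // ler_norml.
  have := nD (x - y) y; rewrite subrK; have := nD (y - x) x; rewrite subrK (nC y); lra.
have h1 := lipq (h + z) (h + k); have h2 := lipq z k.
have e1 : h + z - (h + k) = z - k by rewrite opprD addrACA subrr add0r.
rewrite e1 in h1.
have h3 : n k <= n z + 1.
  by have := nD (k - z) z; rewrite subrK (nC k); lra.
have h4 := nD h z; have h5 := nD h k.
have -> : re h z - re h k = ((q (h + z) - q (h + k)) - (q z - q k)) / 2.
  by rewrite /re; field.
have i2 : 0 <= 2^-1 :> R by rewrite invr_ge0.
rewrite normrM (ger0_norm i2) ler_pdivrMr //.
apply: le_trans (ler_normB _ _) _; apply: le_trans (lerD h1 h2) _.
rewrite -mulrDr [leRHS]mulrAC mulrC; apply: ler_wpM2r => //; lra.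
Qed.

Let ip_lip h z : exists2 C : R, 0 <= C &
  forall k, n (z - k) <= 1 -> cabs (ip h z - ip h k) <= C * n (z - k).
Proof.
have [C C0 hC] := re_lip h z; have [C' C'0 hC'] := re_lip h ('i%C *: z).
exists (C + C'); first exact: addr_ge0.
move=> k zk; apply: le_trans (cabs_le _) _; rewrite ReB ImD ImN /= mulrDl.
apply: lerD; first exact: hC.
have i1 : cabs ('i%C : R[i]) = 1.
  by rewrite /cabs normc_def /= expr0n add0r expr1n sqrtr1.
have ni : n ('i%C *: z - 'i%C *: k) = n (z - k) by rewrite -scalerBr nZ i1 mul1r.
by rewrite -ni; apply: hC'; rewrite ni.
Qed.

Let ip_sq x : Re (ip x x) = n x ^+ 2.
Proof.
rewrite /= /re.
have -> : x + x = (2 : R)%:C *: x.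
  by rewrite -[x in LHS]scale1r -scalerDl -(rmorph1 (real_complex R)) -rmorphD.
rewrite -!n_sq nZ cabsR (@ger0_norm _ 2) // exprMn.
by field.
Qed.

(** Identities between inner products hold as soon as they hold against the
    represented functionals, by density and continuity. *)
Let ip_density (D : X -> R[i]) z (C : R) : 0 <= C ->
  (forall k, n (z - k) <= 1 -> cabs (D z - D k) <= C * n (z - k)) ->
  (forall b, D (hat b) = 0) -> D z = 0.
Proof.
move=> C0 hC hD; apply/cabs_eq0/le_anti; rewrite cabs_ge0 andbT; apply: cvgS_le0 => e e0.
have C1 : 0 < C + 1 by rewrite ltr_wpDl.
have m0 : 0 < Num.min 1 (e / (C + 1)) by rewrite lt_min ltr01 divr_gt0.
have [b hb] := hat_dense z m0; move: hb; rewrite lt_min => /andP[/ltW hb1 hb2].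
have := hC _ hb1; rewrite hD subr0 => /le_trans; apply.
rewrite ltr_pdivlMr // in hb2; apply: le_trans (ltW hb2).
by rewrite mulrC ler_wpM2l //; lra.
Qed.

Let ip_psd : psd ip.
Proof.
have ZL a x z : ip (a *: x) z = a * ip x z.
  apply/eqP; rewrite -subr_eq0; apply/eqP.
  have [C C0 hC] := ip_lip (a *: x) z; have [C' C'0 hC'] := ip_lip x z.
  apply: (@ip_density (fun z => ip (a *: x) z - a * ip x z) z (C + cabs a * C')).
  - by rewrite addr_ge0 // mulr_ge0 ?cabs_ge0.
  - move=> k zk /=.
    have -> : ip (a *: x) z - a * ip x z - (ip (a *: x) k - a * ip x k) =
       (ip (a *: x) z - ip (a *: x) k) - a * (ip x z - ip x k) by ring.
    apply: le_trans (cabsD _ _) _; rewrite cabsN cabsM mulrDl -mulrA.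
    by apply: lerD; [exact: hC | rewrite ler_wpM2l ?cabs_ge0 //; exact: hC'].
  - by move=> b; rewrite !ip_hat fdZ subrr.
split=> //.
- move=> x y z; apply/eqP; rewrite -subr_eq0; apply/eqP.
  have [C C0 hC] := ip_lip (x + y) z; have [C1 C10 hC1] := ip_lip x z.
  have [C2 C20 hC2] := ip_lip y z.
  apply: (@ip_density (fun z => ip (x + y) z - (ip x z + ip y z)) z (C + (C1 + C2))).
  - by rewrite !addr_ge0.
  - move=> k zk /=.
    have -> : ip (x + y) z - (ip x z + ip y z) - (ip (x + y) k - (ip x k + ip y k)) =
      (ip (x + y) z - ip (x + y) k) + (- (ip x z - ip x k) + - (ip y z - ip y k)) by ring.
    apply: le_trans (cabsD _ _) _; rewrite mulrDl; apply: lerD; first exact: hC.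
    apply: le_trans (cabsD _ _) _; rewrite !cabsN mulrDl; apply: lerD.
      exact: hC1.
    exact: hC2.
  - by move=> b; rewrite !ip_hat fdD subrr.
- move=> x y; apply: eqC; first by rewrite Re_conj /= reC.
  rewrite Im_conj /= reC -[LHS]/(Re (ip ('i%C *: y) x)) ZL ReM /= mul0r mul1r sub0r.
  by [].
- by move=> x; rewrite ip_sq sqr_ge0.
Qed.

Let ip_def x : ip x x = 0 -> x = 0.
Proof.
move=> /(congr1 (@complex.Re R)); rewrite ip_sq => /eqP; rewrite sqrf_eq0 => /eqP.
exact: n_eq0.
Qed.

(** A Cauchy sequence of functionals converges pointwise; the limit is bounded
    because the estimates are uniform in the argument. *)
Let ip_complete (u : nat -> X) :
  (forall e : R, 0 < e -> exists N, forall m n, (N <= m)%N -> (N <= n)%N ->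
       Re (ip (u m - u n) (u m - u n)) < e) ->
  exists l, forall e : R, 0 < e -> exists N, forall n, (N <= n)%N ->
       Re (ip (u n - l) (u n - l)) < e.
Proof.
move=> cu.
have {}cu e : 0 < e -> exists N, forall m k, (N <= m)%N -> (N <= k)%N -> n (u m - u k) < e.
  move=> e0; have [|N hN] := cu (e ^+ 2); first by rewrite exprn_gt0.
  exists N => m k Nm Nk; have := hN m k Nm Nk; rewrite ip_sq.
  by rewrite ltr_pXn2r ?nnegrE // ltW.
have hl x : exists l, forall e, 0 < e ->
    exists N, forall k, (N <= k)%N -> cabs (fd (u k) x - l) < e.
  apply: complex_seq_complete => e e0.
  have x0 : 0 < Num.sqrt (Re (s x x)) + 1 by rewrite ltr_wpDl ?sqrtr_ge0.
  have [|N hN] := cu (e / (Num.sqrt (Re (s x x)) + 1)); first by rewrite divr_gt0.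
  exists N => m k Nm Nk; have := hN m k Nm Nk; rewrite -fdB ltr_pdivlMr //.
  apply: le_lt_trans; apply: le_trans (n_bound _ _) _.
  by rewrite ler_wpM2l //; lra.
have [l hl'] := choice hl.
have lim_le x (y : R[i]) (M : R) :
    (exists N, forall k, (N <= k)%N -> cabs (fd (u k) x - y) <= M) -> cabs (l x - y) <= M.
  move=> [N hN]; rewrite -subr_le0; apply: cvgS_le0 => e /(hl' x)[N' hN'].
  have := hN' (maxn N N') (leq_maxr _ _); have := hN (maxn N N') (leq_maxl _ _).
  have := cabsD (l x - fd (u (maxn N N')) x) (fd (u (maxn N N')) x - y).
  by rewrite addrA subrK (cabsB (l x) (fd _ _)); lra.
have lbound e : 0 < e -> exists N, forall k, (N <= k)%N -> forall x,
    cabs (l x - fd (u k) x) <= e * Num.sqrt (Re (s x x)).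
  move=> /cu[N hN]; exists N => k Nk x; apply: lim_le.
  exists N => m Nm; rewrite -fdB; apply: le_trans (n_bound _ _) _.
  by rewrite ler_wpM2r ?sqrtr_ge0 // ltW // hN.
have [N hN] := lbound 1 ltr01.
have ll k x y : l (k *: x + y) = Num.conj k * l x + l y.
  apply/eqP; rewrite -subr_eq0; apply/eqP/cabs_eq0/le_anti; rewrite cabs_ge0 andbT.
  apply: cvgS_le0 => e e0; have e3 : 0 < e / 3 by rewrite divr_gt0.
  have k1 : 0 < cabs k + 1 by rewrite ltr_wpDl ?cabs_ge0.
  have [N1 h1] := hl' (k *: x + y) _ e3; have [N2 h2] := hl' y _ e3.
  have [|N3 h3] := hl' x (e / 3 / (cabs k + 1)); first by rewrite divr_gt0.
  pose m := maxn N1 (maxn N2 N3).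
  have {}h1 := h1 m (leq_maxl _ _).
  have {}h2 := h2 m (leq_trans (leq_maxl _ _) (leq_maxr _ _)).
  have := h3 m (leq_trans (leq_maxr _ _) (leq_maxr _ _)).
  rewrite ltr_pdivlMr // => {}h3.
  have -> : l (k *: x + y) - (Num.conj k * l x + l y) =
     - (fd (u m) (k *: x + y) - l (k *: x + y)) +
     (Num.conj k * (fd (u m) x - l x) + (fd (u m) y - l y)).
    by rewrite (fdP (u m)).1; ring.
  apply: le_trans (cabsD _ _) _; rewrite cabsN.
  have := cabsD (Num.conj k * (fd (u m) x - l x)) (fd (u m) y - l y).
  rewrite cabsM cabs_conj.
  have h4 : cabs k * cabs (fd (u m) x - l x) <= cabs (fd (u m) x - l x) * (cabs k + 1).
    by rewrite mulrC ler_wpM2l ?cabs_ge0 //; lra.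
  move: h4 h3 h1 h2; lra.
have [h hE] : exists h : X, forall x, fd h x = l x.
  apply: (mk_fd (M := (1 + n (u N)) ^+ 2)) => // x.
  rewrite -[Re _]sqr_sqrtr // -exprMn ler_pXn2r ?nnegrE ?cabs_ge0 ?mulr_ge0 ?sqrtr_ge0 ?addr_ge0 //.
  have := hN N (leqnn _) x; have := n_bound (u N) x.
  have := cabsD (l x - fd (u N) x) (fd (u N) x); rewrite subrK mulrDl; lra.
exists h => e e0; have [|N' hN'] := lbound (Num.sqrt (e / 2)); first by rewrite sqrtr_gt0 half_gt0.
exists N' => k N'k; rewrite ip_sq.
apply: (@le_lt_trans _ _ (Num.sqrt (e / 2) ^+ 2)).
  rewrite ler_pXn2r ?nnegrE ?sqrtr_ge0 // nC; apply: n_min => [|x]; first exact: sqrtr_ge0.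
  by rewrite fdB hE; exact: hN'.
by rewrite sqr_sqrtr; lra.
Qed.

Definition pre_dual : preHilbert R := PreHilbert ip_psd ip_def ip_complete.
Definition hdual : hilbertType R := hilbert_of pre_dual.

Lemma hdual_hat (h : X) b : hdot (h : hdual) (hat b : hdual) = fd h b.
Proof. exact: ip_hat. Qed.

Lemma hdual_min (h : X) (M : R) : 0 <= M ->
  (forall x, cabs (fd h x) <= M * Num.sqrt (Re (s x x))) -> rnorm (h : hdual) <= M.
Proof.
move=> M0 hM; rewrite -(@ler_pXn2r _ 2) ?nnegrE ?rnorm_ge0 //.
rewrite [leLHS](rnorm_sq (h : hdual)) [leLHS]ip_sq ler_pXn2r ?nnegrE //.
exact: n_min.
Qed.

Lemma hdual_bound (h : X) x : cabs (fd h x) <= rnorm (h : hdual) * Num.sqrt (Re (s x x)).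
Proof.
have -> : rnorm (h : hdual) = n h; last exact: n_bound.
apply/eqP; rewrite -(@eqrXn2 _ 2) ?rnorm_ge0 //.
by rewrite [X in X == _](rnorm_sq (h : hdual)) [X in X == _]ip_sq.
Qed.

End FormDualSpace.

(** * Contractivity and the norm of a C*-algebra *)

Section CstarBasics.
Variables (R : realType) (A : cstarAlgType R).
Implicit Types (x y z : A).

Lemma cmulNl x y : cmul (- x) y = - cmul x y.
Proof. by rewrite -scaleN1r cmulZl scaleN1r. Qed.
Lemma cmulNr x y : cmul x (- y) = - cmul x y.
Proof. by rewrite -scaleN1r cmulZr scaleN1r. Qed.
Lemma cmulBl x y z : cmul (x - y) z = cmul x z - cmul y z.
Proof. by rewrite cmulDl cmulNl. Qed.
Lemma cmulBr x y z : cmul z (x - y) = cmul z x - cmul z y.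
Proof. by rewrite cmulDr cmulNr. Qed.
Lemma cstar0 : cstar 0 = 0 :> A.
Proof. by apply: (addrI (cstar 0)); rewrite -cstarD !addr0. Qed.
Lemma cstarN x : cstar (- x) = - cstar x.
Proof. by rewrite -scaleN1r cstarZ rmorphN1 scaleN1r. Qed.
Lemma cstarB x y : cstar (x - y) = cstar x - cstar y.
Proof. by rewrite cstarD cstarN. Qed.
Lemma cstarZR (r : R) x : cstar (r%:C *: x) = r%:C *: cstar x.
Proof. by rewrite cstarZ conjE conjc_real. Qed.

Lemma rnormM x y : rnorm (cmul x y) <= rnorm x * rnorm y.
Proof. by rewrite -lecR rmorphM /= -!rnormE cnormM. Qed.

Lemma rnorm_starM x : rnorm (cmul (cstar x) x) = rnorm x ^+ 2.
Proof. by apply: (@complexI R); rewrite rmorphXn /= -!rnormE cnorm_star. Qed.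

Lemma rnorm_star x : rnorm (cstar x) = rnorm x.
Proof.
have le z : rnorm z <= rnorm (cstar z).
  have [z0|z0] := eqVneq (rnorm z) 0; first by rewrite z0 rnorm_ge0.
  have zp : 0 < rnorm z by rewrite lt_def z0 rnorm_ge0.
  by rewrite -(ler_pM2r zp) -expr2 -rnorm_starM rnormM.
by apply/le_anti; rewrite le andbT; have := le (cstar x); rewrite cstarK.
Qed.

Lemma cmul_lim (u v : nat -> A) x y : ecvg u x -> ecvg v y ->
  ecvg (fun n => cmul (u n) (v n)) (cmul x y).
Proof.
move=> ux vy e e0; pose M := rnorm x + rnorm y + 1.
have M0 : 0 < M by rewrite ltr_wpDl // addr_ge0 ?rnorm_ge0.
have d0 : 0 < Num.min 1 (e / (2 * M)) by rewrite lt_min ltr01 divr_gt0 // mulr_gt0.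
have [N1 h1] := ux _ d0; have [N2 h2] := vy _ d0; exists (maxn N1 N2) => n.
rewrite geq_max => /andP[/h1 {}h1 /h2 {}h2].
move: h1 h2; rewrite !lt_min => /andP[a1 a2] /andP[b1 b2].
have -> : cmul (u n) (v n) - cmul x y =
    cmul (u n - x) (v n) + cmul x (v n - y).
  by rewrite cmulBl cmulBr addrA subrK.
apply: le_lt_trans (rnormD _ _) _.
have vn : rnorm (v n) <= rnorm y + 1 by have := rnorm_leB (v n) y; lra.
have c1 : rnorm (cmul (u n - x) (v n)) <= rnorm (u n - x) * M.
  apply: le_trans (rnormM _ _) _; apply: ler_wpM2l; first exact: rnorm_ge0.
  by rewrite /M; have := rnorm_ge0 x; lra.
have c2 : rnorm (cmul x (v n - y)) <= rnorm (v n - y) * M.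
  apply: le_trans (rnormM _ _) _; rewrite mulrC; apply: ler_wpM2l; first exact: rnorm_ge0.
  by rewrite /M; have := rnorm_ge0 y; lra.
have hM : e / (2 * M) * M = e / 2 by field; rewrite gt_eqF.
have d1 : rnorm (u n - x) * M < e / 2 by rewrite -hM ltr_pM2r.
have d2 : rnorm (v n - y) * M < e / 2 by rewrite -hM ltr_pM2r.
lra.
Qed.

Lemma scale_half_split (E : lmodType R[i]) (x : E) : (1 / 2 : R)%:C *: (x + x) = x.
Proof.
rewrite scalerDr -scalerDl -rmorphD /=.
have -> : 1 / 2 + 1 / 2 = 1 :> R by field.
by rewrite rmorph1 scale1r.
Qed.

Section SquareRoot.
Variable b : A.
Hypothesis b1 : rnorm b <= 1.

Let g := fix g n := if n is m.+1 then (1 / 2 : R)%:C *: (b + cmul (g m) (g m)) else 0.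
Let gam := fix gam n : R := if n is m.+1 then (1 + gam m ^+ 2) / 2 else 0.

Let gam_le n : 0 <= gam n <= gam n.+1 /\ gam n.+1 <= 1.
Proof.
elim: n => [|n [/andP[h1 h2] h3]]; first by rewrite /= expr0n addr0; lra.
have h4 : gam n.+1 ^+ 2 <= 1 by rewrite expr_le1 // (le_trans h1).
have h5 : gam n ^+ 2 <= gam n.+1 ^+ 2 by rewrite ler_pXn2r ?nnegrE // (le_trans h1).
have e1 : gam n.+1 = (1 + gam n ^+ 2) / 2 by [].
have e2 : gam n.+2 = (1 + gam n.+1 ^+ 2) / 2 by [].
rewrite e2; split; last lra.
by apply/andP; split; [exact: le_trans h1 h2 | rewrite {1}e1; lra].
Qed.

Let gam_mono n j : gam n <= gam (n + j)%N.
Proof.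
elim: j => [|j IH]; first by rewrite addn0.
by rewrite addnS; apply: le_trans IH _; have [/andP[]] := gam_le (n + j).
Qed.
Let gam_le1 n : gam n <= 1.
Proof. by have [/andP[_ h] h'] := gam_le n; exact: le_trans h h'. Qed.

Let g_bound n : rnorm (g n) <= gam n.
Proof.
elim: n => [|n IH]; first by rewrite /= rnorm0.
rewrite [g _]/= rnormZR ger0_norm ?divr_ge0 // [gam _]/= mul1r mulrC.
apply: ler_wpM2r; first by rewrite invr_ge0.
apply: le_trans (rnormD _ _) _; apply: lerD => //.
apply: le_trans (rnormM _ _) _; rewrite expr2.
by apply: ler_pM => //; exact: rnorm_ge0.
Qed.

Let g_cauchy n j : rnorm (g (n + j)%N - g n) <= gam (n + j)%N - gam n.
Proof.
elim: n => [|n IH]; first by rewrite /= !subr0 g_bound.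
rewrite addSn [g _]/= -/g [X in _ - X]/= -/g -scalerBr opprD addrACA subrr add0r.
rewrite rnormZR ger0_norm ?divr_ge0 //.
have -> : gam (n + j).+1 - gam n.+1 = 1 / 2 * (gam (n + j) ^+ 2 - gam n ^+ 2).
  by rewrite /= -/gam; field.
apply: ler_wpM2l; first by rewrite divr_ge0.
have -> : cmul (g (n + j)) (g (n + j)) - cmul (g n) (g n) =
   cmul (g (n + j)) (g (n + j) - g n) + cmul (g (n + j) - g n) (g n).
  by rewrite cmulBl cmulBr addrA subrK.
apply: le_trans (rnormD _ _) _.
have h1 : rnorm (cmul (g (n + j)) (g (n + j) - g n)) <= gam (n + j) * (gam (n + j) - gam n).
  by apply: le_trans (rnormM _ _) _; apply: ler_pM => //; exact: rnorm_ge0.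
have h2 : rnorm (cmul (g (n + j) - g n) (g n)) <= (gam (n + j) - gam n) * gam n.
  by apply: le_trans (rnormM _ _) _; apply: ler_pM => //; exact: rnorm_ge0.
apply: le_trans (lerD h1 h2) _; rewrite le_eqVlt; apply/orP; left; apply/eqP; ring.
Qed.

(** The scalar iteration dominates the algebra one, so the latter converges in
    norm even on the boundary of the unit ball; [1 - g] is a square root of
    [1 - b] although the algebra has no unit. *)
Lemma cstar_sqrt : exists g, [/\ rnorm g <= 1, g + g = b + cmul g g
  & cstar b = b -> cstar g = g].
Proof.
pose S := range gam.
have hS : has_sup S by split; [exists (gam 0%N), 0%N | exists 1 => _ [n _ <-]].
have cg : ecauchy g.
  move=> e e0; have [_ [N _ <-] hN] := sup_adherent (half_gt0 e0) hS.
  have near k : (N <= k)%N -> rnorm (g k - g N) < e / 2.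
    move=> Nk; have := g_cauchy N (k - N); rewrite subnKC // => h.
    have : gam k <= sup S by apply: sup_upper_bound => //; exists k.
    by move: (sup S) hN => s; lra.
  exists N => m n /near h1 /near h2; have := rnorm_tri (g N) (g m) (g n).
  by rewrite (rnormC (g N) (g n)); lra.
have [l gl] := complete_seq cg.
have gl1 : ecvg (fun n => g n.+1) l.
  by move=> e /gl[N hN]; exists N => n Nn; apply: hN; rewrite leqW.
exists l; split.
- have := ecvg_le (y := 0) (M := 1) gl; rewrite subr0; apply; exists 0%N => n _.
  by rewrite subr0 (le_trans (g_bound n)).
- have gl2 : ecvg (fun n => g n.+1) ((1 / 2 : R)%:C *: (b + cmul l l)).
    move=> e e0; have [N hN] := cmul_lim gl gl e0; exists N => n /hN h.
    rewrite [g _]/= -/g -scalerBr opprD addrACA subrr add0r rnormZR ger0_norm ?divr_ge0 //.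
    by have := rnorm_ge0 (cmul (g n) (g n) - cmul l l); lra.
  rewrite {1 2}(ecvg_uniq gl1 gl2) -scalerDr -[RHS]scale_half_split.
  by [].
- move=> sb; have sg n : cstar (g n) = g n.
    elim: n => [|n IH]; first by rewrite /= cstar0.
    by rewrite [g _]/= -/g cstarZR cstarD cstarM sb IH.
  have gl2 : ecvg g (cstar l).
    move=> e /gl[N hN]; exists N => n /hN.
    by rewrite -[X in X - cstar l](sg n) -cstarB rnorm_star.
  exact: ecvg_uniq gl2 gl.
Qed.

End SquareRoot.

(** For a selfadjoint [b] in the unit ball, [1 - b = (1 - g)^2] acts as a positive
    operator; this is applied to the normalization of [x^* x]. *)
Lemma star_action_contr (E : lmodType R[i]) (s : E -> E -> R[i]) (act : A -> E -> E) :
  psd s -> (forall x y e, act (x + y) e = act x e + act y e) ->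
  (forall k x e, act (k *: x) e = k *: act x e) ->
  (forall x y e, act (cmul x y) e = act x (act y e)) ->
  (forall x e f, s (act x e) f = s e (act (cstar x) f)) ->
  forall x e, Re (s (act x e) (act x e)) <= rnorm x ^+ 2 * Re (s e e).
Proof.
move=> ps aD aZ aM aS x e.
have pos b : cstar b = b -> rnorm b <= 1 -> Re (s (act b e) e) <= Re (s e e).
  move=> sb /cstar_sqrt[g [_ gb /(_ sb) sg]].
  have := psd_ge0 ps (e - act g e).
  rewrite (psd_sqB ps) aS sg -aM => h.
  have h2 : s (act g e) e = s e (act g e) by rewrite aS sg.
  have : Re (s (act (g + g) e) e) = Re (s (act (b + cmul g g) e) e) by rewrite gb.
  rewrite !aD !(psdDl ps) !ReD h2 [in s (act (cmul g g) e) e]aS cstarM sg; lra.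
have [x0|x0] := eqVneq (rnorm x) 0.
  have -> : x = 0 by exact: rnorm_eq0.
  by rewrite -(scale0r (0 : A)) aZ scale0r (psd0l ps) rnormZ cabs0 mul0r expr0n mul0r.
have xp : 0 < rnorm x by rewrite lt_def x0 rnorm_ge0.
have := pos (((rnorm x) ^- 2)%:C *: cmul (cstar x) x).
rewrite cstarZR cstarM cstarK => /(_ erefl).
rewrite rnormZR rnorm_starM ger0_norm ?invr_ge0 ?sqr_ge0 // mulVf ?expf_neq0 //.
move=> /(_ (lexx _)); rewrite aZ (psdZl ps) ReZ aM aS cstarK.
by rewrite mulrC ler_pdivrMr ?exprn_gt0 // mulrC.
Qed.

End CstarBasics.

Section Representations.
Variables (R : realType) (A : cstarAlgType R).

Section OneRepresentation.
Variables (H : hilbertType R) (pi : representation A H).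
Implicit Types (x y : A) (u v : H).

Lemma rep_bop x : bop (pi x).
Proof. exact/bopE/rep_bounded. Qed.

Definition rep_lin x := (rep_bop x).1.

Lemma rep_adj x : is_adj (pi x) (pi (cstar x)).
Proof. by move=> u v; exact: rep_star. Qed.

Lemma rep0 u : pi 0 u = 0.
Proof. by rewrite -(scale0r (0 : A)) repZ scale0r. Qed.
Lemma repN x u : pi (- x) u = - pi x u.
Proof. by rewrite -scaleN1r repZ scaleN1r. Qed.
Lemma repB x y u : pi (x - y) u = pi x u - pi y u.
Proof. by rewrite repD repN. Qed.
Lemma repMu x y u : pi (cmul x y) u = pi x (pi y u).
Proof. by rewrite repM. Qed.

Lemma rep_contr x u : rnorm (pi x u) <= rnorm x * rnorm u.
Proof.
rewrite -(@ler_pXn2r _ 2) ?nnegrE ?mulr_ge0 ?rnorm_ge0 // exprMn.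
rewrite !(rnorm_sq (_ : H)).
apply: (star_action_contr (s := @hdot R H) (act := pi)).
- exact: hdot_psd.
- exact: repD.
- exact: repZ.
- exact: repMu.
- by move=> *; exact: rep_star.
Qed.

Lemma rep_sq x u : Re (hdot (pi (cmul (cstar x) x) u) u) = rnorm (pi x u) ^+ 2.
Proof. by rewrite repMu rep_adj cstarK rnorm_sq. Qed.

End OneRepresentation.

(** The norm is the supremum of the norms in representations.  Inner
    quasidiagonality contains this form of the Gelfand-Naimark theorem, and it
    is how order and functional calculus enter the proof. *)
Definition norm_determined := forall (x : A) (c : R), c < rnorm x ->
  exists (H : hilbertType R) (pi : representation A H) u,
    rnorm u <= 1 /\ c < rnorm (pi x u).

Lemma nd_le (nd : norm_determined) x (M : R) : 0 <= M ->
  (forall (H : hilbertType R) (pi : representation A H) u, rnorm (pi x u) <= M * rnorm u) ->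
  rnorm x <= M.
Proof.
move=> M0 h; rewrite leNgt; apply/negP => /nd[H [pi [u [u1 hu]]]].
have := le_trans (h H pi u) (ler_wpM2l M0 u1); lra.
Qed.

Lemma projection_bop (H : hilbertType R) (P : H -> H) : projection P ->
  [/\ bop P, forall u, P (P u) = P u & is_adj P P].
Proof.
move=> [/bopE bP PP Padj]; split=> // u.
by rewrite -[LHS]/((P \o P) u) PP.
Qed.

Lemma projection_norm (H : hilbertType R) (P : H -> H) u : projection P ->
  rnorm (P u) <= rnorm u.
Proof.
move=> /projection_bop[bP PP aP].
have h : hdot (P u) (u - P u) = 0 by rewrite aP (linB bP.1) PP subrr hdot0r.
rewrite -(@ler_pXn2r _ 2) ?nnegrE ?rnorm_ge0 // -[u in leRHS](subrK (P u)) rnorm_sqD.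
by rewrite (hdot_orthC h) /= mulr0 addr0 lerDr sqr_ge0.
Qed.

Lemma iqd_norm_determined : inner_quasidiagonal A -> norm_determined.
Proof.
move=> iqd x c cx; have e0 : 0 < rnorm x - c by rewrite subr_gt0.
have [H [pi [P [pP _ _ /(_ ord0) [_ hP]]]]] := iqd 1%N (fun _ => x) _ e0.
rewrite opprB addrC subrK in hP.
have [u u1 hu] := opnorm_gt hP.
exists H, pi, (P u); split; first exact: le_trans (projection_norm u pP) u1.
by apply: lt_le_trans hu _; exact: projection_norm pP.
Qed.

End Representations.

Section Contractions.
Variables (R : realType) (H : hilbertType R).
Implicit Types (u v : H) (T : H -> H).

(** [T^2] lies between 0 and 1, hence so does [1 - T^2]. *)
Lemma sa_sq_contr T u : is_adj T T -> (forall u, rnorm (T u) <= rnorm u) ->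
  rnorm (u - T (T u)) <= rnorm u.
Proof.
move=> aT cT; rewrite -(@ler_pXn2r _ 2) ?nnegrE ?rnorm_ge0 // rnorm_sqB.
rewrite -aT -rnorm_sq.
have : rnorm (T (T u)) ^+ 2 <= rnorm (T u) ^+ 2 by rewrite ler_pXn2r ?nnegrE ?rnorm_ge0.
have := sqr_ge0 (rnorm (T u)); lra.
Qed.

(** A selfadjoint operator is controlled by its numerical radius: polarize and
    test on a multiple of [T u]. *)
Lemma sa_numerical T u : bop T -> is_adj T T ->
  (forall u, `|Re (hdot (T u) u)| <= rnorm u ^+ 2) -> rnorm (T u) <= rnorm u.
Proof.
move=> bT aT hT.
have pol v : 2 * Re (hdot (T u) v) <= rnorm u ^+ 2 + rnorm v ^+ 2.
  have h1 := hT (u + v); have h2 := hT (u - v).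
  rewrite (linD bT.1) hdotDl !hdotDr !ReD in h1.
  rewrite (linB bT.1) hdotBl !hdotBr !ReB in h2.
  have e : Re (hdot (T v) u) = Re (hdot (T u) v) by rewrite aT (psdReC (@hdot_psd R H)).
  rewrite e rnorm_sqD in h1; rewrite e rnorm_sqB in h2.
  move: h1 h2; rewrite !ler_norml => /andP[_ h1] /andP[h2 _]; lra.
have [t0|t0] := eqVneq (rnorm (T u)) 0; first by rewrite t0 rnorm_ge0.
have tp : 0 < rnorm (T u) by rewrite lt_def t0 rnorm_ge0.
have := pol ((rnorm u / rnorm (T u))%:C *: T u).
rewrite hdotZr conjE conjc_real ReZ -rnorm_sq rnormZR ger0_norm ?divr_ge0 ?rnorm_ge0 //.
have -> : rnorm u / rnorm (T u) * rnorm (T u) ^+ 2 = rnorm u * rnorm (T u) by field.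
rewrite divfK // => h.
have [u0|u0] := eqVneq (rnorm u) 0.
  by rewrite (rnorm_eq0 u0) (lin0 bT.1).
have up : 0 < rnorm u by rewrite lt_def u0 rnorm_ge0.
by rewrite -(ler_pM2l up) -expr2; lra.
Qed.

End Contractions.

Section NormDetermined.
Variables (R : realType) (A : cstarAlgType R).
Implicit Types (x y h a b c : A).

Lemma rep_sqC (H : hilbertType R) (pi : representation A H) a u :
  rnorm a <= 1 ->
  rnorm (pi (cmul (cstar a) a) u) ^+ 2 <= Re (hdot (pi (cmul (cstar a) a) u) u).
Proof.
move=> a1; rewrite rep_sq repMu ler_pXn2r ?nnegrE ?rnorm_ge0 //.
apply: le_trans (rep_contr _ _ _) _; rewrite rnorm_star.
by rewrite -[leRHS]mul1r ler_wpM2r ?rnorm_ge0.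
Qed.

(** In a representation, both terms are operators between 0 and 1. *)
Lemma nd_pos (nd : norm_determined A) c a : rnorm c <= 1 -> rnorm a <= 1 ->
  rnorm (cmul (cstar c) c - cmul (cstar a) a) <= 1.
Proof.
move=> c1 a1; apply: (nd_le nd) => // H pi u; rewrite mul1r.
apply: sa_numerical; first exact: rep_bop.
  by move=> v w; rewrite rep_adj cstarB !cstarM !cstarK.
move=> v; rewrite repB hdotBl ReB !rep_sq.
have le x : rnorm x <= 1 -> rnorm (pi x v) ^+ 2 <= rnorm v ^+ 2.
  move=> x1; rewrite ler_pXn2r ?nnegrE ?rnorm_ge0 //.
  apply: le_trans (rep_contr _ _ _) _.
  by rewrite -[leRHS]mul1r ler_wpM2r ?rnorm_ge0.
have := le _ c1; have := le _ a1; have := sqr_ge0 (rnorm (pi c v)).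
have := sqr_ge0 (rnorm (pi a v)); rewrite ler_norml => *; apply/andP; split; lra.
Qed.

(** Formally [1 - c n] is the power [n] of [1 - h], a positive contraction.  The
    norm of [(1 - h)^n b] decreases like the inverse square root of [n], and
    even powers make [c n] a contraction. *)
Section ApproximateUnit.
Variables (b : A) (b1 : rnorm b <= 1).
Let h : A := cmul b (cstar b).
Let c := fix c n : A := if n is m.+1 then c m + (h - cmul h (c m)) else 0.

Section InRep.
Variables (H : hilbertType R) (pi : representation A H).
Let S (u : H) := u - pi h u.

Let S_adj : is_adj S S.
Proof.
move=> u v; rewrite /S hdotBl hdotBr rep_adj /h cstarM cstarK.
by [].
Qed.

Let S_contr u : rnorm (S u) <= rnorm u.
Proof.
rewrite -(@ler_pXn2r _ 2) ?nnegrE ?rnorm_ge0 // /S rnorm_sqB.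
rewrite (psdReC (@hdot_psd R H)).
have := @rep_sqC H pi (cstar b) u; rewrite rnorm_star cstarK => /(_ b1).
have := sqr_ge0 (rnorm (pi h u)); rewrite -/h; lra.
Qed.

Let c_iter n u : u - pi (c n) u = iter n S u.
Proof.
elim: n u => [|n IH] u; first by rewrite /= rep0 subr0.
rewrite [c _]/= -/c repD repB repMu iterS -IH /S.
by rewrite (linB (rep_lin pi h)) opprB opprD addrA opprB addrA.
Qed.

Let iter_adj n : is_adj (iter n S) (iter n S).
Proof.
elim: n => [|n IH] u v //; by rewrite [iter _ _ u]iterS S_adj IH -iterSr.
Qed.

Let iter_contr n u : rnorm (iter n S u) <= rnorm u.
Proof. by elim: n => [|n IH] //=; apply: le_trans (S_contr _) IH. Qed.

Lemma au_contr n u : rnorm (pi (c (n + n)%N) u) <= rnorm u.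
Proof.
have -> : pi (c (n + n)%N) u = u - iter n S (iter n S u).
  by rewrite -iterD -c_iter opprB addrC subrK.
by apply: sa_sq_contr => // v.
Qed.

Let S' (u : H) := u - pi (cmul (cstar b) b) u.

Let iter_b n u : iter n S (pi b u) = pi b (iter n S' u).
Proof.
elim: n => [|n IH] //=; rewrite IH /S /S' (linB (rep_lin pi b)) /h.
by rewrite !repMu.
Qed.

(* The squares of the norms of [S^m b u] are bounded by a telescoping sum. *)
Let telescope v : rnorm (pi b v) ^+ 2 <= rnorm v ^+ 2 - rnorm (S' v) ^+ 2.
Proof.
rewrite /S' rnorm_sqB (psdReC (@hdot_psd R H)) rep_sq.
have := @rep_sqC H pi b v b1; rewrite rep_sq; lra.
Qed.

Lemma au_small n u : n%:R * rnorm (pi (b - cmul (c n) b) u) ^+ 2 <= rnorm u ^+ 2.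
Proof.
have -> : pi (b - cmul (c n) b) u = iter n S (pi b u) by rewrite repB repMu c_iter.
suff : n%:R * rnorm (iter n S (pi b u)) ^+ 2 <= rnorm u ^+ 2 - rnorm (iter n S' u) ^+ 2.
  by have := sqr_ge0 (rnorm (iter n S' u)); lra.
elim: n => [|n IH]; first by rewrite mul0r subrr.
have t := telescope (iter n S' u); rewrite -iter_b in t.
have m : rnorm (iter n.+1 S (pi b u)) ^+ 2 <= rnorm (iter n S (pi b u)) ^+ 2.
  by rewrite ler_pXn2r ?nnegrE ?rnorm_ge0 //= S_contr.
have n0 : 0 <= n%:R :> R by [].
have m2 := ler_wpM2l n0 m; rewrite -natr1 mulrDl mul1r.
rewrite [iter n.+1 S' u]/= in t *; lra.
Qed.

End InRep.

Lemma au_unit_ball (nd : norm_determined A) (d : R) : 0 < d ->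
  exists c, rnorm c <= 1 /\ rnorm (b - cmul c b) < d.
Proof.
move=> d0; have [N hN] := inv_small (exprn_gt0 2 (half_gt0 d0)).
exists (c (N.+1 + N.+1)%N); split.
  by apply: (nd_le nd) => // H pi u; rewrite mul1r au_contr.
apply: (@le_lt_trans _ _ (d / 2)); last lra.
apply: (nd_le nd) => [|H pi u]; first lra.
have d2 : 0 < d / 2 by exact: half_gt0.
have nn : 0 <= d / 2 * rnorm u by apply: mulr_ge0; [exact: ltW | exact: rnorm_ge0].
rewrite -(@ler_pXn2r _ 2) ?nnegrE ?rnorm_ge0 //.
rewrite exprMn; have := au_small pi (N.+1 + N.+1) u.
rewrite natrD mulrDl; have := hN N (leqnn _).
have n0 : 0 < N.+1%:R :> R by rewrite ltr0n.
have s0 := sqr_ge0 (rnorm (pi (b - cmul (c (N.+1 + N.+1)) b) u)).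
move: (rnorm _ ^+ 2) s0 => s s0 hd hs.
have h1 : N.+1%:R * s <= rnorm u ^+ 2.
  by have := mulr_ge0 (ltW n0) s0; lra.
have h2 : s <= N.+1%:R^-1 * rnorm u ^+ 2 by rewrite mulrC ler_pdivlMr // mulrC.
by apply: le_trans h2 _; apply: ler_wpM2r; [exact: sqr_ge0 | exact: ltW].
Qed.

End ApproximateUnit.

Lemma nd_approx_unit (nd : norm_determined A) b (d : R) : 0 < d ->
  exists c, rnorm c <= 1 /\ rnorm (b - cmul c b) < d.
Proof.
move=> d0; have M0 : 0 < rnorm b + 1 by rewrite ltr_wpDl ?rnorm_ge0.
have [||c [c1 hc]] := @au_unit_ball ((rnorm b + 1)^-1%:C *: b) _ nd (d / (rnorm b + 1)).
- rewrite rnormZR ger0_norm ?invr_ge0 ?(ltW M0) // mulrC ler_pdivrMr //; lra.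
- by rewrite divr_gt0.
exists c; split=> //; move: hc.
rewrite cmulZr -scalerBr rnormZR ger0_norm ?invr_ge0 ?(ltW M0) //.
by rewrite mulrC ltr_pM2r // invr_gt0.
Qed.

End NormDetermined.

Section InjectiveIsometric.
Variables (R : realType) (A B : cstarAlgType R) (phi : starHom A B).

Section PullBack.
Variables (H : hilbertType R) (pi : representation B H).

Let f (x : A) : H -> H := pi (phi x).

Definition rep_pull : representation A H.
Proof.
refine (@Representation R A H f _ _ _ _ _); rewrite /f.
- by move=> x; exact: rep_bounded.
- by move=> x y u; rewrite linearD repD.
- by move=> k x u; rewrite linearZ repZ.
- by move=> x y; rewrite starHomM repM.
- by move=> x u v; rewrite rep_star starHom_star.
Defined.

Lemma rep_pullE x u : rep_pull x u = pi (phi x) u. Proof. by []. Qed.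

End PullBack.

Lemma starHom_contr (ndB : norm_determined B) x : rnorm (phi x) <= rnorm x.
Proof.
apply: (nd_le ndB) => [|H pi u]; first exact: rnorm_ge0.
by rewrite -rep_pullE rep_contr.
Qed.

(** If [phi] shrank some [h = a^* a] of norm one to norm [r < 1], put
    [x = h / r'] with [r < r' < 1].  Both [x] and the square root construction
    applied to [2 x - x^2] solve [2 g = b + g^2], and so do their images; but
    in [B] the solution is unique, because [phi x] has norm less than one.  By
    injectivity [x] is the square root solution, whose norm is at most one. *)
Lemma starHom_isometric (ndA : norm_determined A) (ndB : norm_determined B) :
  injective phi -> forall a, rnorm (phi a) = rnorm a.
Proof.
move=> inj a; apply/le_anti; rewrite starHom_contr //= leNgt; apply/negP => lt.
have ap : 0 < rnorm a := le_lt_trans (rnorm_ge0 _) lt.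
wlog a1 : a lt ap / rnorm a = 1.
  move=> /(_ ((rnorm a)^-1%:C *: a)); rewrite linearZ !rnormZR.
  have i0 : 0 < (rnorm a)^-1 by rewrite invr_gt0.
  rewrite (gtr0_norm i0) ltr_pM2l // mulVf ?gt_eqF //.
  by move=> h; apply: h.
pose h := cmul (cstar a) a; pose r := rnorm (phi h).
have h1 : rnorm h = 1 by rewrite rnorm_starM a1 expr1n.
have r0 : 0 <= r := rnorm_ge0 _.
have r1 : r < 1.
  rewrite /r /h starHomM starHom_star rnorm_starM.
  by rewrite expr_lt1 ?rnorm_ge0 //; rewrite a1 in lt.
pose t := 2 / (1 + r); pose x := t%:C *: h.
have t1 : 1 < t by rewrite /t ltr_pdivlMr; lra.
have t2 : t <= 2 by rewrite /t ler_pdivrMr; lra.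
have sh : cstar h = h by rewrite /h cstarM cstarK.
have sx : cstar x = x by rewrite cstarZR sh.
pose b := x + x - cmul x x.
have sb : cstar b = b by rewrite /b cstarB cstarD cstarM sx.
have b1 : rnorm b <= 1.
  apply: (nd_le ndA) => // H pi u; rewrite mul1r.
  pose T v := v - pi x v.
  have -> : pi b u = u - T (T u).
    rewrite /T /b repB repD repMu (linB (rep_lin pi x)).
    by rewrite !opprB [RHS]addrC addrA subrK [RHS]addrAC.
  apply: sa_sq_contr => [v w|v].
    by rewrite /T hdotBl hdotBr rep_adj sx.
  rewrite -(@ler_pXn2r _ 2) ?nnegrE ?rnorm_ge0 // /T rnorm_sqB repZ rnormZR.
  rewrite hdotZr conjE conjc_real ReZ (psdReC (@hdot_psd R H)) exprMn real_normK ?num_real //.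
  have a1' : rnorm a <= 1 by rewrite a1.
  have := @rep_sqC R A H pi a v a1'; rewrite -/h; have := sqr_ge0 (rnorm (pi h v)).
  move: (Re _) (rnorm (pi h v) ^+ 2) => p q q0 qp.
  have : t * (t * q) <= t * (2 * p).
    apply: ler_wpM2l; first lra.
    by apply: (@le_trans _ _ (2 * q)); [apply: ler_wpM2r | lra].
  by lra.
have [g [g1 gb _]] := cstar_sqrt b1.
pose U := phi x; pose V := phi g.
have U1 : rnorm U < 1.
  rewrite /U linearZ rnormZR gtr0_norm ?(lt_trans _ t1) // -/r /t.
  by rewrite mulrAC ltr_pdivrMr; lra.
have V1 : rnorm V <= 1 by apply: le_trans g1; exact: starHom_contr.
have UE : U + U = phi b + cmul U U.
  by rewrite /U /b linearB linearD starHomM subrK.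
have VE : V + V = phi b + cmul V V.
  by rewrite /V -starHomM -!linearD gb.
pose D := U - V.
have DE : D + D = cmul U D + cmul D V.
  have -> : cmul U D + cmul D V = cmul U U - cmul V V.
    by rewrite /D cmulBr cmulBl addrA subrK.
  rewrite /D addrACA -opprD UE VE.
  by rewrite opprD addrACA subrr add0r.
have D0 : D = 0.
  apply: rnorm_eq0; apply/eqP; rewrite eq_le rnorm_ge0 andbT leNgt; apply/negP => Dp.
  have : rnorm (D + D) <= rnorm U * rnorm D + rnorm D * rnorm V.
    by rewrite DE; apply: le_trans (rnormD _ _) _; apply: lerD; exact: rnormM.
  have -> : rnorm (D + D) = 2 * rnorm D.
    rewrite -[D in LHS]scale1r -scalerDl -(rmorph1 (real_complex R)) -rmorphD.
    by rewrite rnormZR ger0_norm // addr_ge0.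
  have : rnorm U * rnorm D < 1 * rnorm D by rewrite ltr_pM2r.
  have : rnorm D * rnorm V <= rnorm D * 1 by rewrite ler_pM2l.
  lra.
have xg : x = g by apply: inj; apply/eqP; rewrite -subr_eq0 -/U -/V -/D D0.
have : rnorm x = t by rewrite rnormZR h1 mulr1 gtr0_norm // (lt_trans _ t1).
rewrite xg => gt; lra.
Qed.

End InjectiveIsometric.

(** * Extreme extensions of functionals *)

Section ExtremeHahnBanach.
Variables (R : realType) (V : lmodType R[i]).
Implicit Types (q f g : V -> R) (x y d : V).

(** Only the real structure of the complex space [V] matters here; functionals
    are real-valued. *)
Definition sublin q := [/\ forall x y, q (x + y) <= q x + q y,
  forall (r : R) x, 0 < r -> q (r%:C *: x) <= r * q x & q 0 = 0].

Definition rlin f := (forall x y, f (x + y) = f x + f y) /\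
  (forall (r : R) x, f (r%:C *: x) = r * f x).

Lemma rlinN f x : rlin f -> f (- x) = - f x.
Proof. by move=> [_ fZ]; rewrite -scaleN1r -(rmorphN1 (real_complex R)) fZ mulN1r. Qed.

Lemma rlinB f x y : rlin f -> f (x - y) = f x - f y.
Proof. by move=> fl; rewrite fl.1 rlinN. Qed.

Lemma sublinZ q (r : R) x : sublin q -> 0 < r -> q (r%:C *: x) = r * q x.
Proof.
move=> [_ qZ _] r0; apply/le_anti; rewrite qZ //=.
have ri0 : 0 < r^-1 by rewrite invr_gt0.
have := qZ r^-1 (r%:C *: x) ri0.
rewrite scalerA -rmorphM /= mulVf ?gt_eqF // rmorph1 scale1r.
by rewrite -(ler_pM2l r0) mulrA divff ?gt_eqF // mul1r.
Qed.

Lemma inf_addr (S T : set R) (c : R) : S !=set0 -> T !=set0 ->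
  (forall a b, S a -> T b -> c <= a + b) -> c <= inf S + inf T.
Proof.
move=> S0 T0 h; rewrite -lerBlDr; apply: lb_le_inf => // a Sa.
rewrite lerBlDr -lerBlDl; apply: lb_le_inf => // b Tb.
by rewrite lerBlDl; exact: h.
Qed.

Variable q0 : V -> R.
Hypothesis sq0 : sublin q0.

(** The linear functionals below [q] form a face of those below [q0]: if the
    midpoint of two functionals lies in it, so do both. *)
Definition face q := [/\ sublin q, forall x, q x <= q0 x &
  forall f g, rlin f -> rlin g -> (forall x, f x <= q0 x) -> (forall x, g x <= q0 x) ->
  (forall x, f x + g x <= 2 * q x) -> (forall x, f x <= q x) /\ (forall x, g x <= q x)].

Let face0 : face q0. Proof. by []. Qed.

Let face_lb q x : face q -> - q0 (- x) <= q x.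
Proof.
move=> [[qD _ q00] qq0 _]; have := qD x (- x); rewrite subrr q00.
by have := qq0 (- x); lra.
Qed.

(** The face of the functionals of [q] that are maximal at [d]. *)
Let face_at q d x := inf [set q (x + t%:C *: d) - t * q d | t in [set t : R | 0 <= t]].

Let face_at_has q d x : face q ->
  has_inf [set q (x + t%:C *: d) - t * q d | t in [set t : R | 0 <= t]].
Proof.
move=> fq; have [[qD qZ q00] _ _] := fq; split.
  by exists (q (x + (0 : R)%:C *: d) - 0 * q d), 0 => /=.
exists (- q (- x)) => _ [t /= t0 <-].
have := qD (x + t%:C *: d) (- x); rewrite addrAC subrr add0r.
suff -> : q (t%:C *: d) = t * q d by lra.
move: t0; rewrite le_eqVlt => /orP[/eqP <-|t0]; last exact: sublinZ.
by rewrite rmorph0 scale0r mul0r.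
Qed.

Let face_at_le q d x (t : R) : face q -> 0 <= t ->
  face_at q d x <= q (x + t%:C *: d) - t * q d.
Proof.
by move=> fq t0; apply: ge_inf; [exact: (face_at_has d x fq).2 | exists t].
Qed.

Let face_at_leq q d x : face q -> face_at q d x <= q x.
Proof.
move=> fq; have := face_at_le d x fq (lexx 0).
by rewrite rmorph0 scale0r addr0 mul0r subr0.
Qed.

Let face_at_face q d : face q -> face (face_at q d).
Proof.
move=> fq; have [sq qq0 fqf] := fq; have [qD qZ q00] := sq.
have le x := face_at_leq d x fq.
have has x := face_at_has d x fq.
split.
- split.
  + move=> x y; apply: inf_addr; [exact: (has x).1 | exact: (has y).1|].
    move=> _ _ [t /= t0 <-] [t' /= t'0 <-].
    apply: le_trans (face_at_le d (x + y) fq (addr_ge0 t0 t'0)) _.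
    rewrite rmorphD scalerDl addrACA.
    by have := qD (x + t%:C *: d) (y + t'%:C *: d); lra.
  + move=> r x r0; rewrite mulrC -ler_pdivrMr //.
    apply: lb_le_inf; first exact: (has x).1.
    move=> _ [t /= t0 <-]; rewrite ler_pdivrMr //.
    have := face_at_le d (r%:C *: x) fq (mulr_ge0 (ltW r0) t0).
    by rewrite rmorphM -scalerA -scalerDr (@sublinZ q) //; lra.
  + apply/le_anti/andP; split; first by rewrite -[leRHS]q00.
    apply: lb_le_inf; first exact: (has 0).1.
    move=> _ [t /= t0 <-]; rewrite add0r.
    have [<-|t0'] := eqVneq 0 t.
      by rewrite rmorph0 scale0r q00 mul0r subr0.
    by rewrite sublinZ ?subrr // lt_def eq_sym t0'.
- by move=> x; apply: le_trans (le x) (qq0 x).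
- move=> f g lf lg fq0 gq0 fg.
  have [fle gle] : (forall x, f x <= q x) /\ (forall x, g x <= q x).
    by apply: fqf => // x; apply: le_trans (fg x) _; rewrite ler_pM2l.
  have := fg (- d); have := face_at_le d (- d) fq ler01.
  rewrite rmorph1 scale1r addNr q00 mul1r (@rlinN f d lf) (@rlinN g d lg) => h1 h2.
  have fd : f d = q d by have := fle d; have := gle d; lra.
  have gd : g d = q d by have := fle d; have := gle d; lra.
  have key k : rlin k -> (forall x, k x <= q x) -> k d = q d ->
      forall x, k x <= face_at q d x.
    move=> lk kle kd x; apply: lb_le_inf; first exact: (has x).1.
    move=> _ [t /= t0 <-]; have := kle (x + t%:C *: d).
    by rewrite lk.1 lk.2 kd; lra.
  by split; apply: key.
Qed.

(** Zorn's lemma gives a minimal face.  Restricting it to the functionals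
    maximal at any [d] does not change it, so all its functionals agree at [d]
    and [q] is linear: the face is an extreme point. *)
Lemma extreme_below : exists f, [/\ rlin f, forall x, f x <= q0 x &
  forall g, rlin g -> (forall x, f x + g x <= q0 x) -> (forall x, f x - g x <= q0 x) ->
  forall x, g x = 0].
Proof.
pose T := {q : V -> R | face q}.
pose Rel (q q' : T) : bool := `[< forall x, sval q' x <= sval q x >].
have [||A tA|[q fq] qmin] := @ZL_preorder T (exist _ q0 face0) Rel.
- by move=> t; apply/asboolP.
- move=> r s t /asboolP sr /asboolP ts; apply/asboolP => x.
  exact: le_trans (ts x) (sr x).
- have [[a Aa]|nA] := pselect (exists a, A a); last first.
    by exists (exist _ q0 face0) => s As; case: nA; exists s.
  pose S x := [set sval q x | q in A].
  have Shas x : has_inf (S x).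
    split; first by exists (sval a x), a.
    by exists (- q0 (- x)) => _ [[q fq] _ <-]; exact: face_lb.
  pose qi x := inf (S x).
  have qi_le (q : T) x : A q -> qi x <= sval q x.
    by move=> Aq; apply: ge_inf; [exact: (Shas x).2 | exists q].
  have fqi : face qi.
    split.
    + split.
      * move=> x y; apply: inf_addr; [exact: (Shas x).1 | exact: (Shas y).1|].
        move=> _ _ [q1 A1 <-] [q2 A2 <-].
        have [/asboolP h|/asboolP h] := tA _ _ A1 A2.
          have [[qD _ _] _ _] := svalP q2.
          by have := qi_le q2 (x + y) A2; have := qD x y; have := h x; lra.
        have [[qD _ _] _ _] := svalP q1.
        by have := qi_le q1 (x + y) A1; have := qD x y; have := h y; lra.
      * move=> r x r0; rewrite mulrC -ler_pdivrMr //.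
        apply: lb_le_inf; first exact: (Shas x).1.
        move=> _ [q Aq <-]; rewrite ler_pdivrMr //.
        have [sq _ _] := svalP q; have := qi_le q (r%:C *: x) Aq.
        by rewrite (@sublinZ (sval q)) // mulrC.
      * apply/le_anti/andP; split.
          by have := qi_le a 0 Aa; have [[_ _ ->] _ _] := svalP a.
        apply: lb_le_inf; first exact: (Shas 0).1.
        by move=> _ [q Aq <-]; have [[_ _ ->] _ _] := svalP q.
    + by move=> x; apply: le_trans (qi_le a x Aa) _; have [_ h _] := svalP a.
    + move=> f g lf lg fq0 gq0 fg.
      have h (q : T) : A q -> (forall x, f x <= sval q x) /\ (forall x, g x <= sval q x).
        move=> Aq; have [_ _ fqf] := svalP q; apply: fqf => // x.
        by apply: le_trans (fg x) _; rewrite ler_pM2l // qi_le.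
      split=> x; apply: lb_le_inf; [exact: (Shas x).1| |exact: (Shas x).1|].
        by move=> _ [q Aq <-]; exact: (h q Aq).1.
      by move=> _ [q Aq <-]; exact: (h q Aq).2.
  exists (exist _ qi fqi) => s As; apply/asboolP => x /=; exact: qi_le.
- have {}qmin q' : face q' -> (forall x, q' x <= q x) -> forall x, q x <= q' x.
    move=> fq' le; have /asboolP := qmin (exist _ q' fq') (introT (asboolP _) le).
    by [].
  have [sq qq0 fqf] := fq; have [qD qZ q00] := sq.
  have qN d : q (- d) = - q d.
    apply/le_anti/andP; split.
      have := qmin _ (face_at_face d fq) (fun x => face_at_leq d x fq) (- d).
      have := face_at_le d (- d) fq ler01.
      rewrite rmorph1 scale1r addNr q00 mul1r; lra.
    by have := qD d (- d); rewrite subrr q00; lra.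
  have lq : rlin q.
    split.
      move=> x y; apply/le_anti; rewrite qD /=.
      by have := qD (- x) (- y); rewrite -opprD !qN; lra.
    move=> r x; case: (ltgtP r 0) => r0.
    - have -> : r%:C *: x = - ((- r)%:C *: x) by rewrite rmorphN scaleNr opprK.
      by rewrite qN sublinZ ?oppr_gt0 // mulNr opprK.
    - by rewrite sublinZ.
    - by rewrite r0 rmorph0 scale0r mul0r.
  exists q; split=> // g lg h1 h2 x.
  have lqg : rlin (fun x => q x + g x).
    by split=> [y z|r y]; [rewrite lq.1 lg.1 | rewrite lq.2 lg.2]; ring.
  have lqg' : rlin (fun x => q x - g x).
    by split=> [y z|r y]; [rewrite lq.1 lg.1 | rewrite lq.2 lg.2]; ring.
  have [|||h3 h4] := fqf _ _ lqg lqg'; [exact: h1 | exact: h2 | by move=> y; lra |].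
  have := h3 x; have := h4 x; lra.
Qed.

End ExtremeHahnBanach.

Section StateExtension.
Variable R : realType.

(** The two facts about the larger algebra that the extension of states needs;
    both hold for algebras whose norm is determined by representations, and
    both pass to limits. *)
Definition pos_contr (L : cstarAlgType R) := forall c a : L,
  rnorm c <= 1 -> rnorm a <= 1 -> rnorm (cmul (cstar c) c - cmul (cstar a) a) <= 1.

Definition approx_unit (L : cstarAlgType R) := forall (b : L) (d : R), 0 < d ->
  exists c : L, rnorm c <= 1 /\ rnorm (b - cmul c b) < d.

Definition lin_fun (L : lmodType R[i]) (F : L -> R[i]) :=
  forall k x y, F (k *: x + y) = k * F x + F y.

Definition herm_fun (L : cstarAlgType R) (F : L -> R[i]) :=
  forall x, F (cstar x) = Num.conj (F x).

Section LinFun.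
Variables (L : lmodType R[i]) (F : L -> R[i]) (lF : lin_fun F).
Lemma lfD x y : F (x + y) = F x + F y.
Proof. by rewrite -[x in LHS]scale1r lF mul1r. Qed.
Lemma lf0 : F 0 = 0.
Proof. by apply: (addrI (F 0)); rewrite -lfD !addr0. Qed.
Lemma lfZ k x : F (k *: x) = k * F x.
Proof. by rewrite -[_ *: x]addr0 lF lf0 addr0. Qed.
Lemma lfB x y : F (x - y) = F x - F y.
Proof. by rewrite -scaleN1r lfD lfZ mulN1r. Qed.
End LinFun.

Variables (A L : cstarAlgType R) (iota : starHom A L).
Hypothesis iota_iso : forall a, rnorm (iota a) = rnorm a.
Hypothesis posL : pos_contr L.
Variables (H : hilbertType R) (pi : representation A H) (xi : H).
Hypothesis xi1 : rnorm xi = 1.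
Hypothesis xi_nd : forall d : R, 0 < d ->
  exists c : A, rnorm c <= 1 /\ rnorm (xi - pi c xi) < d.

Let w a : R := Re (hdot (pi a xi) xi).
Let p (x : L) : R := rnorm ((1 / 2 : R)%:C *: (x + cstar x)).

Let p_le x : p x <= rnorm x.
Proof.
rewrite /p rnormZR ger0_norm ?divr_ge0 //.
by have := rnormD x (cstar x); rewrite rnorm_star; lra.
Qed.

Let pD x y : p (x + y) <= p x + p y.
Proof. by rewrite /p cstarD addrACA scalerDr rnormD. Qed.

Let pZ (r : R) x : p (r%:C *: x) = `|r| * p x.
Proof. by rewrite /p cstarZR -scalerDr scalerA mulrC -scalerA rnormZR. Qed.

Let wD a b : w (a + b) = w a + w b.
Proof. by rewrite /w repD hdotDl ReD. Qed.

Let wZ (r : R) a : w (r%:C *: a) = r * w a.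
Proof. by rewrite /w repZ hdotZl ReZ. Qed.

Let wN a : w (- a) = - w a.
Proof. by rewrite /w repN hdotNl ReN. Qed.

Let w_le a : w a <= p (iota a).
Proof.
have -> : w a = w ((1 / 2 : R)%:C *: (a + cstar a)).
  rewrite wZ wD; have -> : w (cstar a) = w a.
    by rewrite /w rep_adj cstarK (psdReC (@hdot_psd R H)).
  by field.
rewrite /p -starHom_star -linearD -linearZ iota_iso.
apply: le_trans (Re_lec _) _; apply: le_trans (hdot_CS _ _) _.
by rewrite xi1 mulr1 (le_trans (rep_contr _ _ _)) // xi1 mulr1.
Qed.

Let q0 x := inf [set p (x + iota a) - w a | a in [set: A]].

Let q0_has x : has_inf [set p (x + iota a) - w a | a in [set: A]].
Proof.
split; first by exists (p (x + iota 0) - w 0), 0.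
exists (- p (- x)) => _ [a _ <-]; have := w_le a.
by have := pD (x + iota a) (- x); rewrite addrAC subrr add0r; lra.
Qed.

Let q0_le x a : q0 x <= p (x + iota a) - w a.
Proof. by apply: ge_inf; [exact: (q0_has x).2 | exists a]. Qed.

Let w0 : w 0 = 0. Proof. by rewrite /w rep0 hdot0l. Qed.

Let q0_lep x : q0 x <= p x.
Proof. by have := q0_le x 0; rewrite linear0 addr0 w0 subr0. Qed.

Let q0_sublin : sublin q0.
Proof.
split.
- move=> x y; apply: inf_addr; [exact: (q0_has x).1 | exact: (q0_has y).1|].
  move=> _ _ [a _ <-] [b _ <-]; have := q0_le (x + y) (a + b).
  by rewrite linearD addrACA wD; have := pD (x + iota a) (y + iota b); lra.
- move=> r x r0; rewrite mulrC -ler_pdivrMr //.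
  apply: lb_le_inf; first exact: (q0_has x).1.
  move=> _ [a _ <-]; rewrite ler_pdivrMr //.
  have := q0_le (r%:C *: x) (r%:C *: a).
  by rewrite linearZ -scalerDr pZ wZ gtr0_norm //; lra.
- apply/le_anti/andP; split.
    have := q0_lep 0; rewrite /p cstar0 addr0 scaler0 rnorm0; exact.
  apply: lb_le_inf; first exact: (q0_has 0).1.
  by move=> _ [a _ <-]; rewrite add0r subr_ge0.
Qed.

Let below f : rlin f -> (forall x, f x <= p x) -> (forall a, f (iota a) = w a) ->
  forall x, f x <= q0 x.
Proof.
move=> lf fp fw x; apply: lb_le_inf; first exact: (q0_has x).1.
by move=> _ [a _ <-]; rewrite -fw -lerBlDr opprK -lf.1.
Qed.

(** [p] is the norm of the hermitian part and [q0] is the largest sublinear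
    functional below [p] whose linear minorants all extend [w], so an extreme
    linear functional below [q0] is hermitian, contractive, extends the vector
    state, and is extreme among such extensions.  It is positive: if [c] almost
    fixes [xi] then its value at [c^* c] is almost 1, while [c^* c - y^* y] has
    norm at most 1 for [y] in the unit ball. *)
Lemma state_extension : exists F : L -> R[i], [/\
  lin_fun F, herm_fun F, forall x, cabs (F x) <= rnorm x,
  forall a, F (iota a) = hdot (pi a xi) xi
  & (forall x, 0 <= Re (F (cmul (cstar x) x))) /\
    forall G, lin_fun G -> herm_fun G -> (forall a, G (iota a) = 0) ->
      (forall x, cabs (F x + G x) <= rnorm x) -> (forall x, cabs (F x - G x) <= rnorm x) ->
      forall x, G x = 0].
Proof.
have [f [lf fq0 fext]] := extreme_below q0_sublin.
have fp x : f x <= p x by apply: le_trans (fq0 x) (q0_lep x).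
have fw a : f (iota a) = w a.
  apply/le_anti/andP; split.
    have := le_trans (fq0 (iota a)) (q0_le _ (- a)).
    rewrite linearN subrr wN.
    by rewrite /p cstar0 addr0 scaler0 rnorm0; lra.
  have := le_trans (fq0 (- iota a)) (q0_le _ a).
  by rewrite addNr rlinN // /p cstar0 addr0 scaler0 rnorm0; lra.
have fstar x : f (cstar x) = f x.
  have h y : p (y - cstar y) = 0.
    by rewrite /p cstarB cstarK addrA subrK subrr scaler0 rnorm0.
  apply/le_anti/andP; split.
    have h' : p (cstar x - x) = 0 by have := h (cstar x); rewrite cstarK.
    by have := fp (cstar x - x); rewrite h' rlinB //; lra.
  by have := fp (x - cstar x); rewrite h rlinB //; lra.
pose F x : R[i] := Complex (f x) (- f ('i%C *: x)).
have FE x : Re (F x) = f x by [].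
have ii x : 'i%C *: ('i%C *: x) = - x :> L.
  by rewrite scalerA -expr2 sqr_i scaleN1r.
have kE (k : R[i]) x : k *: x = (Re k)%:C *: x + (Im k)%:C *: ('i%C *: x) :> L.
  by rewrite {1}(complexE k) scalerDl scalerA [(Im k)%:C * _]mulrC.
have lF : lin_fun F.
  move=> k x y; apply: eqC; rewrite /F ?ReD ?ImD ?ReM ?ImM /=.
    by rewrite lf.1 kE lf.1 !lf.2; ring.
  rewrite scalerDr lf.1 scalerA [_ * k]mulrC -scalerA kE ii lf.1 !lf.2 rlinN //.
  by ring.
have hF : herm_fun F.
  move=> x; apply: eqC; rewrite /F ?Re_conj ?Im_conj /=; first exact: fstar.
  have -> : 'i%C *: cstar x = cstar (- ('i%C *: x)).
    rewrite cstarN cstarZ -scaleNr; congr (_ *: _).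
    by apply: eqC; rewrite /= ?oppr0 // opprK.
  by rewrite fstar rlinN.
have nF x : cabs (F x) <= rnorm x.
  have [z [z1 hz]] := phase (F x).
  have -> : cabs (F x) = Re (F (z *: x)) by rewrite lfZ // hz.
  by rewrite FE (le_trans (fp _)) // (le_trans (p_le _)) // rnormZ z1 mul1r.
have Fw a : F (iota a) = hdot (pi a xi) xi.
  apply: eqC; rewrite /F /=; first exact: fw.
  by rewrite -linearZ fw /w repZ hdotZl ReM /=; ring.
exists F; split=> //; split.
  move=> x; rewrite FE.
  have small y : rnorm y <= 1 -> 0 <= f (cmul (cstar y) y).
    move=> y1; rewrite -oppr_le0; apply: cvgS_le0 => e e0.
    have m0 : 0 < Num.min 1 (e / 2) by rewrite lt_min ltr01 half_gt0.
    have [c [c1]] := xi_nd m0; rewrite lt_min => /andP[hc1 hc2].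
    have ic1 : rnorm (iota c) <= 1 by rewrite iota_iso.
    have := le_trans (p_le _) (posL ic1 y1).
    rewrite -starHom_star -starHomM => h.
    have := le_trans (fp _) h; rewrite rlinB // fw /w rep_sq.
    have c2 : 1 - rnorm (xi - pi c xi) <= rnorm (pi c xi).
      by have := rnorm_leB xi (pi c xi); rewrite xi1; lra.
    have c3 : (1 - rnorm (xi - pi c xi)) ^+ 2 <= rnorm (pi c xi) ^+ 2.
      by rewrite ler_pXn2r ?nnegrE ?rnorm_ge0 // subr_ge0 ltW.
    move: c3; rewrite sqrrB expr1n mul1r; have := sqr_ge0 (rnorm (xi - pi c xi)).
    lra.
  have M0 : 0 < rnorm x + 1 by rewrite ltr_wpDl ?rnorm_ge0.
  have := small ((rnorm x + 1)^-1%:C *: x).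
  rewrite rnormZR ger0_norm ?invr_ge0 ?(ltW M0) // => /(_ _) h.
  have {}h : 0 <= f (cmul (cstar ((rnorm x + 1)^-1%:C *: x)) ((rnorm x + 1)^-1%:C *: x)).
    by apply: h; rewrite mulrC ler_pdivrMr //; lra.
  rewrite cstarZR cmulZl cmulZr !lf.2 mulrA pmulr_rge0 // in h.
  by rewrite mulr_gt0 // invr_gt0.
move=> G lG hG Gi n1 n2 x.
pose g x := Re (G x).
have lg : rlin g.
  by split=> [y z|r y]; rewrite /g; [rewrite lfD // ReD | rewrite lfZ // ReZ].
have gstar y : g (cstar y) = g y by rewrite /g hG Re_conj.
have symm (k : L -> R) (y : L) : rlin k -> (forall z, k (cstar z) = k z) ->
    k y = k ((1 / 2 : R)%:C *: (y + cstar y)).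
  by move=> lk ks; rewrite lk.2 lk.1 ks; field.
have g0 : forall y, g y = 0.
  apply: fext => // y.
    have lk : rlin (fun y => f y + g y).
      by split=> [a b|r a]; [rewrite lf.1 lg.1 | rewrite lf.2 lg.2]; ring.
    apply: (below lk) => [z|a]; last by rewrite fw /g Gi addr0.
    rewrite (symm (fun y => f y + g y)) //; last by move=> z'; rewrite fstar gstar.
    by rewrite /p; apply: le_trans (n1 _); rewrite -FE -ReD Re_lec.
  have lk : rlin (fun y => f y - g y).
    by split=> [a b|r a]; [rewrite lf.1 lg.1 | rewrite lf.2 lg.2]; ring.
  apply: (below lk) => [z|a]; last by rewrite fw /g Gi subr0.
  rewrite (symm (fun y => f y - g y)) //; last by move=> z'; rewrite fstar gstar.
  by rewrite /p; apply: le_trans (n2 _); rewrite -FE -ReB Re_lec.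
apply: eqC; first exact: g0.
have := g0 ('i%C *: x); rewrite /g lfZ // ReM /=; lra.
Qed.

End StateExtension.

(** * The representation of an extreme state *)

Section Approximation.
Variables (R : realType) (H : hilbertType R).

(** Density of a subspace in its double orthogonal complement. *)
Lemma cspan_approx (S : set H) v : S 0 ->
  (forall (k : R[i]) x y, S x -> S y -> S (x + k *: y)) -> cspan S v ->
  forall e : R, 0 < e -> exists2 s, S s & rnorm (v - s) < e.
Proof.
move=> S0 SL Sv; have [||z [hz hz']] := @nearest_point _ H S v => //.
  by move=> r x y; exact: SL.
have oz : ocompl S (v - z).
  move=> s Ss; apply: hdot_orthC; apply: hdot_Re0; apply: hz' => //.
  by rewrite -[_ *: _]add0r; exact: SL.
have zS : cspan S z.
  apply: cspan_closed => e /hz[g Sg zg]; exists g => //; exact: cspan_sub.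
have vz : v = z.
  apply/eqP; rewrite -subr_eq0; apply/eqP/hdot_eq0.
  by have := cspanD (-1) Sv zS; rewrite scaleN1r; apply.
by rewrite vz.
Qed.

Lemma hdot_limr_uniq (K : hilbertType R) (u : nat -> H) (u' : nat -> K) l l' v v' :
  ecvg u l -> ecvg u' l' -> (forall n, hdot (u n) v = hdot (u' n) v') ->
  hdot l v = hdot l' v'.
Proof.
move=> ul ul' uu'; apply/eqP; rewrite -subr_eq0; apply/eqP/cabs_eq0/le_anti.
rewrite cabs_ge0 andbT; apply: cvgS_le0 => e e0.
have [N hN] := hdot_lim v ul (half_gt0 e0).
have [N' hN'] := hdot_lim v' ul' (half_gt0 e0).
have := hN _ (leq_maxl N N'); have := hN' _ (leq_maxr N N').
rewrite -uu'; set m := maxn N N'.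
have := cabsD (hdot l v - hdot (u m) v) (hdot (u m) v - hdot l' v').
by rewrite addrA subrK (cabsB (hdot l v) (hdot (u m) v)); lra.
Qed.

End Approximation.

Section Intertwiners.
Variables (R : realType) (A : cstarAlgType R).

Definition comm_rep (H : hilbertType R) (pi : representation A H) (T : H -> H) :=
  bop T /\ forall a u, T (pi a u) = pi a (T u).

Definition intertwines (H K : hilbertType R) (pi : representation A H)
  (rho : representation A K) (V : H -> K) := bop V /\ forall a u, V (pi a u) = rho a (V u).

Lemma comm_repE (H : hilbertType R) (pi : representation A H) T :
  commutant (range pi) T <-> comm_rep pi T.
Proof.
split=> [[/bopE bT h]|[bT h]].
  split=> // a u; have h' : T \o pi a = pi a \o T by apply: h; exists a.
  by rewrite -[T (pi a u)]/((T \o pi a) u) h'.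
by split; [exact/bopE | move=> _ [a _ <-]; apply/funext => u /=; exact: h].
Qed.

Lemma bicommutantE (H : hilbertType R) (pi : representation A H) P :
  bicommutant (range pi) P <->
  bop P /\ forall T, comm_rep pi T -> forall u, P (T u) = T (P u).
Proof.
split=> [[/bopE bP h]|[bP h]].
  split=> // T /comm_repE cT u.
  by rewrite -[P (T u)]/((P \o T) u) h.
by split; [exact/bopE | move=> T /comm_repE cT; apply/funext => u /=; exact: h].
Qed.

Lemma intertwines_adj (H K : hilbertType R) (pi : representation A H)
  (rho : representation A K) V : intertwines pi rho V -> intertwines rho pi (adj V).
Proof.
move=> [bV hV]; split=> [|a u]; first exact: adj_bop.
have aV := adjP bV; apply: hdot_ext => w.
by rewrite (is_adj_sym aV) rep_adj rep_adj (is_adj_sym aV) hV.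
Qed.

Lemma intertwines_comp (H K X : hilbertType R) (pi : representation A H)
  (rho : representation A K) (sigma : representation A X) V W :
  intertwines pi rho V -> intertwines rho sigma W -> intertwines pi sigma (W \o V).
Proof.
move=> [bV hV] [bW hW]; split=> [|a u]; first exact: bop_comp.
by rewrite /= hV hW.
Qed.

Lemma comm_rep_id (H : hilbertType R) (pi : representation A H) : comm_rep pi id.
Proof. by split=> //; exact: bop_id. Qed.

Lemma comm_repB (H : hilbertType R) (pi : representation A H) T S :
  comm_rep pi T -> comm_rep pi S -> comm_rep pi (fun u => T u - S u).
Proof.
move=> [bT hT] [bS hS]; split=> [|a u]; first exact: bopB.
by rewrite hT hS (linB (rep_lin pi a)).
Qed.

Lemma comm_repD (H : hilbertType R) (pi : representation A H) T S :
  comm_rep pi T -> comm_rep pi S -> comm_rep pi (fun u => T u + S u).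
Proof.
move=> [bT hT] [bS hS]; split=> [|a u]; first exact: bopD.
by rewrite hT hS (linD (rep_lin pi a)).
Qed.

Lemma comm_repZ (H : hilbertType R) (pi : representation A H) (k : R[i]) T :
  comm_rep pi T -> comm_rep pi (fun u => k *: T u).
Proof.
move=> [bT hT]; split=> [|a u]; first exact: bopZ.
by rewrite hT (linZ (rep_lin pi a)).
Qed.

Lemma comm_rep_comp (H : hilbertType R) (pi : representation A H) T S :
  comm_rep pi T -> comm_rep pi S -> comm_rep pi (T \o S).
Proof. by move=> cT cS; exact: intertwines_comp cS cT. Qed.

Lemma comm_rep_adj (H : hilbertType R) (pi : representation A H) T :
  comm_rep pi T -> comm_rep pi (adj T).
Proof. exact: intertwines_adj. Qed.

Lemma oproj_comm_rep (H : hilbertType R) (pi : representation A H) (S : set H) :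
  (forall a s, S s -> cspan S (pi a s)) -> comm_rep pi (oproj S).
Proof.
move=> hS; split=> [|a u]; first exact: oproj_bop.
symmetry; apply: (oproj_comm (T' := pi (cstar a))).
- exact: rep_adj.
- exact: rep_lin.
- by move=> s; exact: hS.
- by move=> s; exact: hS.
Qed.

Definition cyc (H : hilbertType R) (pi : representation A H) (xi : H) : set H :=
  [set pi a xi | a in [set: A]].

Definition cycproj (H : hilbertType R) (pi : representation A H) (xi : H) :=
  oproj (cyc pi xi).

Lemma cyc_approx (H : hilbertType R) (pi : representation A H) xi v :
  cspan (cyc pi xi) v -> forall e : R, 0 < e -> exists a, rnorm (v - pi a xi) < e.
Proof.
move=> hv e e0; have [||s [a _ <-] h] := cspan_approx _ _ hv e0; last by exists a.
  by exists 0; rewrite ?rep0.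
by move=> k _ _ [a _ <-] [b _ <-]; exists (a + k *: b) => //; rewrite repD repZ.
Qed.

Lemma cycproj_comm (H : hilbertType R) (pi : representation A H) xi :
  comm_rep pi (cycproj pi xi).
Proof.
apply: oproj_comm_rep => a _ [b _ <-]; apply: cspan_sub.
by exists (cmul a b) => //; rewrite repMu.
Qed.

Section CyclicTransport.
Variables (H K : hilbertType R) (pi : representation A H) (rho : representation A K).
Variables (xi : H) (eta : K).
Hypothesis same : forall a, hdot (pi a xi) xi = hdot (rho a eta) eta.

Let same2 a b : hdot (pi a xi) (pi b xi) = hdot (rho a eta) (rho b eta).
Proof.
have e (X : hilbertType R) (s : representation A X) (x : X) :
    hdot (s a x) (s b x) = hdot (s (cmul (cstar b) a) x) x.
  by rewrite repMu [RHS]rep_adj cstarK.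
by rewrite !e.
Qed.

Let same_norm a b : rnorm (rho a eta - rho b eta) = rnorm (pi a xi - pi b xi).
Proof.
apply/eqP; rewrite -(@eqrXn2 _ 2) ?rnorm_ge0 // !rnorm_sqB -same2 !(rnorm_sq (_ : H)).
by rewrite !(rnorm_sq (_ : K)) !same2.
Qed.

Let e := cycproj pi xi.

(** The closure of the isometry [pi a xi |-> rho a eta], precomposed with [e]. *)
Let graph u (v : K) := exists a : nat -> A,
  ecvg (fun n => pi (a n) xi) (e u) /\ ecvg (fun n => rho (a n) eta) v.

Let graph_ex u : exists v, graph u v.
Proof.
have h n : exists a, rnorm (e u - pi a xi) < n.+1%:R^-1.
  by apply: cyc_approx; [exact: oproj_in | rewrite invr_gt0 ltr0n].
have [a ha] := choice h.
have ca : ecvg (fun n => pi (a n) xi) (e u).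
  move=> d d0; have [N hN] := inv_small d0; exists N => n Nn.
  by rewrite rnormC; apply: lt_trans (ha n) (hN n Nn).
have [|v hv] := @complete_seq _ K (fun n => rho (a n) eta); last by exists v, a.
move=> d d0; have [N hN] := ca _ (half_gt0 d0); exists N => m n /hN h1 /hN h2.
rewrite same_norm; have := rnorm_tri (e u) (pi (a m) xi) (pi (a n) xi).
by rewrite (rnormC (e u)); lra.
Qed.

Let graph_dot u v a : graph u v -> hdot v (rho a eta) = hdot u (pi a xi).
Proof.
move=> [b [b1 b2]]; rewrite -(hdot_limr_uniq (v := pi a xi) b1 b2) //.
by rewrite /e oproj_sa oproj_id //; apply: cspan_sub; exists a.
Qed.

Let graph_span u v : graph u v -> cspan (cyc rho eta) v.
Proof.
move=> [b [_ b2]]; apply: cspan_closed => d /b2[N hN].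
exists (rho (b N) eta); first by apply: cspan_sub; exists (b N).
by rewrite rnormC hN.
Qed.

Let graph_char u v v' : graph u v -> cspan (cyc rho eta) v' ->
  (forall a, hdot v' (rho a eta) = hdot u (pi a xi)) -> v = v'.
Proof.
move=> guv sv' hv'; apply/eqP; rewrite -subr_eq0; apply/eqP/hdot_eq0.
have := cspanD (-1) (graph_span guv) sv'; rewrite scaleN1r; apply.
move=> _ [a _ <-]; apply: hdot_orthC.
by rewrite hdotBl (graph_dot _ guv) hv' subrr.
Qed.

Let V u : K := projT1 (cid (graph_ex u)).
Let V_graph u : graph u (V u).
Proof. by rewrite /V; case: cid. Qed.

Let V_norm u : rnorm (V u) <= rnorm u.
Proof.
have [a [a1 a2]] := V_graph u; rewrite -subr_le0; apply: cvgS_le0 => d d0.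
have [N hN] := a1 _ (half_gt0 d0); have [N' hN'] := a2 _ (half_gt0 d0).
have := hN _ (leq_maxl N N'); have := hN' _ (leq_maxr N N').
set m := maxn N N'.
have sn : rnorm (rho (a m) eta) = rnorm (pi (a m) xi).
  by have := same_norm (a m) 0; rewrite !rep0 !subr0.
have := rnorm_leB (V u) (rho (a m) eta); rewrite (rnormC (V u)).
have := rnorm_leB (pi (a m) xi) (e u); have := oproj_norm (cyc pi xi) u.
rewrite -/(cycproj _ _) -/e sn; lra.
Qed.

Let V_linear : linear V.
Proof.
move=> k u v; apply: graph_char (V_graph _) _ _.
  rewrite addrC; exact: cspanD (graph_span (V_graph v)) (graph_span (V_graph u)).
by move=> a; rewrite !hdotDl !hdotZl !(graph_dot _ (V_graph _)).
Qed.

(** Since the vector states agree, [pi a xi |-> rho a eta] is isometric; it is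
    extended by continuity to the cyclic subspace and by zero to its
    complement. *)
Lemma cyclic_intertwiner : exists W : H -> K, [/\ intertwines pi rho W,
  forall u, adj W (W u) = cycproj pi xi u & forall a, W (pi a xi) = rho a eta].
Proof.
have bV : bop V by split; [exact: V_linear | exists 1 => u; rewrite mul1r].
exists V; split.
- split=> // a u; apply: graph_char (V_graph _) _ _.
    move=> w ow; rewrite rep_adj; apply: (graph_span (V_graph u)) => _ [b _ <-].
    by rewrite -(cstarK a) -rep_adj -repMu; apply: ow; exists (cmul a b); rewrite ?cstarK.
  move=> b; rewrite rep_adj -repMu (graph_dot _ (V_graph u)).
  by rewrite repMu -rep_adj.
- move=> u; apply: hdot_ext => w; rewrite (is_adj_sym (adjP bV)).
  have [a [a1 a2]] := V_graph w.
  
  rewrite [LHS]hdotC [RHS]hdotC; congr (Num.conj _).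
  rewrite -/e -oproj_sa; apply: hdot_limr_uniq a2 a1 _ => n.
  by rewrite [LHS]hdotC (graph_dot _ (V_graph u)) -hdotC.
- move=> a; apply: graph_char (V_graph _) _ _ => [|b]; last by rewrite same2.
  by apply: cspan_sub; exists a.
Qed.

End CyclicTransport.

End Intertwiners.

Section GNS.
Variables (R : realType) (L : cstarAlgType R).
Variables (F : L -> R[i]).
Hypotheses (lF : lin_fun F) (hF : herm_fun F) (nF : forall x, cabs (F x) <= rnorm x).
Hypothesis pF : forall x, 0 <= Re (F (cmul (cstar x) x)).
Hypothesis auL : approx_unit L.

Let s (a b : L) : R[i] := F (cmul (cstar b) a).

Let s_psd : psd s.
Proof.
split=> [x y z|k x z|x y|x]; rewrite /s.
- by rewrite cmulDr lfD.
- by rewrite cmulZr lfZ.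
- by rewrite -hF cstarM cstarK.
- exact: pF.
Qed.

(** Cauchy-Schwarz against an approximate unit, in place of the unit. *)
Let F_sq x : cabs (F x) <= Num.sqrt (Re (s x x)).
Proof.
have le c : rnorm c <= 1 -> cabs (F (cmul c x)) <= Num.sqrt (Re (s x x)).
  move=> c1; rewrite -(@ler_pXn2r _ 2) ?nnegrE ?cabs_ge0 ?sqrtr_ge0 // sqr_sqrtr ?pF //.
  have -> : F (cmul c x) = s x (cstar c) by rewrite /s cstarK.
  apply: le_trans (psd_CS s_psd _ _) _; rewrite -[leRHS]mulr1.
  apply: ler_wpM2l; first exact: pF.
  apply: le_trans (Re_lec _) _; apply: le_trans (nF _) _.
  by apply: le_trans (rnormM _ _) _; rewrite !rnorm_star mulr_ile1 ?rnorm_ge0.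
rewrite -subr_le0; apply: cvgS_le0 => e /(auL x)[c [c1 hc]].
have := le c c1; have := nF (x - cmul c x); rewrite lfB //.
by have := cabsD (F x - F (cmul c x)) (F (cmul c x)); rewrite subrK; lra.
Qed.

Let K := hdual s_psd.

Let act_contr x e : Num.sqrt (Re (s (cmul x e) (cmul x e))) <= rnorm x * Num.sqrt (Re (s e e)).
Proof.
rewrite -(@ler_pXn2r _ 2) ?nnegrE ?mulr_ge0 ?rnorm_ge0 ?sqrtr_ge0 // exprMn !sqr_sqrtr ?pF //.
apply: (star_action_contr (s := s) (act := @cmul R L)) => //.
- by move=> a b c; rewrite cmulDl.
- by move=> k a b; rewrite cmulZl.
- by move=> a b c; rewrite cmulA.
- by move=> a b c; rewrite /s cstarM cstarK cmulA.
Qed.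

Let act_ex (x : L) (h : form_dual s) :
  exists k : form_dual s, forall y, fd k y = fd h (cmul (cstar x) y).
Proof.
apply: (mk_fd (M := (rnorm (h : K) * rnorm x) ^+ 2)) => [k a b|y].
  by rewrite cmulDr cmulZr (fdP h).1.
rewrite -[Re _]sqr_sqrtr ?pF // -exprMn ler_pXn2r ?nnegrE ?cabs_ge0 ?mulr_ge0 ?rnorm_ge0 ?sqrtr_ge0 //.
apply: le_trans (hdual_bound s_psd _ _) _; rewrite -mulrA; apply: ler_wpM2l.
  exact: rnorm_ge0.
by apply: le_trans (act_contr _ _) _; rewrite rnorm_star.
Qed.

Let act (x : L) (h : K) : K := projT1 (cid (act_ex x h)).

Let actE x (h : K) y : fd (act x h) y = fd h (cmul (cstar x) y).
Proof. by rewrite /act; case: cid. Qed.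

Let act_hat x y : act x (hat s_psd y) = hat s_psd (cmul x y).
Proof.
by apply: fd_ext => z; rewrite actE !hatE /s cstarM cstarK cmulA.
Qed.

Let act_bop x : bop (act x).
Proof.
split.
  move=> k u v; apply: fd_ext => y.
  by rewrite actE !fdD !fdZ !actE.
exists (rnorm x) => u; apply: hdual_min => [|y]; first by rewrite mulr_ge0 ?rnorm_ge0.
rewrite actE; apply: le_trans (hdual_bound s_psd _ _) _.
rewrite mulrAC [_ * rnorm u]mulrC; apply: ler_wpM2l; first exact: rnorm_ge0.
by apply: le_trans (act_contr _ _) _; rewrite rnorm_star.
Qed.

Let act_adj x (u v : K) : hdot (act x u) v = hdot u (act (cstar x) v).
Proof.
have aT := adjP (act_bop x); rewrite aT; congr (hdot _ _); apply: fd_ext => y.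
rewrite actE cstarK -(hdual_hat s_psd (adj (act x) v)) (is_adj_sym aT).
by rewrite act_hat hdual_hat.
Qed.

Let gns_rep : representation L K.
Proof.
refine (@Representation R L K act _ _ _ _ act_adj).
- by move=> x; apply/bopE.
- move=> x y u; apply: fd_ext => z.
  by rewrite fdD !actE cstarD cmulDl fdDr.
- move=> k x u; apply: fd_ext => z.
  by rewrite fdZ !actE cstarZ cmulZl fdZr conjCK.
- move=> x y; apply/funext => u; apply: fd_ext => z.
  by rewrite /= !actE cstarM cmulA.
Defined.

(** The space is the dual of the form [F (b^* a)], on which [x] acts by
    [h |-> h (x^* -)].  Without a unit in [L], the cyclic vector is the
    functional [y |-> F (y^* )] itself. *)
Lemma gns : exists (K : hilbertType R) (rho : representation L K) (eta : K),
  [/\ rnorm eta <= 1, forall b, hdot (rho b eta) eta = F b &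
  forall k, (forall b, hdot k (rho b eta) = 0) -> k = 0].
Proof.
have [eta etaE] : exists h : form_dual s, forall y, fd h y = F (cstar y).
  apply: (mk_fd (M := 1)) => [k x y|y].
    by rewrite cstarD cstarZ lfD // lfZ.
  rewrite mul1r -[leRHS]sqr_sqrtr ?pF // ler_pXn2r ?nnegrE ?cabs_ge0 ?sqrtr_ge0 //.
  by rewrite hF cabs_conj.
have hatE' b : act b eta = hat s_psd b.
  by apply: fd_ext => y; rewrite actE etaE hatE /s cstarM cstarK.
exists K, gns_rep, (eta : K); split.
- apply: hdual_min => // y; rewrite etaE mul1r hF cabs_conj; exact: F_sq.
- move=> b; rewrite -[gns_rep b eta]/(act b eta) hatE' hdotC.
  by rewrite hdual_hat etaE hF conjCK.
- move=> k hk; apply: fd_ext => y; rewrite fd0 -(hdual_hat s_psd) -hatE'; exact: hk.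
Qed.

End GNS.

(** Irreducibility of the cyclic subspace, in the form given by Schur's lemma;
    it is stated for the compressions of all of the commutant. *)
Definition irreducible_vector (R : realType) (A : cstarAlgType R) (H : hilbertType R)
    (pi : representation A H) (xi : H) :=
  forall T, comm_rep pi T ->
  exists lam : R[i], forall u, cycproj pi xi (T (cycproj pi xi u)) = lam *: cycproj pi xi u.

Section IrreducibleExtension.
Variables (R : realType) (A L : cstarAlgType R) (iota : starHom A L).
Hypothesis iota_iso : forall a, rnorm (iota a) = rnorm a.
Hypotheses (posL : pos_contr L) (auL : approx_unit L) (auA : approx_unit A).
Variables (H : hilbertType R) (pi : representation A H) (xi : H).
Hypotheses (xi1 : rnorm xi = 1) (xi_nd : cspan (cyc pi xi) xi).
Hypothesis irr : irreducible_vector pi xi.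

Let e := cycproj pi xi.
Let e_xi : e xi = xi. Proof. exact: oproj_id. Qed.
Let e_cyc a : e (pi a xi) = pi a xi.
Proof. by apply: oproj_id; apply: cspan_sub; exists a. Qed.
Let e_sa u v : hdot (e u) v = hdot u (e v). Proof. exact: oproj_sa. Qed.

Let xi_contr (d : R) : 0 < d -> exists c : A, rnorm c <= 1 /\ rnorm (xi - pi c xi) < d.
Proof.
move=> d0; have d3 : 0 < d / 3 by rewrite divr_gt0.
have [b hb] := cyc_approx xi_nd d3.
have [c [c1 hc]] := auA b d3; exists c; split=> //.
have h1 : rnorm (pi b xi - pi c (pi b xi)) <= rnorm (b - cmul c b).
  by rewrite -repMu -repB (le_trans (rep_contr _ _ _)) // xi1 mulr1.
have h2 : rnorm (pi c (xi - pi b xi)) <= rnorm (xi - pi b xi).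
  by rewrite (le_trans (rep_contr _ _ _)) // -[leRHS]mul1r ler_wpM2r ?rnorm_ge0.
rewrite (linB (rep_lin pi c)) in h2.
have := rnorm_tri (pi b xi) xi (pi c xi).
have := rnorm_tri (pi c (pi b xi)) (pi b xi) (pi c xi).
rewrite (rnormC (pi c (pi b xi)) (pi c xi)); lra.
Qed.

(** Compressing an operator of [rho(L)'] to the cyclic subspace of [A] gives a
    scalar; extremality of the extended state then makes the operator itself
    that scalar. *)
Lemma irreducible_extension : exists (K : hilbertType R) (rho : representation L K) (V : H -> K),
  [/\ intertwines pi (rep_pull iota rho) V, forall u, adj V (V u) = cycproj pi xi u
   & forall T, comm_rep rho T -> exists lam : R[i], forall k, T k = lam *: k].
Proof.
have [F [lF hF nF Fi [pF Fext]]] := state_extension iota_iso posL xi1 xi_contr.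
have [K [rho [eta [eta1 etaF cyc_eta]]]] := gns lF hF nF pF auL.
pose rhoA := rep_pull iota rho.
have [V [iV VV Vcyc]] : exists W : H -> K, [/\ intertwines pi rhoA W,
  forall u, adj W (W u) = cycproj pi xi u & forall a, W (pi a xi) = rhoA a eta].
  by apply: cyclic_intertwiner => a; rewrite rep_pullE etaF Fi.
have [bV hV] := iV; have aV := adjP bV.
have eta_sq : rnorm eta ^+ 2 <= 1 by rewrite expr_le1 ?rnorm_ge0.
have norm_same a : rnorm (rhoA a eta) ^+ 2 = rnorm (pi a xi) ^+ 2.
  by rewrite -!rep_sq rep_pullE etaF Fi.
have Ve u : rnorm (V u) <= rnorm u.
  rewrite -(@ler_pXn2r _ 2) ?nnegrE ?rnorm_ge0 // [leLHS]rnorm_sq aV VV.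
  rewrite -[cycproj _ _ u]oproj_idem -oproj_sa -rnorm_sq.
  by rewrite ler_pXn2r ?nnegrE ?rnorm_ge0 // oproj_norm.
have Vxi : V xi = eta.
  apply/eqP; rewrite -subr_eq0; apply/eqP/rnorm_small => d d0.
  have [a ha] := cyc_approx xi_nd (half_gt0 d0).
  have h : rnorm (rhoA a eta - eta) <= rnorm (pi a xi - xi).
    rewrite -(@ler_pXn2r _ 2) ?nnegrE ?rnorm_ge0 // !rnorm_sqB norm_same.
    by rewrite [rhoA a eta]rep_pullE etaF Fi xi1 expr1n lerD2l.
  have := Ve (xi - pi a xi); have := rnorm_tri (rhoA a eta) (V xi) eta.
  by rewrite (linB bV.1) Vcyc; rewrite (rnormC (pi a xi)) in h; lra.
have etaN : rnorm eta = 1.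
  apply/eqP; rewrite -(@eqrXn2 _ 2) ?rnorm_ge0 // expr1n [X in X == _]rnorm_sq -{1}Vxi aV.
  by rewrite -Vxi VV -/e e_xi -rnorm_sq xi1 expr1n.
have sa_case T : comm_rep rho T -> is_adj T T -> exists lam : R[i], forall k, T k = lam *: k.
  move=> cT aT; have [bT hT] := cT.
  have cS : comm_rep pi (adj V \o (T \o V)).
    apply: intertwines_comp (intertwines_adj iV).
    apply: intertwines_comp iV _; split=> // a u; exact: hT.
  have [lam hlam] := irr cS.
  have compr a : hdot (T (rhoA a eta)) eta = lam * hdot (rhoA a eta) eta.
    have -> : hdot (T (rhoA a eta)) eta = hdot (adj V (T (V (pi a xi)))) xi.
      by rewrite Vcyc (is_adj_sym aV) Vxi.
    have := hlam (pi a xi); rewrite -/e e_cyc /= => h.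
    rewrite -{2}e_xi -e_sa h hdotZl; congr (_ * _).
    by rewrite etaF Fi.
  have lam_eta : hdot (T eta) eta = lam.
    have -> : hdot (T eta) eta = hdot (adj V (T (V xi))) xi by rewrite (is_adj_sym aV) Vxi.
    have := hlam xi; rewrite -/e e_xi /= => h.
    by rewrite -{2}e_xi -e_sa h hdotZl hdot_sq xi1 expr1n rmorph1 mulr1.
  have lam_real : Num.conj lam = lam by rewrite -lam_eta -(hdotC eta) aT.
  have [S [SE cSS aS]] : exists S, [/\ forall k, S k = T k - lam *: k, comm_rep rho S
      & is_adj S S].
    exists (fun k => T k - lam *: k); split=> //.
      by apply: comm_repB cT (comm_repZ lam (comm_rep_id _)).
    by move=> u v; rewrite hdotBl hdotBr aT hdotZl hdotZr lam_real.
  have [bS hS] := cSS.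
  have [M M0 hM] := bop_bound bS.
  pose c := M^-1; have c0 : 0 < c by rewrite invr_gt0.
  pose G x := c%:C * hdot (S (rho x eta)) eta.
  have Seta : hdot (S eta) eta = 0.
    by rewrite SE hdotBl lam_eta hdotZl hdot_sq etaN expr1n rmorph1 mulr1 subrr.
  (* The operator 1 + sg c S is positive and commutes with rho, so that the
     vector eta gives a positive functional of norm 1 for its form. *)
  have bound (sg : R) x : `|sg| = 1 -> cabs (F x + sg%:C * G x) <= rnorm x.
    move=> sg1; pose B k := k + (sg * c)%:C *: S k.
    have -> : F x + sg%:C * G x = hdot (B (rho x eta)) eta.
      by rewrite /B /G hdotDl etaF hdotZl rmorphM mulrA.
    pose s u v := hdot (B u) v.
    have ps : psd s.
      split=> [u v z|k u z|u v|u]; rewrite /s /B.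
      - by rewrite (linD bS.1) scalerDr !hdotDl addrACA.
      - by rewrite (linZ bS.1) !hdotDl !hdotZl mulrDr mulrCA.
      - have cR : Num.conj (sg * c)%:C = (sg * c)%:C by rewrite conjE conjc_real.
        move: (sg * c)%:C cR => cc cR.
        by rewrite !hdotDl !hdotZl (hdotC u v) aS (hdotC u (S v)) rmorphD rmorphM /= cR.
      - rewrite hdotDl hdotZl ReD ReZ -rnorm_sq.
        have h1 : `|sg * c * Re (hdot (S u) u)| <= rnorm u ^+ 2.
          rewrite !normrM sg1 mul1r (gtr0_norm c0).
          rewrite mulrC ler_pdivrMr // mulrC; apply: le_trans (Re_le_cabs _) _.
          apply: le_trans (hdot_CS _ _) _; rewrite expr2 mulrA; apply: ler_wpM2r; first exact: rnorm_ge0.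
          exact: hM.
        by move: h1; rewrite ler_norml => /andP[]; lra.
    have Bc y k : B (rho y k) = rho y (B k).
      by rewrite /B hS (linD (rep_lin rho y)) (linZ (rep_lin rho y)).
    have see : Re (s eta eta) = 1.
      by rewrite /s /B hdotDl hdotZl Seta mulr0 addr0 hdot_sq etaN expr1n.
    rewrite -[hdot _ _]/(s (rho x eta) eta).
    rewrite -(@ler_pXn2r _ 2) ?nnegrE ?cabs_ge0 ?rnorm_ge0 //.
    apply: le_trans (psd_CS ps _ _) _; rewrite see mulr1.
    rewrite -[leRHS]mulr1 -see.
    apply: (star_action_contr (act := rho) ps).
    - exact: repD.
    - exact: repZ.
    - exact: repMu.
    - by move=> y u v; rewrite /s Bc rep_star.
  have G0 : forall x, G x = 0.
    apply: Fext.
    - by move=> k x y; rewrite /G repD repZ bS.1 hdotDl hdotZl; ring.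
    - move=> x; rewrite /G rmorphM /= conjE conjc_real; congr (_ * _).
      by rewrite hS rep_star cstarK aS -hdotC.
    - move=> a; rewrite /G SE hdotBl hdotZl -[rho (iota a) eta]/(rhoA a eta) compr.
      by rewrite subrr mulr0.
    - by move=> x; have := bound 1 x (normr1 _); rewrite rmorph1 mul1r.
    - by move=> x; have := bound (-1) x; rewrite normrN1 rmorphN1 mulN1r; apply.
  have S0 x : hdot (S (rho x eta)) eta = 0.
    have /eqP := G0 x; rewrite mulf_eq0 => /orP[/eqP h|/eqP//].
    by have := (@complexI R) _ _ (h : c%:C = 0%:C) => c00; rewrite c00 ltxx in c0.
  have Scyc x : S (rho x eta) = 0.
    by apply: cyc_eta => b; rewrite -{1}(cstarK b) -rep_star -hS -repMu S0.
  exists lam => k; apply/eqP; rewrite -subr_eq0; apply/eqP; apply: cyc_eta => b.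
  by rewrite -SE aS Scyc hdot0r.
exists K, rho, V; split=> // T cT; have aT := adjP cT.1.
have cT' := comm_rep_adj cT.
have [l1 h1] : exists lam : R[i], forall k, T k + adj T k = lam *: k.
  apply: sa_case; first exact: comm_repD.
  by move=> u v; rewrite hdotDl hdotDr aT (is_adj_sym aT) addrC.
have [l2 h2] : exists lam : R[i], forall k, 'i%C *: (T k - adj T k) = lam *: k.
  apply: sa_case; first exact: comm_repZ (comm_repB cT cT').
  move=> u v; rewrite hdotZl hdotZr hdotBl hdotBr aT (is_adj_sym aT).
  have -> : Num.conj 'i%C = - 'i%C :> R[i] by rewrite conjE; apply: eqC; rewrite /= ?oppr0.
  by rewrite mulNr -mulrN opprB.
exists ((1 / 2 : R)%:C * (l1 - 'i%C * l2)) => k.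
rewrite -scalerA scalerBl -scalerA -h1 -h2 scalerA -expr2 sqr_i scaleN1r opprK.
by rewrite addrACA subrr addr0 scale_half_split.
Qed.

End IrreducibleExtension.

(** * Irreducible summands of a finite-rank projection *)

Section FiniteRank.
Variables (R : realType) (H : hilbertType R).
Implicit Types (T f S : H -> H).

Definition rank_le n T := exists b : 'I_n -> H,
  forall u, exists c : 'I_n -> R[i], T u = \sum_i c i *: b i.

Lemma rank_le_ext n T S : (forall u, T u = S u) -> rank_le n T -> rank_le n S.
Proof. by move=> TS [b hb]; exists b => u; rewrite -TS. Qed.

(** The relation [f (T u) = 0] expresses the image under [f] of one generator of
    the range of [T] in terms of the others. *)
Lemma rank_drop n T f u : linear f -> rank_le n T -> f (T u) = 0 -> T u <> 0 ->
  exists2 m, (m < n)%N & rank_le m (f \o T).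
Proof.
move=> lf [b hb] fTu Tu; have [c hc] := hb u.
have [[i0 ci0]|nc] := pselect (exists i, c i <> 0); last first.
  case: Tu; rewrite hc big1 // => i _.
  have [->|ci] := eqVneq (c i) 0; first by rewrite scale0r.
  by case: nc; exists i; apply/eqP.
case: n b hb c hc i0 ci0 => [|n] b hb c hc i0 ci0; first by case: i0 ci0.
exists n => //; exists (fun j => f (b (lift i0 j))) => v; have [d hd] := hb v.
exists (fun j => d (lift i0 j) - d i0 * c (lift i0 j) / c i0).
have c0 : c i0 != 0 by apply/eqP.
have fb : f (b i0) = - (\sum_j (c (lift i0 j) / c i0) *: f (b (lift i0 j))).
  move: fTu; rewrite hc (lin_sum lf) (bigD1_ord i0) //= (linZ lf) => /eqP.
  rewrite addr_eq0 => /eqP h.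
  have -> : f (b i0) = (c i0)^-1 *: (c i0 *: f (b i0)) by rewrite scalerA mulVf // scale1r.
  rewrite h scalerN scaler_sumr; congr (- _); apply: eq_bigr => j _.
  by rewrite (linZ lf) scalerA mulrC.
rewrite /= hd (lin_sum lf) (bigD1_ord i0) //= (linZ lf) fb scalerN scaler_sumr addrC.
rewrite -sumrB; apply: eq_bigr => j _.
by rewrite (linZ lf) scalerA -scalerBl mulrA.
Qed.

Section Eigenvector.
Variables (S : H -> H) (lS : linear S).

Let ev N (p : {poly R[i]}) v := \sum_(k < N) p`_k *: iter k S v.

Let ev_step N (q : {poly R[i]}) z v : (size q <= N)%N ->
  ev N.+1 (('X - z%:P) * q) v = ev N q (S v - z *: v).
Proof.
move=> sN.
have iterL k : linear (iter k S).
  elim: k => [|k IH] a u w //=; by rewrite IH lS.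
have -> : ev N q (S v - z *: v) =
    \sum_(k < N) q`_k *: iter k.+1 S v - \sum_(k < N) (z * q`_k) *: iter k S v.
  rewrite /ev -sumrB; apply: eq_bigr => k _.
  by rewrite (linB (iterL k)) (linZ (iterL k)) scalerBr scalerA mulrC -iterSr.
have -> : \sum_(k < N) (z * q`_k) *: iter k S v = \sum_(k < N.+1) (z * q`_k) *: iter k S v.
  by rewrite [RHS]big_ord_recr /= (nth_default _ sN) mulr0 scale0r addr0.
have -> : \sum_(k < N) q`_k *: iter k.+1 S v = \sum_(k < N.+1) ('X * q)`_k *: iter k S v.
  rewrite big_ord_recl /= coefXM eqxx scale0r add0r; apply: eq_bigr => k _.
  by rewrite coefXM.
rewrite /ev -sumrB; apply: eq_bigr => k _.
by rewrite mulrBl coefB coefCM scalerBl.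
Qed.

Let ev_roots (Phi : H -> Prop) : (forall v z, Phi v -> Phi (S v - z *: v)) ->
  forall (rs : seq R[i]) v, Phi v -> v <> 0 ->
  ev (size rs).+1 (\prod_(z <- rs) ('X - z%:P)) v = 0 ->
  exists lam w, [/\ Phi w, w <> 0 & S w = lam *: w].
Proof.
move=> hPhi; elim=> [|z rs IH] v Pv v0.
  by rewrite big_nil /ev big_ord_recl big_ord0 /= addr0 coef1 scale1r.
rewrite big_cons ev_step; last by rewrite size_prod_XsubC.
have [h _|h] := eqVneq (S v - z *: v) 0.
  by exists z, v; split=> //; apply/eqP; rewrite -subr_eq0 h.
by apply: IH; [exact: hPhi | exact/eqP].
Qed.

(** The iterates of a vector under [S] stay in a finite-dimensional space, so
    they are dependent, and the polynomial of the dependence splits. *)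
Lemma eigenvector (Phi : H -> Prop) n T v : rank_le n T -> (forall v, Phi v -> T v = v) ->
  (forall v z, Phi v -> Phi (S v - z *: v)) -> Phi v -> v <> 0 ->
  exists lam w, [/\ Phi w, w <> 0 & S w = lam *: w].
Proof.
move=> [b hb] PhiT hPhi Pv v0.
have PS u : Phi u -> Phi (S u) by move=> /(hPhi _ 0); rewrite scale0r subr0.
have Pk k : Phi (iter k S v) by elim: k => [|k IH] //=; exact: PS.
have [c hc] := choice (fun k => hb (iter k S v)).
pose C : 'M[R[i]]_(n.+1, n) := \matrix_(k, i) c k i.
have /rowV0Pn[r rC r0] : kermx C != 0.
  rewrite kermx_eq0 /row_free; apply/negP => /eqP h.
  by have := rank_leq_col C; rewrite h ltnn.
have {}rC : r *m C = 0 by apply/sub_kermxP.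
pose p : {poly R[i]} := \poly_(k < n.+1) r 0 (inord k).
have pE (k : 'I_n.+1) : p`_k = r 0 k by rewrite coef_poly ltn_ord inord_val.
have p0 : p != 0.
  apply: contraNneq r0 => p0; apply/eqP/rowP => k.
  by rewrite -pE p0 coef0 mxE.
have evp : ev n.+1 p v = 0.
  rewrite /ev (eq_bigr (fun k : 'I_n.+1 => \sum_i (r 0 k * c k i) *: b i)).
    rewrite exchange_big /= big1 // => i _; rewrite -scaler_suml.
    have := congr1 (fun M : 'rV_n => M 0 i) rC; rewrite !mxE.
    under eq_bigr do rewrite mxE.
    by move=> ->; rewrite scale0r.
  move=> k _; rewrite pE -[iter k S v](PhiT _ (Pk k)) hc scaler_sumr.
  by apply: eq_bigr => i _; rewrite scalerA.
have [rs prs] := closed_field_poly_normal p.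
have lp : lead_coef p != 0 by rewrite lead_coef_eq0.
apply: (ev_roots hPhi (rs := rs) Pv v0).
have srs : (size (\prod_(z <- rs) ('X - z%:P))%R <= n.+1)%N.
  have := size_poly n.+1 (fun k => r 0 (inord k)); rewrite -/p prs size_scale //.
rewrite size_prod_XsubC in srs.
have evN N (q : {poly R[i]}) : (size q <= N)%N -> (N <= n.+1)%N -> ev N q v = ev n.+1 q v.
  move=> sq Nn; rewrite /ev (big_ord_widen n.+1 (fun k => q`_k *: iter k S v)) //.
  rewrite [RHS](bigID (fun k : 'I_n.+1 => (k < N)%N)) /= [X in _ = _ + X]big1 ?addr0 //.
  by move=> k; rewrite -leqNgt => Nk; rewrite nth_default ?scale0r // (leq_trans sq).
rewrite evN ?size_prod_XsubC //.
have evZ k (q : {poly R[i]}) : ev n.+1 (k *: q) v = k *: ev n.+1 q v.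
  by rewrite /ev scaler_sumr; apply: eq_bigr => j _; rewrite coefZ scalerA.
have /eqP : ev n.+1 (lead_coef p *: \prod_(z <- rs) ('X - z%:P)) v = 0 by rewrite -prs.
by rewrite evZ scaler_eq0 (negPf lp) => /eqP.
Qed.

End Eigenvector.

End FiniteRank.

Section NonDegenerate.
Variables (R : realType) (A : cstarAlgType R) (H : hilbertType R).
Variable pi : representation A H.

Definition rep_null : set H := [set v | forall a, pi a v = 0].

Let nul := oproj rep_null.

Let nul_null u a : pi a (nul u) = 0.
Proof.
apply: hdot_eq0; rewrite rep_adj; apply: oproj_in => s ss.
by rewrite -(cstarK a) -rep_adj cstarK ss hdot0l.
Qed.

Let nul_comm : comm_rep pi nul.
Proof. by apply: oproj_comm_rep => a s ss; rewrite ss; exact: cspan0. Qed.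

Let nul_central T : comm_rep pi T -> forall u, T (nul u) = nul (T u).
Proof.
move=> cT u; have [bT hT] := cT; have [bT' hT'] := comm_rep_adj cT.
apply: (oproj_comm (T' := adj T)); [exact: adjP | exact: bT.1 | |].
  by move=> s ss; apply: cspan_sub => a; rewrite -hT ss (lin0 bT.1).
by move=> s ss; apply: cspan_sub => a; rewrite -hT' ss (lin0 bT'.1).
Qed.

(** The projection onto the null space commutes with the commutant and with the
    bicommutant, so [P] splits along it; the part of [P] on the null space is
    invisible to [pi]. *)
Lemma nondegenerate_part P : projection P -> finite_rank P -> bicommutant (range pi) P ->
  exists P', [/\ [/\ projection P', finite_rank P' & bicommutant (range pi) P'],
    forall a u, P' (pi a u) - pi a (P' u) = P (pi a u) - pi a (P u),
    forall a u, P' (pi a (P' u)) = P (pi a (P u))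
  & forall v, rep_null v -> P' v = 0].
Proof.
move=> pP [n [b hb]] /bicommutantE[bP cP]; have [_ PP aP] := projection_bop pP.
have Pn u : P (nul u) = nul (P u) by exact: cP.
have nn u : nul (nul u) = nul u by exact: oproj_idem.
have bn : bop nul by exact: oproj_bop.
pose P' u := P (u - nul u).
have bP' : bop P' by apply: (bop_comp (bopB (bop_id _) bn) bP).
have nP' u : nul (P' u) = 0 by rewrite -Pn (linB bn.1) nn subrr (lin0 bP.1).
have piP' a u : pi a (P' u) = pi a (P u).
  by rewrite /P' (linB bP.1) Pn (linB (rep_lin pi a)) nul_null subr0.
have P'pi a u : P' (pi a u) = P (pi a u).
  by rewrite /P' nul_comm.2 nul_null subr0.
exists P'; split.
- split.
  + split; first exact/bopE.
      by apply/funext => u /=; rewrite {1}/P' nP' subr0 /P' PP.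
    move=> u v; rewrite /P' aP !(linB bP.1) !Pn hdotBl hdotBr.
    by congr (_ - _); rewrite /nul oproj_sa.
  + by exists n, b => u; exact: hb.
  + apply/bicommutantE; split=> // T cT u.
    by rewrite /P' -(nul_central cT) -(linB cT.1.1) cP.
- by move=> a u; rewrite P'pi piP'.
- by move=> a u; rewrite P'pi piP'.
- by move=> v nv; rewrite /P' /nul oproj_id ?subrr ?(lin0 bP.1) //; exact: cspan_sub.
Qed.

End NonDegenerate.

Section Selection.
Variables (R : realType) (A : cstarAlgType R) (H : hilbertType R).
Variables (pi : representation A H) (P : H -> H).
Hypotheses (pP : projection P) (fP : finite_rank P) (bP : bicommutant (range pi) P).
Hypothesis nP : forall v, rep_null pi v -> P v = 0.

Let PP u : P (P u) = P u. Proof. by have [_ h _] := projection_bop pP. Qed.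
Let aP : is_adj P P. Proof. by have [_ _ h] := projection_bop pP. Qed.
Let bopP : bop P. Proof. by have [h _ _] := projection_bop pP. Qed.
Let cP T : comm_rep pi T -> forall u, P (T u) = T (P u).
Proof. by have [_ h] := (bicommutantE pi P).1 bP; exact: h. Qed.

Lemma nondegenerate_vector xi : P xi = xi -> cspan (cyc pi xi) xi.
Proof.
move=> Pxi; have cc := cycproj_comm pi xi.
have null : rep_null pi (xi - cycproj pi xi xi).
  move=> a; rewrite (linB (rep_lin pi a)) -cc.2 /cycproj oproj_id ?subrr //.
  by apply: cspan_sub; exists a.
have := nP null; rewrite (linB bopP.1) Pxi (cP cc) Pxi => /eqP.
by rewrite subr_eq0 => /eqP h; rewrite {2}h; exact: oproj_in.
Qed.

Variables (x : A) (c : R).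
Hypothesis c0 : 0 <= c.

(** The candidates for the irreducible summand; [n] is the quantity to minimize. *)
Let good n (e : H -> H) := [/\ comm_rep pi e, is_adj e e, forall u, e (e u) = e u,
  rank_le n (e \o P) & exists w, [/\ rnorm w <= 1, P w = w, e w = w & c < rnorm (P (pi x w))]].

(** Let a summand [e] of minimal rank contain [f], and suppose that neither [f]
    nor [g = e - f] vanishes on the range of [P].  Both have smaller rank, so
    both compress [x] to norm at most [c]; by Pythagoras so does [e]. *)
Let good_split n e f : (forall m, (m < n)%N -> forall e, ~ good m e) -> good n e ->
  comm_rep pi f -> is_adj f f -> (forall u, f (f u) = f u) -> (forall u, e (f u) = f u) ->
  (exists u, f (P u) <> 0) -> forall u, f (P u) = e (P u).
Proof.
move=> min [ce ae ee re [w [w1 Pw ew hw]]] cf af ff ef [u1 fu1].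
apply: contrapT => /existsNP[u2 hu2].
have fe u : f (e u) = f u.
  by apply: hdot_ext => v; rewrite af ae ef -af.
pose g u := e u - f u.
have cg : comm_rep pi g by exact: comm_repB.
have ag : is_adj g g by move=> u v; rewrite /g hdotBl hdotBr ae af.
have [lf lg le lP] : [/\ linear f, linear g, linear e & linear P].
  by split; [exact: cf.1.1 | exact: cg.1.1 | exact: ce.1.1 | exact: bopP.1].
have fg u : f (g u) = 0 by rewrite /g (linB lf) fe ff subrr.
have gf u : g (f u) = 0 by rewrite /g ef ff subrr.
have ge u : g (e u) = g u by rewrite /g ee fe.
have gg u : g (g u) = g u by rewrite {1}/g fg subr0 /g (linB le) ee ef.
have efg u : e u = f u + g u by rewrite /g addrC subrK.
have gu2 : g (P u2) <> 0.
  by rewrite /g => /eqP; rewrite subr_eq0 => /eqP h; apply: hu2; rewrite h.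
have nf : ~ c * rnorm (f w) < rnorm (P (pi x (f w))).
  move=> h; have [m mn rm] : exists2 m, (m < n)%N & rank_le m (f \o (e \o P)).
    apply: (rank_drop (u := g u2) lf re) => /=.
      by rewrite (cP cg) fe fg.
    by rewrite (cP cg) efg fg gg add0r.
  apply: (min m mn f); split=> //; first by apply: rank_le_ext rm => u /=; rewrite fe.
  have fw0 : rnorm (f w) != 0.
    apply/eqP => fw0; move: h; rewrite (rnorm_eq0 fw0) (lin0 (rep_lin pi x)) (lin0 lP).
    by rewrite rnorm0 mulr0 ltxx.
  have fwp : 0 < rnorm (f w) by rewrite lt_def fw0 rnorm_ge0.
  exists ((rnorm (f w))^-1%:C *: f w); split.
  - by rewrite rnormZR gtr0_norm ?invr_gt0 // mulVf.
  - by rewrite (linZ lP) (cP cf) Pw.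
  - by rewrite (linZ lf) ff.
  - rewrite (linZ (rep_lin pi x)) (linZ lP) rnormZR gtr0_norm ?invr_gt0 //.
    by rewrite mulrC ltr_pdivlMr.
have ng : ~ c * rnorm (g w) < rnorm (P (pi x (g w))).
  move=> h; have [m mn rm] : exists2 m, (m < n)%N & rank_le m (g \o (e \o P)).
    apply: (rank_drop (u := f u1) lg re) => /=.
      by rewrite (cP cf) ge gf.
    by rewrite (cP cf) ef.
  apply: (min m mn g); split=> //; first by apply: rank_le_ext rm => u /=; rewrite ge.
  have gw0 : rnorm (g w) != 0.
    apply/eqP => gw0; move: h; rewrite (rnorm_eq0 gw0) (lin0 (rep_lin pi x)) (lin0 lP).
    by rewrite rnorm0 mulr0 ltxx.
  have gwp : 0 < rnorm (g w) by rewrite lt_def gw0 rnorm_ge0.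
  exists ((rnorm (g w))^-1%:C *: g w); split.
  - by rewrite rnormZR gtr0_norm ?invr_gt0 // mulVf.
  - by rewrite (linZ lP) (cP cg) Pw.
  - by rewrite (linZ lg) gg.
  - rewrite (linZ (rep_lin pi x)) (linZ lP) rnormZR gtr0_norm ?invr_gt0 //.
    by rewrite mulrC ltr_pdivlMr.
move/negP: nf; rewrite -leNgt => nf; move/negP: ng; rewrite -leNgt => ng.
have wE : w = f w + g w by rewrite -efg ew.
have orth a b : hdot (f a) (g b) = 0 by rewrite af fg hdot0r.
have nw : rnorm w ^+ 2 = rnorm (f w) ^+ 2 + rnorm (g w) ^+ 2.
  by rewrite {1}wE rnorm_sqD orth /= mulr0 addr0.
have Pf a : P (pi x (f a)) = f (P (pi x a)) by rewrite -cf.2 (cP cf).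
have Pg a : P (pi x (g a)) = g (P (pi x a)) by rewrite -cg.2 (cP cg).
have nx : rnorm (P (pi x w)) ^+ 2 = rnorm (P (pi x (f w))) ^+ 2 + rnorm (P (pi x (g w))) ^+ 2.
  rewrite {1}wE (linD (rep_lin pi x)) (linD lP) rnorm_sqD Pf Pg orth /= mulr0 addr0.
  by [].
have h1 : rnorm (P (pi x (f w))) ^+ 2 <= c ^+ 2 * rnorm (f w) ^+ 2.
  by rewrite -exprMn ler_pXn2r ?nnegrE ?mulr_ge0 ?rnorm_ge0.
have h2 : rnorm (P (pi x (g w))) ^+ 2 <= c ^+ 2 * rnorm (g w) ^+ 2.
  by rewrite -exprMn ler_pXn2r ?nnegrE ?mulr_ge0 ?rnorm_ge0.
have h3 : c ^+ 2 < rnorm (P (pi x w)) ^+ 2 by rewrite ltr_pXn2r ?nnegrE ?rnorm_ge0.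
have h4 : c ^+ 2 * rnorm w ^+ 2 <= c ^+ 2.
  by rewrite -[leRHS]mulr1 ler_wpM2l ?sqr_ge0 // expr_le1 ?rnorm_ge0.
by move: h4; rewrite nw mulrDr; lra.
Qed.

(** Among the summands seeing [x], take one of minimal rank.  By [good_split] it
    agrees on the range of [P] with the cyclic subspace of the witness [xi], and
    with every eigenspace of an operator [S] of the commutant of that subspace
    that meets the range of [P].  Such an eigenspace exists because [S] preserves
    this finite-dimensional range; it contains [xi], so [S] is a scalar. *)
Lemma irreducible_summand : c < opnorm (P \o pi x \o P) ->
  exists xi, [/\ rnorm xi = 1, cspan (cyc pi xi) xi, irreducible_vector pi xi
    & exists w, [/\ rnorm w <= 1, P w = w, cycproj pi xi w = w & c < rnorm (P (pi x w))]].
Proof.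
move=> /opnorm_gt[u u1 hu]; have [N rP] : exists N, rank_le N P by [].
have ex : exists n e, good n e.
  exists N, id; split=> //; first exact: comm_rep_id.
  exists (P u); split=> //; exact: le_trans (projection_norm u pP) u1.
have [n [e ge] min] : exists2 n, (exists e, good n e) &
    forall m, (m < n)%N -> forall e, ~ good m e.
  have exb : exists n, `[< exists e, good n e >] by have [n h] := ex; exists n; apply/asboolP.
  have [n /asboolP h hmin] := ex_minnP exb; exists n => // m mn e ge.
  have := hmin m; rewrite leqNgt mn => /(_ (introT (asboolP _) (ex_intro _ e ge))).
  by [].
have sp f' := good_split (f := f') min ge.
have [ce ae ee re [w [w1 Pw ew hw]]] := ge.
have lP := bopP.1.
have w0 : rnorm w != 0.
  apply/eqP => w0; move: hw; rewrite (rnorm_eq0 w0) (lin0 (rep_lin pi x)) (lin0 lP).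
  by rewrite rnorm0 ltNge c0.
have wp : 0 < rnorm w by rewrite lt_def w0 rnorm_ge0.
pose xi := (rnorm w)^-1%:C *: w.
have xi1 : rnorm xi = 1 by rewrite rnormZR gtr0_norm ?invr_gt0 // mulVf.
have Pxi : P xi = xi by rewrite (linZ lP) Pw.
have exi : e xi = xi by rewrite (linZ ce.1.1) ew.
have xi_nd := nondegenerate_vector Pxi.
pose f := cycproj pi xi.
have cf : comm_rep pi f := cycproj_comm pi xi.
have af : is_adj f f by move=> a b; exact: oproj_sa.
have ff a : f (f a) = f a by exact: oproj_idem.
have fxi : f xi = xi by exact: oproj_id.
have on_cyc (T S : H -> H) : comm_rep pi T -> comm_rep pi S -> T xi = S xi ->
    forall a, T (f a) = S (f a).
  move=> cT cS TS a; apply: (bop_ext (D := cyc pi xi) cT.1 cS.1).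
    by move=> _ [b _ <-]; rewrite cT.2 cS.2 TS.
  move=> d d0; have [b hb] := cyc_approx (oproj_in (S := cyc pi xi) a) d0.
  by exists (pi b xi) => //; exists b.
have ef a : e (f a) = f a.
  by apply: (on_cyc e id); [exact: ce | exact: comm_rep_id | exact: exi].
have xi0 : xi <> 0 by move=> h; move: xi1; rewrite h rnorm0 => /eqP; rewrite eq_sym oner_eq0.
have fPe : forall a, f (P a) = e (P a).
  by apply: (sp f) => //; exists xi; rewrite Pxi fxi.
exists xi; split=> //; last first.
  by exists w; split=> //; rewrite -/f -{1}Pw fPe Pw ew.
move=> T cT; rewrite -/f; pose S a := f (T (f a)).
have cS : comm_rep pi S.
  by apply: (comm_rep_comp (comm_rep_comp cf cT) cf).
pose Phi v := P v = v /\ f v = v.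
have [|v z|//||lam [v [[Pv fv] v0 Sv]]] := @eigenvector _ H S cS.1.1 Phi N P xi rP.
- by move=> v [].
- move=> [Pv fv]; split.
    by rewrite (linB lP) (linZ lP) (cP cS) Pv.
  by rewrite (linB cf.1.1) (linZ cf.1.1) /S ff fv.
- exact: xi0.
exists lam; pose Z : set H := [set z | f z = z /\ S z = lam *: z].
pose g := oproj Z.
have cg : comm_rep pi g.
  apply: oproj_comm_rep => a z [fz Sz]; apply: cspan_sub; split.
    by rewrite cf.2 fz.
  by rewrite cS.2 Sz (linZ (rep_lin pi a)).
have gZ (T1 T2 : H -> H) : bop T1 -> bop T2 -> (forall z, Z z -> T1 z = T2 z) ->
    forall a, T1 (g a) = T2 (g a).
  move=> bT1 bT2 h a; apply: (bop_ext (D := Z) bT1 bT2 h) => d d0.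
  have [||z Zz hz] := cspan_approx _ _ (oproj_in (S := Z) a) d0; last by exists z.
    by split; rewrite ?(lin0 cf.1.1) ?(lin0 cS.1.1) ?scaler0.
  move=> k z1 z2 [f1 S1] [f2 S2]; split.
    by rewrite (linD cf.1.1) (linZ cf.1.1) f1 f2.
  by rewrite (linD cS.1.1) (linZ cS.1.1) S1 S2 scalerDr !scalerA mulrC.
have fgE a : f (g a) = g a.
  by apply: (gZ f id) => //; [exact: cf.1 | exact: bop_id | move=> z []].
have gv : g v = v by apply: oproj_id; apply: cspan_sub.
have gPe : forall a, g (P a) = e (P a).
  apply: (sp g) => //.
  - by move=> a b; exact: oproj_sa.
  - by move=> a; exact: oproj_idem.
  - by move=> a; rewrite -fgE ef.
  - by exists v; rewrite Pv gv.
have gxi : g xi = xi by rewrite -Pxi gPe Pxi exi.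
have Sxi : S xi = lam *: xi.
  rewrite -gxi; apply: (gZ S (fun z => lam *: z)) => [||z []//]; first exact: cS.1.
  exact: bopZ (bop_id _).
move=> a; have := on_cyc S (fun z => lam *: z) cS (comm_repZ lam (comm_rep_id _)) Sxi a.
by rewrite /S ff.
Qed.

End Selection.

(** * Transporting a finite-rank projection to the larger algebra *)

Section Transport.
Variables (R : realType).

Variables (A L : cstarAlgType R) (iota : starHom A L).
Variables (H : hilbertType R) (pi : representation A H) (P : H -> H).
Hypotheses (pP : projection P) (fP : finite_rank P) (bP : bicommutant (range pi) P).

Let PP u : P (P u) = P u. Proof. by have [_ h _] := projection_bop pP. Qed.
Let aP : is_adj P P. Proof. by have [_ _ h] := projection_bop pP. Qed.
Let bopP : bop P. Proof. by have [h _ _] := projection_bop pP. Qed.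
Let cP T : comm_rep pi T -> forall u, P (T u) = T (P u).
Proof. by have [_ h] := (bicommutantE pi P).1 bP; exact: h. Qed.

(** A bound [C] on how far [pi a] moves the range of [P] off itself also holds
    for [sigma a] and [Q]; this is what transfers commutator estimates. *)
Definition defect_le (K : hilbertType R) (sigma : representation A K) (Q : K -> K) :=
  forall a (C : R), 0 <= C ->
  (forall u, rnorm (pi a (P u) - P (pi a (P u))) <= C * rnorm u) ->
  forall y, rnorm (sigma a (Q y) - Q (sigma a (Q y))) <= C * rnorm (Q y).

Section Corner.
Variables (K : hilbertType R) (sigma : representation A K) (xi : H) (V : H -> K).
Hypotheses (iV : intertwines pi sigma V) (VV : forall u, adj V (V u) = cycproj pi xi u).

Let e := cycproj pi xi.
Let bV : bop V := iV.1.
Let aV : is_adj V (adj V) := adjP bV.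
Let lV := bV.1.
Let ee u : e (e u) = e u. Proof. exact: oproj_idem. Qed.
Let le : linear e. Proof. exact: oproj_linear. Qed.
Let ae : is_adj e e. Proof. by move=> u v; exact: oproj_sa. Qed.
Let Pe u : P (e u) = e (P u). Proof. by apply: cP; exact: cycproj_comm. Qed.

Lemma corner_dot u v : hdot (V u) (V v) = hdot (e u) v.
Proof. by rewrite /e -VV (is_adj_sym aV). Qed.

Lemma corner_sq u : rnorm (V u) ^+ 2 = rnorm (e u) ^+ 2.
Proof. by rewrite [LHS]rnorm_sq corner_dot -ee ae -rnorm_sq ee. Qed.

Lemma corner_norm u : rnorm (V u) = rnorm (e u).
Proof. by apply/eqP; rewrite -(@eqrXn2 _ 2) ?rnorm_ge0 // corner_sq. Qed.

Lemma corner_le u : rnorm (V u) <= rnorm u.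
Proof. by rewrite corner_norm oproj_norm. Qed.

Lemma corner_supp u : V (e u) = V u.
Proof.
apply/eqP; rewrite -subr_eq0 -(linB lV); apply/eqP/rnorm_eq0.
by rewrite corner_norm (linB le) ee subrr rnorm0.
Qed.

(** The copy in [K] of the part of [P] lying in the cyclic subspace of [xi]. *)
Definition corner (k : K) : K := V (P (adj V k)).

Lemma corner_V u : corner (V u) = V (P u).
Proof. by rewrite /corner VV Pe corner_supp. Qed.

Lemma corner_projection : projection corner.
Proof.
split.
- by apply/bopE; exact: (bop_comp (bop_comp (adj_bop bV) bopP) bV).
- by apply/funext => k /=; rewrite {2}/corner corner_V PP.
- by move=> u v; rewrite /corner aV aP (is_adj_sym aV).
Qed.

Lemma corner_finite_rank : finite_rank corner.
Proof.
have [n [b hb]] := fP; exists n, (V \o b) => k; have [c hc] := hb (adj V k).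
exists c; rewrite /corner hc (lin_sum lV); apply: eq_bigr => i _.
by rewrite (linZ lV).
Qed.

Lemma corner_defect : defect_le sigma corner.
Proof.
move=> a C C0 hC y; have -> : sigma a (corner y) - corner (sigma a (corner y)) =
    V (pi a (P (adj V y)) - P (pi a (P (adj V y)))).
  by rewrite {1 3}/corner -!iV.2 corner_V (linB lV).
apply: le_trans (corner_le _) _; have := hC (P (adj V y)); rewrite PP => /le_trans; apply.
rewrite le_eqVlt; apply/orP; left; apply/eqP; congr (_ * _).
have ez : e (adj V y) = adj V y.
  by apply: hdot_ext => u; rewrite ae !(is_adj_sym aV) corner_supp.
by rewrite /corner corner_norm -/e -Pe ez.
Qed.

End Corner.

(** The ranges of [Q] and of the corner generate orthogonal invariant pieces, so
    the two defects add by Pythagoras instead of the triangle inequality. *)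
Lemma defect_sum (K : hilbertType R) (sigma : representation A K) (xi : H) (V : H -> K) Q :
  intertwines pi sigma V -> (forall u, adj V (V u) = cycproj pi xi u) ->
  projection Q -> defect_le sigma Q -> (forall u, Q (V u) = 0) ->
  projection (fun k => Q k + corner V k) /\ defect_le sigma (fun k => Q k + corner V k).
Proof.
move=> iV VV pQ dQ QV; have [bQ QQ aQ] := projection_bop pQ.
have pG := corner_projection iV VV; have [bG GG aG] := projection_bop pG.
have dG := corner_defect iV VV.
have aV := adjP iV.1.
have VQ k : adj V (Q k) = 0.
  by apply: hdot_ext => u; rewrite (is_adj_sym aV) aQ QV hdot0r hdot0l.
have GQ k : corner V (Q k) = 0 by rewrite /corner VQ (lin0 bopP.1) (lin0 iV.1.1).
have QG k : Q (corner V k) = 0 by exact: QV.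
split.
  split; first by apply/bopE; exact: bopD.
    apply/funext => k /=.
    by rewrite (linD bQ.1) (linD bG.1) QQ GG GQ QG add0r addr0.
  by move=> u v; rewrite hdotDl hdotDr aQ aG.
move=> a C C0 hC y.
have Qs k : Q (sigma a (corner V k)) = 0 by rewrite /corner -iV.2 QV.
have Vs k : adj V (sigma a (Q k)) = 0.
  by rewrite (intertwines_adj iV).2 VQ (lin0 (rep_lin pi a)).
have Gs k : corner V (sigma a (Q k)) = 0.
  by rewrite /corner Vs (lin0 bopP.1) (lin0 iV.1.1).
have -> : sigma a (Q y + corner V y) -
    (Q (sigma a (Q y + corner V y)) + corner V (sigma a (Q y + corner V y))) =
    (sigma a (Q y) - Q (sigma a (Q y))) +
    (sigma a (corner V y) - corner V (sigma a (corner V y))).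
  rewrite !(linD (rep_lin sigma a)) !(linD bQ.1) !(linD bG.1) Qs Gs addr0 add0r.
  by rewrite opprD addrACA.
have h1 := dQ a C C0 hC y; have h2 := dG a C C0 hC y.
have orth : hdot (sigma a (Q y) - Q (sigma a (Q y)))
    (sigma a (corner V y) - corner V (sigma a (corner V y))) = 0.
  rewrite {1 3}/corner -!iV.2 (corner_V iV VV) -(linB iV.1.1) -(is_adj_sym aV).
  by rewrite (linB (adj_bop iV.1).1) Vs VQ subrr hdot0l.
have orth2 : hdot (Q y) (corner V y) = 0 by rewrite aQ QG hdot0r.
move: (sigma a (Q y) - _) (sigma a (corner V y) - _) orth h1 h2 => t1 t2 orth h1 h2.
rewrite -(@ler_pXn2r _ 2) ?nnegrE ?mulr_ge0 ?rnorm_ge0 // exprMn.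
rewrite (rnorm_sqD t1) (rnorm_sqD (Q y)) orth orth2 /= mulr0 !addr0 mulrDr -!exprMn.
by apply: lerD; rewrite ler_pXn2r ?nnegrE ?mulr_ge0 ?rnorm_ge0.
Qed.

Lemma finite_rankD (K : hilbertType R) (S T : K -> K) : finite_rank S -> finite_rank T ->
  finite_rank (fun k => S k + T k).
Proof.
move=> [n [b hb]] [m [d hd]].
exists (n + m)%N, (fun i : 'I_(n + m) => match fintype.split i with inl j => b j | inr j => d j end) => u.
have [c hc] := hb u; have [f hf] := hd u.
exists (fun i : 'I_(n + m) => match fintype.split i with inl j => c j | inr j => f j end).
rewrite big_split_ord /= hc hf; congr (_ + _); apply: eq_bigr => i _.
  by rewrite -[lshift _ _]/(unsplit (inl i)) unsplitK.
by rewrite -[rshift _ _]/(unsplit (inr i)) unsplitK.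
Qed.

(** The inductive invariant: a multiplicity-free representation of [L] and a
    finite-rank projection of its bicommutant assembled from the cyclic
    summands of [pi] generated by the vectors of [s].  By the last clause, [Q]
    lives on the images of these summands under intertwiners. *)
Definition assembly (s : seq H) (K : hilbertType R) (rho : representation L K) (Q : K -> K) :=
  let rhoA := rep_pull iota rho in
  [/\ forall S T, comm_rep rho S -> comm_rep rho T -> forall k, S (T k) = T (S k),
      [/\ projection Q, finite_rank Q & forall T, comm_rep rho T -> forall k, Q (T k) = T (Q k)],
      defect_le rhoA Q,
      forall xi, xi \in s -> exists V, [/\ intertwines pi rhoA V,
         forall u, adj V (V u) = cycproj pi xi u & forall u, Q (V u) = V (P u)]
    & forall v, (forall xi V, xi \in s -> intertwines pi rhoA V ->
         (forall u, V (cycproj pi xi u) = V u) -> forall u, hdot (V u) v = 0) -> Q v = 0].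

Section Step.
Variables (s : seq H) (xi : H).
Hypothesis xi1 : rnorm xi = 1.
Hypothesis irr : irreducible_vector pi xi.
Let e := cycproj pi xi.
Let e_comm : comm_rep pi e. Proof. exact: cycproj_comm. Qed.
Let ae : is_adj e e. Proof. by move=> u v; exact: oproj_sa. Qed.
Let ee u : e (e u) = e u. Proof. exact: oproj_idem. Qed.
Let le : linear e. Proof. exact: oproj_linear. Qed.

Definition disjoint_from :=
  forall zeta T u, zeta \in s -> comm_rep pi T -> cycproj pi zeta (T (e u)) = 0.

(** If the summand of [xi] is not disjoint from that of some earlier [zeta],
    irreducibility makes the intertwiner [X] a multiple of an isometry on it;
    composed with the embedding of [zeta], it embeds [xi] and follows [P]. *)
Lemma assembly_equivalent K (rho : representation L K) Q :
  cspan (cyc pi xi) xi -> ~ disjoint_from -> assembly s rho Q -> assembly (xi :: s) rho Q.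
Proof.
move=> xi_nd nd [comm [pQ fQ cQ] dQ hV he]; split=> //; last first.
  by move=> v h; apply: he => z V zs; apply: h; rewrite in_cons zs orbT.
move=> z; rewrite in_cons => /orP[/eqP ->|]; last exact: hV.
move/existsNP: nd => [zeta /existsNP[T /existsNP[u0 h]]].
have [zs [cT hu0]] : zeta \in s /\ comm_rep pi T /\ cycproj pi zeta (T (e u0)) <> 0.
  split; first by apply: contrapT => n1; apply: h => /n1.
  split; first by apply: contrapT => n1; apply: h => _ /n1.
  by move=> n1; apply: h.
have [W [iW WW QW]] := hV zeta zs.
pose f := cycproj pi zeta.
pose X u := f (T (e u)).
have cX : comm_rep pi X.
  exact: comm_rep_comp (comm_rep_comp (cycproj_comm pi zeta) cT) e_comm.
have aX := adjP cX.1.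
have fX u : f (X u) = X u by exact: oproj_idem.
have Xe u : X (e u) = X u by rewrite /X ee.
have [lam hlam] := irr (comm_rep_comp (comm_rep_adj cX) cX).
have exi : e xi = xi by exact: oproj_id.
have XX u v : hdot (X u) (X v) = lam * hdot (e u) v.
  have h1 : e (adj X (X (e u))) = lam *: e u by exact: hlam.
  by rewrite -[X u]Xe -[X v]Xe -(is_adj_sym aX) -ae h1 hdotZl.
pose r := rnorm (X xi).
have lamE : lam = (r ^+ 2)%:C.
  have := XX xi xi; rewrite hdot_sq exi hdot_sq xi1 expr1n rmorph1 mulr1.
  by move=> <-.
have r0 : r != 0.
  apply/eqP => r0; apply: hu0; apply: hdot_eq0.
  by rewrite -/f -[f (T (e u0))]/(X u0) XX lamE r0 expr0n /= rmorph0 mul0r.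
have rp : 0 < r by rewrite lt_def r0 rnorm_ge0.
pose U u := r^-1%:C *: X u.
have cU : comm_rep pi U by exact: comm_repZ.
have iWU : intertwines pi (rep_pull iota rho) (W \o U) by exact: intertwines_comp cU iW.
exists (W \o U); split=> // [u|u].
  apply: hdot_ext => v; rewrite (is_adj_sym (adjP iWU.1)) /=.
  have lf : linear f by exact: oproj_linear.
  have fU : f (U u) = U u by rewrite /U (linZ lf) fX.
  rewrite (corner_dot iW WW) -/f fU /U hdotZl hdotZr conjE conjc_real XX lamE.
  rewrite !mulrA -!rmorphM /= -/e.
  have -> : r^-1 * r^-1 * r ^+ 2 = 1 by field.
  by rewrite rmorph1 mul1r.
by rewrite /= QW (cP cU).
Qed.

(** A disjoint summand embeds through an isometric intertwiner [Y]; its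
    projection is orthogonal to [Q], so it can be added to it. *)
Lemma assembly_embed K (rho : representation L K) Q K' (rho' : representation L K') V' Y :
  disjoint_from -> assembly s rho Q ->
  intertwines pi (rep_pull iota rho') V' -> (forall u, adj V' (V' u) = e u) ->
  (forall T, comm_rep rho' T -> exists lam : R[i], forall k, T k = lam *: k) ->
  intertwines rho' rho Y -> (forall k, adj Y (Y k) = k) ->
  exists Q', assembly (xi :: s) rho Q'.
Proof.
move=> dis [comm [pQ fQ cQ] dQ hV he] iV' VV' scal iY YY.
have [bY hY] := iY; have aY := adjP bY.
pose V := Y \o V'.
have iV : intertwines pi (rep_pull iota rho) V.
  by apply: intertwines_comp iV' _; split=> // a u; rewrite rep_pullE hY.
have aV := adjP iV.1.
have VV u : adj V (V u) = cycproj pi xi u.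
  apply: hdot_ext => w; rewrite (is_adj_sym aV) /V /= -(is_adj_sym aY) YY.
  by rewrite -(is_adj_sym (adjP iV'.1)) VV'.
have WV z W u : z \in s -> intertwines pi (rep_pull iota rho) W ->
    (forall u, W (cycproj pi z u) = W u) -> forall u', hdot (W u') (V u) = 0.
  move=> zs iW We u'; have cT : comm_rep pi (adj W \o V).
    exact: intertwines_comp iV (intertwines_adj iW).
  rewrite -We (adjP iW.1) -(corner_supp iV VV) oproj_sa.
  by rewrite -[oproj _ _]/(cycproj pi z ((adj W \o V) (e u))) dis // hdot0r.
have QV u : Q (V u) = 0.
  by apply: he => z W zs iW We u'; apply: (WV z).
have [pQ' dQ'] := defect_sum iV VV pQ dQ QV.
have Vscal T : comm_rep rho T -> exists lam : R[i], forall u, T (V u) = lam *: V u.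
  move=> cT.
  have cYY : comm_rep rho (Y \o adj Y) by exact: intertwines_comp (intertwines_adj iY) iY.
  have [lam hlam] := scal _ (intertwines_comp (intertwines_comp iY cT) (intertwines_adj iY)).
  have hl k : adj Y (T (Y k)) = lam *: k by exact: hlam.
  by exists lam => u; have := comm _ _ cT cYY (Y (V' u)); rewrite /= YY hl (linZ bY.1).
have pG := corner_projection iV VV; have [bG GG aG] := projection_bop pG.
have Gscal T : comm_rep rho T -> forall k, corner V (T k) = T (corner V k).
  move=> cT k; have cT' := comm_rep_adj cT; have aT := adjP cT.1.
  have [l1 h1] := Vscal _ cT; have [l2 h2] := Vscal _ cT'.
  have [v0|v0] := eqVneq (corner V k) 0.
    rewrite v0 (lin0 cT.1.1); apply: hdot_ext => w; rewrite hdot0l aG aT.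
    by rewrite h2 hdotZr -[V _]/(corner V w) -aG v0 hdot0l mulr0.
  have h3 : forall w, hdot (corner V (T k)) w = Num.conj l2 * hdot (corner V k) w.
    by move=> w; rewrite aG aT h2 hdotZr -[V _]/(corner V w) -aG.
  have h4 : T (corner V k) = l1 *: corner V k by exact: h1.
  have cc : hdot (corner V k) (corner V k) != 0.
    by apply: contra v0 => /eqP /hdot_eq0 ->.
  apply: hdot_ext => w; rewrite h3 h4 hdotZl; congr (_ * _); apply: (mulIf cc).
  have h5 : adj T (corner V k) = l2 *: corner V k by exact: h2.
  by rewrite -[RHS]hdotZl -h4 aT h5 hdotZr.
exists (fun k => Q k + corner V k); split=> //.
- split=> //; first exact: finite_rankD fQ (corner_finite_rank iV).
  by move=> T cT k; rewrite cQ // Gscal // (linD cT.1.1).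
- move=> z; rewrite in_cons => /orP[/eqP ->|zs].
    by exists V; split=> // u; rewrite QV add0r (corner_V iV VV).
  have [W [iW WW QW]] := hV z zs; exists W; split=> // u.
  rewrite QW; suff -> : corner V (W u) = 0 by rewrite addr0.
  rewrite /corner; have -> : adj V (W u) = 0.
    apply: hdot_ext => w; rewrite (is_adj_sym aV) hdot0l.
    by apply: (WV z W w zs iW) => u'; exact: (corner_supp iW WW).
  by rewrite (lin0 bopP.1) (lin0 iV.1.1).
- move=> v h; rewrite he ?add0r; last first.
    by move=> z W zs iW We u; apply: (h z) => //; rewrite in_cons zs orbT.
  rewrite /corner; have -> : adj V v = 0.
    apply: hdot_ext => w; rewrite hdot0l hdotC -aV.
    rewrite (h xi V) ?rmorph0 ?in_cons ?eqxx //; exact: (corner_supp iV VV).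
  by rewrite (lin0 bopP.1) (lin0 iV.1.1).
Qed.

Section Enlarge.
Variables (K K' : hilbertType R) (rho : representation L K) (rho' : representation L K').

Let act (x : L) (k : hsum K K') : hsum K K' := (rho x k.1, rho' x k.2).

Lemma hsum_fst_le (k : hsum K K') : rnorm k.1 <= rnorm k.
Proof.
rewrite -(@ler_pXn2r _ 2) ?nnegrE ?rnorm_ge0 // [leRHS]hsum_sq lerDl.
exact: sqr_ge0.
Qed.

Lemma hsum_snd_le (k : hsum K K') : rnorm k.2 <= rnorm k.
Proof.
rewrite -(@ler_pXn2r _ 2) ?nnegrE ?rnorm_ge0 // [leRHS]hsum_sq lerDr.
exact: sqr_ge0.
Qed.

Lemma hsum_le (a : K) (b : K') : rnorm ((a, b) : hsum K K') <= rnorm a + rnorm b.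
Proof.
rewrite -(@ler_pXn2r _ 2) ?nnegrE ?addr_ge0 ?rnorm_ge0 // [leLHS]hsum_sq /= sqrrD.
by have := mulr_ge0 (rnorm_ge0 a) (rnorm_ge0 b); lra.
Qed.

Let act_bop x : bop (act x).
Proof.
split.
  by move=> k u v; rewrite /act /= !(rep_lin _ x).
exists (rnorm x + rnorm x) => u; apply: le_trans (hsum_le _ _) _.
rewrite mulrDl; apply: lerD; apply: le_trans (rep_contr _ _ _) _;
  apply: ler_wpM2l; rewrite ?rnorm_ge0 //; [exact: hsum_fst_le | exact: hsum_snd_le].
Qed.

Definition rep_sum : representation L (hsum K K').
Proof.
refine (@Representation R L _ act _ _ _ _ _).
- by move=> x; exact/bopE/act_bop.
- by move=> x y u; rewrite /act !repD.
- by move=> k x u; rewrite /act !repZ.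
- by move=> x y; apply/funext => u; rewrite /act /= !repM.
- by move=> x u v; rewrite !hsumE /act /= !rep_star.
Defined.

Let i1 (k : K) : hsum K K' := (k, 0).
Let i2 (k : K') : hsum K K' := (0, k).
Let p1 (k : hsum K K') : K := k.1.
Let p2 (k : hsum K K') : K' := k.2.

Let i1_int : intertwines rho rep_sum i1.
Proof.
split=> [|a u]; last by rewrite -[RHS]/(act a (i1 u)) /act /= (lin0 (rep_lin _ _)).
split; first by move=> k u v; congr (_, _); rewrite /= scaler0 addr0.
by exists 1 => u; apply: le_trans (hsum_le _ _) _; rewrite rnorm0 addr0 mul1r.
Qed.

Let i2_int : intertwines rho' rep_sum i2.
Proof.
split=> [|a u]; last by rewrite -[RHS]/(act a (i2 u)) /act /= (lin0 (rep_lin _ _)).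
split; first by move=> k u v; congr (_, _); rewrite /= scaler0 addr0.
by exists 1 => u; apply: le_trans (hsum_le _ _) _; rewrite rnorm0 add0r mul1r.
Qed.

Let p1_int : intertwines rep_sum rho p1.
Proof. by split=> //; split=> //; exists 1 => u; rewrite mul1r hsum_fst_le. Qed.

Let p2_int : intertwines rep_sum rho' p2.
Proof. by split=> //; split=> //; exists 1 => u; rewrite mul1r hsum_snd_le. Qed.

Let a1 : is_adj i1 p1.
Proof. by move=> u v; rewrite hsumE /= hdot0l addr0. Qed.

Let a2 : is_adj i2 p2.
Proof. by move=> u v; rewrite hsumE /= hdot0l add0r. Qed.

Let decomp (k : hsum K K') : k = i1 (p1 k) + i2 (p2 k).
Proof. by case: k => x y; congr (_, _); rewrite /= ?addr0 ?add0r. Qed.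

Lemma rep_sum_inr : intertwines rho' rep_sum i2 /\ forall k, adj i2 (i2 k) = k.
Proof. by split=> // k; rewrite (adj_uniq i2_int.1 a2). Qed.

(** Without intertwiners between the summands, the commutant of the sum is
    diagonal, hence stays commutative. *)
Lemma assembly_enlarge Q :
  (forall X, intertwines rho' rho X -> forall k, X k = 0) ->
  (forall T, comm_rep rho' T -> exists lam : R[i], forall k, T k = lam *: k) ->
  assembly s rho Q -> assembly s rep_sum (fun k : hsum K K' => i1 (Q (p1 k))).
Proof.
move=> noX scal [comm [pQ fQ cQ] dQ hV he]; have [bQ QQ aQ] := projection_bop pQ.
have l1 := i1_int.1.1; have l2 := i2_int.1.1.
have diag T : comm_rep rep_sum T -> exists S (lam : R[i]), comm_rep rho S /\
    forall k, T k = i1 (S (p1 k)) + i2 (lam *: p2 k).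
  move=> cT; have [lam hlam] := scal _ (intertwines_comp (intertwines_comp i2_int cT) p2_int).
  exists (p1 \o (T \o i1)), lam; split.
    exact: (intertwines_comp (intertwines_comp i1_int cT) p1_int).
  move=> k; rewrite {1}(decomp k) (linD cT.1.1) [T (i1 _)]decomp [T (i2 _)]decomp.
  have -> : p2 (T (i1 (p1 k))) = 0.
    apply: hdot_ext => w; rewrite hdot0l.
    have iT := intertwines_comp (intertwines_comp i2_int (comm_rep_adj cT)) p1_int.
    rewrite (is_adj_sym a2) (adjP cT.1) a1.
    by have /= -> := noX _ iT w; rewrite hdot0r.
  have -> : p1 (T (i2 (p2 k))) = 0.
    exact: (noX _ (intertwines_comp (intertwines_comp i2_int cT) p1_int)).
  rewrite (lin0 l1) (lin0 l2) addr0 add0r; congr (_ + i2 _).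
  exact: (hlam (p2 k)).
have p1i x y : p1 (i1 x + i2 y) = x by rewrite /p1 /= addr0.
have p2i x y : p2 (i1 x + i2 y) = y by rewrite /p2 /= add0r.
split.
- move=> T1 T2 /diag[S1 [m1 [c1 h1]]] /diag[S2 [m2 [c2 h2]]] k.
  rewrite (h2 k) (h1 (_ + _)) (h1 k) (h2 (_ + _)) !p1i !p2i comm // !scalerA.
  by rewrite mulrC.
- split.
  + split; first by apply/bopE; exact: (bop_comp (bop_comp p1_int.1 bQ) i1_int.1).
      by apply/funext => k /=; rewrite QQ.
    by move=> u v; rewrite [LHS]a1 aQ (is_adj_sym a1).
  + have [n [b hb]] := fQ; exists n, (i1 \o b) => k; have [c hc] := hb (p1 k); exists c.
    by rewrite hc (lin_sum l1); apply: eq_bigr => i _; rewrite (linZ l1).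
  + move=> T /diag[S [m [c h]]] k; rewrite (h k) p1i cQ // h.
    by rewrite /p2 /= scaler0 (lin0 l2) addr0.
- move=> a C C0 hC y; have h := dQ a C C0 hC (p1 y).
  have eq : rep_pull iota rep_sum a (i1 (Q (p1 y))) = i1 (rho (iota a) (Q (p1 y))).
    by rewrite rep_pullE -i1_int.2.
  have ni k : rnorm (i1 k) = rnorm k.
    apply/eqP; rewrite -(@eqrXn2 _ 2) ?rnorm_ge0 // [X in X == _]hsum_sq /=.
    by rewrite rnorm0 expr0n addr0.
  by rewrite eq -(linB l1) !ni.
- move=> z /hV[V [iV VV QV]].
  have iW : intertwines pi (rep_pull iota rep_sum) (i1 \o V).
    by apply: intertwines_comp iV _; split=> [|a u]; [exact: i1_int.1 | exact: (i1_int.2 (iota a))].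
  exists (i1 \o V); split=> // [u|u].
    apply: hdot_ext => w; rewrite (is_adj_sym (adjP iW.1)).
    have -> : hdot ((i1 \o V) u) ((i1 \o V) w) = hdot (V u) (V w) by exact: a1.
    by rewrite -(is_adj_sym (adjP iV.1)) VV.
  by rewrite /= QV.
- move=> v h; rewrite he ?(lin0 l1) // => z V zs iV Ve u.
  rewrite -(a1 (V u) v); apply: (h z (i1 \o V) zs) => [|u']; last by rewrite /= Ve.
  by apply: intertwines_comp iV _; split=> [|a u']; [exact: i1_int.1 | exact: (i1_int.2 (iota a))].
Qed.

End Enlarge.

Hypothesis iota_iso : forall a, rnorm (iota a) = rnorm a.
Hypotheses (posL : pos_contr L) (auL : approx_unit L) (auA : approx_unit A).
Hypothesis xi_nd : cspan (cyc pi xi) xi.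

(** Three cases: [xi] is equivalent to an earlier vector; or its irreducible
    extension is already contained in [K], a nonzero intertwiner from an
    irreducible representation being a multiple of an isometry; or it is new
    and [K] is enlarged.  In the second case equivalence over [L] does not come
    from equivalence over [A], and [K] has to house both corners. *)
Lemma assembly_step (K : hilbertType R) (rho : representation L K) Q : assembly s rho Q ->
  exists (K' : hilbertType R) (rho' : representation L K') Q', assembly (xi :: s) rho' Q'.
Proof.
move=> ass; have [dis|ndis] := pselect disjoint_from; last first.
  by exists K, rho, Q; exact: assembly_equivalent.
have [K' [rho' [V' [iV' VV' scal]]]] :=
  irreducible_extension iota_iso posL auL auA xi1 xi_nd irr.
have [noX|exX] := pselect (forall X, intertwines rho' rho X -> forall k, X k = 0).
  have ass' := assembly_enlarge noX scal ass; have [iY YY] := rep_sum_inr rho rho'.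
  have [Q' hQ'] := assembly_embed dis ass' iV' VV' scal iY YY.
  by exists (hsum K K'), (rep_sum rho rho'), Q'.
move/existsNP: exX => [X] /not_implyP[iX] /existsNP[k0 Xk0].
have [bX hX] := iX; have aX := adjP bX.
have [lam hlam] := scal _ (intertwines_comp iX (intertwines_adj iX)).
have XX u v : hdot (X u) (X v) = lam * hdot u v.
  by rewrite -(is_adj_sym aX) (hlam u : adj X (X u) = _) hdotZl.
have k00 : rnorm k0 != 0.
  by apply/eqP => /rnorm_eq0 k00; apply: Xk0; rewrite k00 (lin0 bX.1).
have Xp : rnorm (X k0) != 0 by apply/eqP => /rnorm_eq0.
pose r := rnorm (X k0) / rnorm k0.
have lamE : lam = (r ^+ 2)%:C.
  have := XX k0 k0; rewrite !hdot_sq => h.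
  have kC : ((rnorm k0) ^+ 2)%:C != 0 :> R[i].
    by apply/eqP => /(@complexI R) /eqP; rewrite sqrf_eq0 (negPf k00).
  by apply: (mulIf kC); rewrite -h -rmorphM /=; congr (_%:C); rewrite /r; field.
have r0 : r != 0 by rewrite mulf_neq0 // invr_neq0.
pose Y k := r^-1%:C *: X k.
have iY : intertwines rho' rho Y.
  split=> [|a u]; first exact: bopZ.
  by rewrite /Y hX (linZ (rep_lin rho a)).
have YY k : adj Y (Y k) = k.
  apply: hdot_ext => w; rewrite (is_adj_sym (adjP iY.1)) /Y hdotZl hdotZr conjE conjc_real.
  rewrite XX lamE !mulrA -!rmorphM /=.
  have -> : r^-1 * r^-1 * r ^+ 2 = 1 by field.
  by rewrite rmorph1 mul1r.
have [Q' hQ'] := assembly_embed dis ass iV' VV' scal iY YY.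
by exists K, rho, Q'.
Qed.

End Step.

Hypothesis iota_iso : forall a, rnorm (iota a) = rnorm a.
Hypotheses (posL : pos_contr L) (auL : approx_unit L) (auA : approx_unit A).

(** The dual of the zero form is the zero space. *)
Lemma assembly_nil : exists (K : hilbertType R) (rho : representation L K) Q,
  assembly [::] rho Q.
Proof.
have ps : psd (fun _ _ : L => 0 : R[i]).
  by split=> *; rewrite ?addr0 ?mulr0 ?rmorph0.
have triv (k : hdual ps) : k = 0.
  apply: fd_ext => x; rewrite fd0; apply: cabs_eq0; apply/le_anti.
  by rewrite cabs_ge0 andbT; have := hdual_bound ps k x; rewrite /= sqrtr0 mulr0.
have b0 : bop (fun _ : hdual ps => 0 : hdual ps) by exact: bop0.
have rho : representation L (hdual ps).
  refine (@Representation R L (hdual ps) (fun _ _ => 0) _ _ _ _ _).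
  - by move=> x; exact/bopE.
  - by move=> x y u /=; rewrite addr0.
  - by move=> k x u /=; rewrite scaler0.
  - by [].
  - by move=> x u v; exact: (etrans (hdot0l v) (esym (hdot0r u))).
exists (hdual ps), rho, (fun _ => 0); split=> //.
- by move=> S T _ _ k; rewrite [LHS]triv [RHS]triv.
- split; last by move=> T _ k; rewrite [RHS]triv.
    split=> //; first exact/bopE.
    by move=> u v; exact: (etrans (hdot0l v) (esym (hdot0r u))).
  by exists 0%N, (fun _ => 0) => u; exists (fun _ => 0); rewrite big_ord0.
- by move=> a C C0 _ y; rewrite [rep_pull _ _ _ _]triv subrr rnorm0 mulr0.
Qed.

Lemma assembly_ex (s : seq H) :
  (forall xi, xi \in s -> [/\ rnorm xi = 1, cspan (cyc pi xi) xi & irreducible_vector pi xi]) ->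
  exists (K : hilbertType R) (rho : representation L K) Q, assembly s rho Q.
Proof.
elim: s => [|xi s IH] hs; first exact: assembly_nil.
have [|K [rho [Q ass]]] := IH; first by move=> z zs; apply: hs; rewrite in_cons zs orbT.
have [h1 h2 h3] := hs xi (mem_head _ _).
exact: assembly_step ass.
Qed.

End Transport.

(** * Commutators and compressions *)

Section CommutatorBound.
Variables (R : realType) (A : cstarAlgType R) (H : hilbertType R).
Variables (pi : representation A H) (P : H -> H).
Hypothesis pP : projection P.

Let PP u : P (P u) = P u. Proof. by have [_ h _] := projection_bop pP. Qed.
Let aP : is_adj P P. Proof. by have [_ _ h] := projection_bop pP. Qed.
Let bopP : bop P. Proof. by have [h _ _] := projection_bop pP. Qed.
Let lP := bopP.1.

Definition commutator a u := P (pi a u) - pi a (P u).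

Lemma commutator_bop a : bop (commutator a).
Proof. by apply: bopB; apply: bop_comp => //; exact: rep_bop. Qed.

Lemma compression_bop a : bop (P \o pi a \o P).
Proof. exact: (bop_comp bopP (bop_comp (rep_bop pi a) bopP)). Qed.

Lemma opnorm_ge0 (T : H -> H) : 0 <= opnorm T.
Proof.
rewrite /opnorm; have [hs|hs] := pselect (has_sup [set rnorm (T u) | u in [set u | rnorm u <= 1]]).
  apply: le_trans (rnorm_ge0 (T 0)) _; apply: sup_upper_bound => //.
  by exists 0 => //=; rewrite rnorm0.
by rewrite sup_out.
Qed.

Let comm_adj a : is_adj (commutator a) (fun v => - commutator (cstar a) v).
Proof.
move=> u v; rewrite /commutator hdotBl hdotNr hdotBr aP !rep_adj aP.
by rewrite opprB.
Qed.

(** The off-diagonal corners of [pi a] with respect to [P] are compressions of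
    the commutator, up to sign. *)
Lemma commutator_defect a u : rnorm (pi a (P u) - P (pi a (P u))) <=
  opnorm (commutator a) * rnorm u.
Proof.
have -> : pi a (P u) - P (pi a (P u)) = - commutator a (P u).
  by rewrite /commutator PP opprB.
rewrite rnormN; apply: le_trans (opnorm_bound _ (commutator_bop a)) _.
by apply: ler_wpM2l; [exact: opnorm_ge0 | exact: projection_norm].
Qed.

Lemma commutator_defect_star a u : rnorm (pi (cstar a) (P u) - P (pi (cstar a) (P u))) <=
  opnorm (commutator a) * rnorm u.
Proof.
have -> : pi (cstar a) (P u) - P (pi (cstar a) (P u)) = - commutator (cstar a) (P u).
  by rewrite /commutator PP opprB.
apply: le_trans (adj_bound (opnorm_ge0 (commutator a)) (comm_adj a) _ _) _.
  by move=> v; exact: opnorm_bound (commutator_bop a).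
by apply: ler_wpM2l; [exact: opnorm_ge0 | exact: projection_norm].
Qed.

(** The commutator is the difference of the two off-diagonal corners, which have
    orthogonal ranges and orthogonal supports. *)
Lemma commutator_le a (C : R) : 0 <= C ->
  (forall y, rnorm (pi a (P y) - P (pi a (P y))) <= C * rnorm (P y)) ->
  (forall y, rnorm (pi (cstar a) (P y) - P (pi (cstar a) (P y))) <= C * rnorm (P y)) ->
  opnorm (commutator a) <= C.
Proof.
move=> C0 h1 h2; apply: opnorm_le => // y.
pose Z u := pi (cstar a) (P u) - P (pi (cstar a) (P u)).
pose Z' v := P (pi a (v - P v)).
have aZ : is_adj Z Z'.
  move=> u v; rewrite /Z /Z' hdotBl (aP (pi _ _)) !rep_adj !cstarK.
  by rewrite -hdotBr -(linB (rep_lin pi a)) aP.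
have Z'le v : rnorm (Z' v) <= C * rnorm v.
  apply: (adj_bound C0 aZ) => u; apply: le_trans (h2 u) _.
  by apply: ler_wpM2l => //; exact: projection_norm.
have Z'Q : Z' y = Z' (y - P y) by rewrite /Z' (linB lP) PP subrr subr0.
have -> : commutator a y = Z' y - (pi a (P y) - P (pi a (P y))).
  rewrite /commutator /Z' (linB (rep_lin pi a)) (linB lP) opprB addrA subrK.
  by [].
have orth : hdot (Z' y) (pi a (P y) - P (pi a (P y))) = 0.
  by rewrite /Z' aP (linB lP) PP subrr hdot0r.
have orth2 : hdot (y - P y) (P y) = 0 by rewrite hdotBl aP PP subrr.
have hy : rnorm y ^+ 2 = rnorm (y - P y) ^+ 2 + rnorm (P y) ^+ 2.
  by rewrite -{1}(subrK (P y) y) (rnorm_sqD (y - P y)) orth2 /= mulr0 addr0.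
have {}h1 := h1 y; have := Z'le (y - P y); rewrite -Z'Q => h3.
move: (pi a (P y) - _) orth h1 => t2 orth h1.
rewrite -(@ler_pXn2r _ 2) ?nnegrE ?mulr_ge0 ?rnorm_ge0 // exprMn hy.
rewrite (rnorm_sqB (Z' y)) orth /= mulr0 subr0 mulrDr -!exprMn.
by apply: lerD; rewrite ler_pXn2r ?nnegrE ?mulr_ge0 ?rnorm_ge0.
Qed.

Lemma commutator_perturb x y :
  opnorm (commutator x) <= opnorm (commutator y) + 2 * rnorm (x - y).
Proof.
apply: opnorm_le; first by rewrite addr_ge0 ?opnorm_ge0 // mulr_ge0 ?rnorm_ge0.
move=> u; have -> : commutator x u = commutator y u + commutator (x - y) u.
  rewrite /commutator !repB (linB lP) opprB.
  by rewrite addrACA [P (pi y u) + _]addrC subrK addKr.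
apply: le_trans (rnormD _ _) _; rewrite mulrDl; apply: lerD.
  exact: opnorm_bound (commutator_bop y).
apply: le_trans (rnormB _ _) _.
have h1 := projection_norm (pi (x - y) u) pP.
have h2 := rep_contr pi (x - y) u; have h3 := rep_contr pi (x - y) (P u).
have h4 : rnorm (x - y) * rnorm (P u) <= rnorm (x - y) * rnorm u.
  by apply: ler_wpM2l; [exact: rnorm_ge0 | exact: projection_norm].
lra.
Qed.

Lemma compression_perturb x y :
  opnorm (P \o pi x \o P) <= opnorm (P \o pi y \o P) + rnorm (x - y).
Proof.
apply: opnorm_le; first by rewrite addr_ge0 ?opnorm_ge0 ?rnorm_ge0.
move=> u; have -> : (P \o pi x \o P) u = (P \o pi y \o P) u + P (pi (x - y) (P u)).
  by rewrite /= repB (linB lP) addrC subrK.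
apply: le_trans (rnormD _ _) _; rewrite mulrDl; apply: lerD.
  exact: opnorm_bound (compression_bop y).
apply: le_trans (projection_norm _ pP) _; apply: le_trans (rep_contr _ _ _) _.
by apply: ler_wpM2l; [exact: rnorm_ge0 | exact: projection_norm].
Qed.

End CommutatorBound.

Section Embedding.
Variables (R : realType) (A L : cstarAlgType R) (iota : starHom A L).
Hypothesis iota_iso : forall a, rnorm (iota a) = rnorm a.
Hypotheses (posL : pos_contr L) (auL : approx_unit L) (auA : approx_unit A).

(** One irreducible summand is kept for each [x j]; a negative [c j] needs none,
    norms being nonnegative.  On the summand, compressions are unchanged; the
    commutators are handled through their two off-diagonal corners. *)
Lemma transport_witness (H : hilbertType R) (pi : representation A H) (P : H -> H)
    (n : nat) (x : 'I_n -> A) (c : 'I_n -> R) :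
  projection P -> finite_rank P -> bicommutant (range pi) P ->
  (forall j, c j < opnorm (P \o pi (x j) \o P)) ->
  exists (K : hilbertType R) (rho : representation L K) (Q : K -> K),
    [/\ projection Q, finite_rank Q, bicommutant (range rho) Q
      & forall j, opnorm (fun u => Q (rho (iota (x j)) u) - rho (iota (x j)) (Q u)) <=
                  opnorm (fun u => P (pi (x j) u) - pi (x j) (P u)) /\
                  c j < opnorm (Q \o rho (iota (x j)) \o Q)].
Proof.
move=> pP0 fP0 bP0 hc0.
have [P' [[pP fP bP] comm' compr' nP]] := nondegenerate_part pP0 fP0 bP0.
have hc j : c j < opnorm (P' \o pi (x j) \o P').
  suff -> : P' \o pi (x j) \o P' = P \o pi (x j) \o P by exact: hc0.
  by apply/funext => u /=; exact: compr'.
have cE a : (fun u => P (pi a u) - pi a (P u)) = commutator pi P' a.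
  by apply/funext => u; rewrite -comm'.
have sel j : exists xi, 0 <= c j -> [/\ rnorm xi = 1, cspan (cyc pi xi) xi,
    irreducible_vector pi xi & exists w, [/\ rnorm w <= 1, P' w = w, cycproj pi xi w = w
      & c j < rnorm (P' (pi (x j) w))]].
  have [cj|cj] := boolP (0 <= c j); last by exists 0.
  by have [xi h] := irreducible_summand pP fP bP nP cj (hc j); exists xi.
have [xi hxi] := choice sel.
pose s := [seq xi j | j <- enum 'I_n & 0 <= c j].
have [|K [rho [Q [comm [pQ fQ cQ] dQ hV _]]]] := @assembly_ex R A L iota H pi P' pP fP bP
   iota_iso posL auL auA s.
  by move=> z /mapP[j]; rewrite mem_filter => /andP[cj _] ->; have [] := hxi j cj.
exists K, rho, Q; have [bQ QQ aQ] := projection_bop pQ; split=> //.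
  by apply/bicommutantE.
move=> j; set a := x j; split.
  rewrite -[fun u : K => _]/(commutator rho Q (iota a)) cE.
  have C0 : 0 <= opnorm (commutator pi P' a) by exact: opnorm_ge0.
  apply: (commutator_le pQ) => // y.
    by apply: (dQ a) => // u; exact: commutator_defect.
  rewrite -starHom_star; apply: (dQ (cstar a)) => // u.
  exact: commutator_defect_star.
have [cj|cj] := boolP (0 <= c j); last first.
  by rewrite -ltNge in cj; apply: lt_le_trans cj _; exact: opnorm_ge0.
have [_ _ _ [w [w1 Pw ew hw]]] := hxi j cj.
have [|V [iV VV QV]] := hV (xi j).
  by apply/mapP; exists j => //; rewrite mem_filter cj mem_enum.
have cor := corner_norm iV VV.
have ePx : cycproj pi (xi j) (P' (pi a w)) = P' (pi a w).
  have [_ cP] := (bicommutantE pi P').1 bP; have ce := cycproj_comm pi (xi j).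
  by rewrite -cP // ce.2 ew.
have VwE : (Q \o rho (iota a) \o Q) (V w) = V (P' (pi a w)).
  by rewrite /= QV Pw -[rho (iota a) _]/(rep_pull iota rho a _) -iV.2 QV.
apply: (lt_le_trans hw); rewrite -ePx -cor -VwE.
apply: le_trans (opnorm_bound _ (compression_bop rho pQ _)) _.
rewrite -[leRHS]mulr1; apply: ler_wpM2l; first exact: opnorm_ge0.
by rewrite cor ew.
Qed.

End Embedding.

(** * Inductive limits *)

Section Limit.
Variables (R : realType) (A : nat -> cstarAlgType R).
Variables (phi : forall n, starHom (A n) (A n.+1)) (L : cstarAlgType R).
Variables (psi : forall n, starHom (A n) L).
Hypotheses (qA : forall n, inner_quasidiagonal (A n)) (inj : forall n, injective (phi n)).
Hypothesis lim : is_inductive_limit phi psi.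

Let nd n : norm_determined (A n). Proof. exact: iqd_norm_determined. Qed.

Lemma limit_isometric n a : rnorm (psi n a) = rnorm a.
Proof.
have [_ h _] := lim.
have hm m : rnorm (connecting phi m a) = rnorm a.
  by elim: m => [|m IH] //=; rewrite (starHom_isometric (@nd _) (@nd _) (@inj _)).
have := h n a; rewrite (_ : (fun m => rnorm (connecting phi m a)) = fun=> rnorm a); last first.
  exact/funext.
by move=> h1; exact: (norm_cvg_unique h1 (cvg_cst _)).
Qed.

Lemma limit_widen n m a : (n <= m)%N -> exists b, psi m b = psi n a.
Proof.
have [h _ _] := lim; elim: m => [|m IH]; first by rewrite leqn0 => /eqP <-; exists a.
rewrite leq_eqVlt => /orP[/eqP <-|]; first by exists a.
by rewrite ltnS => /IH[b hb]; exists (phi m b); rewrite h.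
Qed.

Lemma limit_approx k (x : 'I_k -> L) (d : R) : 0 < d ->
  exists n (a : 'I_k -> A n), forall j, rnorm (x j - psi n (a j)) < d.
Proof.
move=> d0; have [_ _ /dense_rnorm dL] := lim.
have hn j : exists n, exists a : A n, rnorm (x j - psi n a) < d.
  by have [_ [n _ [a _ <-]] h] := dL (x j) d d0; exists n, a.
have [N hN] := choice hn; exists (\max_j N j)%N.
have ha j : exists b, rnorm (x j - psi (\max_j N j)%N b) < d.
  have [a h] := hN j; have [b hb] := limit_widen a (leq_bigmax j).
  by exists b; rewrite hb.
by have [a h] := choice ha; exists a.
Qed.

Lemma limit_approx2 (x y : L) (d : R) : 0 < d ->
  exists n (a b : A n), rnorm (x - psi n a) < d /\ rnorm (y - psi n b) < d.
Proof.
move=> d0; have [n [a ha]] := limit_approx (fun j : 'I_2 => if j == ord0 then x else y) d0.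
by exists n, (a ord0), (a ord_max); split; [exact: (ha ord0) | exact: (ha ord_max)].
Qed.

(** Approximate in some [A n], and rescale the approximants, whose norm may
    exceed 1 by [d]. *)
Lemma limit_pos_contr : pos_contr L.
Proof.
move=> c a c1 a1; rewrite -subr_le0; apply: cvgS_le0 => e e0.
pose d := Num.min 1 (e / 9).
have d0 : 0 < d by rewrite lt_min ltr01 divr_gt0.
have d1 : d <= 1 by rewrite ge_min lexx.
have d9 : 9 * d <= e.
  have : d <= e / 9 by rewrite ge_min lexx orbT.
  lra.
have [n [c' [a' [hc ha]]]] := limit_approx2 c a d0.
have close (x : L) (y : A n) : rnorm x <= 1 -> rnorm (x - psi n y) < d ->
    rnorm y <= 1 + d /\ rnorm (cmul (cstar x) x - psi n (cmul (cstar y) y)) <= 3 * d.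
  move=> x1 xy.
  have ny : rnorm y <= 1 + d.
    have := rnorm_leB (psi n y) x; rewrite limit_isometric (rnormC (psi n y) x); lra.
  split=> //; rewrite starHomM starHom_star.
  have -> : cmul (cstar x) x - cmul (cstar (psi n y)) (psi n y) =
     cmul (cstar x) (x - psi n y) + cmul (cstar (x - psi n y)) (psi n y).
    by rewrite cmulBr cstarB cmulBl addrA subrK.
  apply: le_trans (rnormD _ _) _.
  have h1 := rnormM (cstar x) (x - psi n y); have h2 := rnormM (cstar (x - psi n y)) (psi n y).
  rewrite !rnorm_star limit_isometric in h1 h2.
  have h3 : rnorm x * rnorm (x - psi n y) <= 1 * d.
    by apply: ler_pM; rewrite ?rnorm_ge0 //; exact: ltW.
  have h4 : rnorm (x - psi n y) * rnorm y <= d * 2.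
    apply: ler_pM; rewrite ?rnorm_ge0 //; first exact: ltW.
    lra.
  lra.
have [nc hc'] := close _ _ c1 hc; have [na ha'] := close _ _ a1 ha.
have main : rnorm (cmul (cstar c') c' - cmul (cstar a') a') <= 1 + 3 * d.
  have p1 : 0 < 1 + d by lra.
  have sc (y : A n) : rnorm y <= 1 + d -> rnorm ((1 + d)^-1%:C *: y) <= 1.
    by move=> hy; rewrite rnormZR gtr0_norm ?invr_gt0 // mulrC ler_pdivrMr // mul1r.
  have := nd_pos (@nd n) (sc _ nc) (sc _ na).
  rewrite !cstarZR !cmulZl !cmulZr !scalerA -scalerBr -rmorphM /= rnormZR.
  rewrite -expr2 ger0_norm ?sqr_ge0 // exprVn mulrC ler_pdivrMr ?exprn_gt0 // mul1r.
  move=> h; apply: le_trans h _; rewrite sqrrD expr1n mul1r.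
  have : d ^+ 2 <= d by rewrite expr2 -[leRHS]mulr1 ler_pM2l.
  lra.
have -> : cmul (cstar c) c - cmul (cstar a) a =
   (cmul (cstar c) c - psi n (cmul (cstar c') c')) +
   ((psi n (cmul (cstar c') c' - cmul (cstar a') a')) +
    (psi n (cmul (cstar a') a') - cmul (cstar a) a)).
  rewrite linearB; move: (psi n (cmul (cstar c') c')) (psi n (cmul (cstar a') a')) => C D.
  by rewrite [C - D + _]addrA subrK addrA subrK.
have := rnormD (psi n (cmul (cstar c') c' - cmul (cstar a') a'))
  (psi n (cmul (cstar a') a') - cmul (cstar a) a).
rewrite limit_isometric (rnormC (psi n _)).
set t := _ - _ + _ => h.
by rewrite lerBlDr; apply: le_trans (rnormD _ _) _; lra.
Qed.

Lemma limit_approx_unit : approx_unit L.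
Proof.
move=> b d d0; have d3 : 0 < d / 3 by rewrite divr_gt0.
have [n [b' [_ [hb _]]]] := limit_approx2 b 0 d3.
have [c [c1 hc]] := nd_approx_unit (@nd n) b' d3.
exists (psi n c); split; first by rewrite limit_isometric.
have h1 : rnorm (psi n b' - cmul (psi n c) (psi n b')) < d / 3.
  by rewrite -starHomM -linearB limit_isometric.
have h2 : rnorm (cmul (psi n c) (b - psi n b')) <= 1 * rnorm (b - psi n b').
  apply: le_trans (rnormM _ _) _; apply: ler_wpM2r; first exact: rnorm_ge0.
  by rewrite limit_isometric.
rewrite cmulBr (rnormC (cmul _ b)) in h2.
have := rnorm_tri (psi n b') b (cmul (psi n c) b).
have := rnorm_tri (cmul (psi n c) (psi n b')) (psi n b') (cmul (psi n c) b).
lra.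
Qed.

Lemma limit_iqd : inner_quasidiagonal L.
Proof.
move=> k x eps e0; have e5 : 0 < eps / 5 by rewrite divr_gt0.
have [n [a ha]] := limit_approx x e5.
have [H [pi [P [pP fP bP hP]]]] := qA a e5.
have [|K [rho [Q [pQ fQ bQ hQ]]]] := transport_witness (limit_isometric (n := n))
   limit_pos_contr limit_approx_unit (nd_approx_unit (@nd n))
   (c := fun j => rnorm (a j) - eps / 5) (x := a) pP fP bP.
  by move=> j; exact: (hP j).2.
exists K, rho, Q; split=> // j; have [h1 h2] := hQ j; have [h3 _] := hP j.
have hj := ha j.
split.
  apply: le_lt_trans (commutator_perturb rho pQ (x j) (psi n (a j))) _.
  move: h1 h3; set t := opnorm _; set t' := opnorm _; lra.
have := compression_perturb rho pQ (psi n (a j)) (x j).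
have := rnorm_leB (x j) (psi n (a j)).
rewrite limit_isometric (rnormC (psi n (a j))).
move: h2; set t := opnorm _; set t' := opnorm _; lra.
Qed.

End Limit.

(** * Strong-star density *)

Section Amplification.
Variables (R : realType) (A : cstarAlgType R) (H : hilbertType R) (I : finType).
Variable pi : representation A H.

Let amp (T : H -> H) (u : hpower I H) : hpower I H := [ffun i => T ((u : {ffun I -> H}) i)].

Lemma hpower_sq (u : {ffun I -> H}) :
  rnorm (u : hpower I H) ^+ 2 = \sum_i rnorm (u i) ^+ 2.
Proof.
rewrite (rnorm_sq (u : hpower I H)) hpowerE Re_sum.
by apply: eq_bigr => i _; rewrite rnorm_sq.
Qed.

Let amp_bop T : bop T -> bop (amp T).
Proof.
move=> bT; split.
  by move=> k u v; apply/ffunP => i; rewrite !ffunE bT.1.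
have [M M0 hM] := bop_bound bT; exists M => u.
rewrite -(@ler_pXn2r _ 2) ?nnegrE ?mulr_ge0 ?rnorm_ge0 ?(ltW M0) // exprMn !hpower_sq mulr_sumr.
apply: ler_sum => i _; rewrite ffunE -exprMn.
by rewrite ler_pXn2r ?nnegrE ?mulr_ge0 ?rnorm_ge0 ?(ltW M0).
Qed.

Definition rep_power : representation A (hpower I H).
Proof.
refine (@Representation R A (hpower I H) (fun a => amp (pi a)) _ _ _ _ _).
- by move=> a; apply/bopE/amp_bop; exact: rep_bop.
- by move=> x y u; apply/ffunP => i; rewrite !ffunE repD.
- by move=> k x u; apply/ffunP => i; rewrite !ffunE repZ.
- by move=> x y; apply/funext => u; apply/ffunP => i; rewrite !ffunE repMu.
- by move=> x u v; rewrite !hpowerE; apply: eq_bigr => i _; rewrite !ffunE rep_adj.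
Defined.

Lemma rep_powerE a (u : {ffun I -> H}) i : (rep_power a u : {ffun I -> H}) i = pi a (u i).
Proof. by rewrite /= ffunE. Qed.

Let inj (j : I) (x : H) : hpower I H := [ffun i => if i == j then x else 0].

Let inj_bop j : bop (inj j).
Proof.
split; first by move=> k u v; apply/ffunP => i; rewrite !ffunE; case: eqP; rewrite ?scaler0 ?addr0.
exists 1 => u; rewrite mul1r -(@ler_pXn2r _ 2) ?nnegrE ?rnorm_ge0 // hpower_sq (bigD1 j) //=.
rewrite ffunE eqxx big1 ?addr0 // => i /negPf ij.
by rewrite ffunE ij rnorm0 expr0n.
Qed.

Let inj_sum (u : {ffun I -> H}) : u = \sum_j inj j (u j) :> hpower I H.
Proof.
apply/ffunP => i; rewrite sum_ffunE (bigD1 i) //= ffunE eqxx big1 ?addr0 // => j ji.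
by rewrite ffunE eq_sym (negPf ji).
Qed.

(** The matrix entries of an operator commuting with the amplification commute
    with [pi], hence an element of the bicommutant, amplified, commutes with
    the operator. *)
Lemma bicommutant_power P : bicommutant (range pi) P ->
  forall T, comm_rep rep_power T -> forall u, amp P (T u) = T (amp P u).
Proof.
move=> /bicommutantE[bP cP] T [bT hT] u.
pose entry i j x := (T (inj j x) : {ffun I -> H}) i.
have ce i j : comm_rep pi (entry i j).
  split.
    apply: (bop_comp (bop_comp (inj_bop j) bT) (S := fun v : hpower I H => (v : {ffun I -> H}) i)).
    split; first by move=> k v w; rewrite !ffunE.
    by exists 1 => v; rewrite mul1r; exact: hpower_comp.
  move=> a x; rewrite /entry -rep_powerE -hT; congr (T _ _).
  by apply/ffunP => k; rewrite !ffunE; case: eqP; rewrite ?(lin0 (rep_lin pi a)).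
have TE v i : (T v : {ffun I -> H}) i = \sum_j entry i j ((v : {ffun I -> H}) j).
  by rewrite {1}[v](inj_sum v) (lin_sum bT.1) sum_ffunE.
apply/ffunP => i; rewrite TE ffunE TE (lin_sum bP.1); apply: eq_bigr => j _.
by rewrite ffunE cP.
Qed.

End Amplification.

Section Density.
Variables (R : realType) (A : cstarAlgType R) (H : hilbertType R).
Variables (pi : representation A H) (P : H -> H).
Hypotheses (pP : projection P) (bP : bicommutant (range pi) P).
Hypothesis nP : forall v, rep_null pi v -> P v = 0.

(** In the amplification, the projection [e] onto the closed span of the orbit of
    [al] commutes with [P], and [al - e al] is killed by [pi A], hence by [P];
    so [P al] lies in that span, to which [be] is orthogonal. *)
Lemma bicommutant_weak (I : finType) (al be : I -> H) :
  (forall a, \sum_i hdot (pi a (al i)) (be i) = 0) -> \sum_i hdot (P (al i)) (be i) = 0.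
Proof.
move=> h; pose al' : hpower I H := [ffun i => al i]; pose be' : hpower I H := [ffun i => be i].
pose rho := rep_power I pi; pose e := cycproj rho al'.
pose PI (u : hpower I H) : hpower I H := [ffun i => P ((u : {ffun I -> H}) i)].
have ce : comm_rep rho e by exact: cycproj_comm.
have cPe u : PI (e u) = e (PI u) by exact: (bicommutant_power bP ce).
have null a : rho a al' = rho a (e al').
  by rewrite -ce.2 /e /cycproj oproj_id //; apply: cspan_sub; exists a.
have PIe : PI al' = PI (e al').
  apply/ffunP => i; rewrite !ffunE; apply/eqP; rewrite -subr_eq0.
  have [bP' _ _] := projection_bop pP; rewrite -(linB bP'.1); apply/eqP/nP => a.
  rewrite (linB (rep_lin pi a)) -(rep_powerE pi a (e al')) -/rho -null rep_powerE ffunE.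
  by rewrite subrr.
have : hdot (PI al') be' = 0.
  rewrite PIe cPe; apply: oproj_in => _ [a _ <-].
  by rewrite hpowerE -[RHS](h a); apply: eq_bigr => i _; rewrite !ffunE.
by rewrite hpowerE => h'; rewrite -[RHS]h'; apply: eq_bigr => i _; rewrite !ffunE.
Qed.

(** The pairs ([pi a v], [pi a* v]) form a real subspace only, as the adjoint is
    antilinear; a functional vanishing on it is turned into a complex linear one
    by moving [a*] across the inner product. *)
Lemma strong_star_density (I : finType) (v : I -> H) (d : R) : 0 < d ->
  exists a, forall i, rnorm (pi a (v i) - P (v i)) < d /\
                      rnorm (pi (cstar a) (v i) - P (v i)) < d.
Proof.
move=> d0; have [_ _ aP] := projection_bop pP.
pose sa (b : bool) (a : A) := if b then a else cstar a.
pose act a : hpower (I * bool)%type H := [ffun k => pi (sa k.2 a) (v k.1)].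
pose t : hpower (I * bool)%type H := [ffun k => P (v k.1)].
have actE a k : (act a : {ffun I * bool -> H}) k = pi (sa k.2 a) (v k.1) by rewrite ffunE.
have tE k : (t : {ffun I * bool -> H}) k = P (v k.1) by rewrite ffunE.
have [||z [zG orth]] := @nearest_point _ _ (range act) t.
- exists 0 => //; apply/ffunP => -[i []]; rewrite !ffunE /= ?cstar0; exact: rep0.
- move=> r _ _ [x _ <-] [y _ <-]; exists (x + r%:C *: y) => //; apply/ffunP => -[i []].
    by rewrite !ffunE /= repD repZ.
  by rewrite !ffunE /= cstarD cstarZR repD repZ.
pose w := t - z; pose wf : {ffun I * bool -> H} := w.
pose al k := if k.2 then v k.1 else wf k; pose be k := if k.2 then wf k else v k.1.
pose f a := \sum_k hdot (pi a (al k)) (be k).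
have ReE (F G : I * bool -> R[i]) : (forall k, Re (F k) = Re (G k)) ->
    Re (\sum_(k : I * bool) F k) = Re (\sum_k G k).
  by move=> h; rewrite !Re_sum; apply: eq_bigr => k _.
have Ref a : Re (f a) = 0.
  rewrite -[RHS](orth (act a)) // -/w hpowerE; apply: ReE => -[i []]; rewrite /al /be actE /=.
    exact: (psdReC (@hdot_psd R H)).
  by rewrite rep_adj.
have f0 a : f a = 0.
  apply: eqC; first exact: Ref.
  have := Ref ('i%C *: a).
  have -> : f ('i%C *: a) = 'i%C * f a.
    by rewrite /f mulr_sumr; apply: eq_bigr => k _; rewrite repZ hdotZl.
  by rewrite ReM /= mul0r mul1r sub0r => /eqP; rewrite oppr_eq0 => /eqP.
have wt : Re (hdot w t) = 0.
  have /(congr1 (@complex.Re R)) := bicommutant_weak f0; rewrite [RHS]/= => h.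
  rewrite -[RHS]h hpowerE; apply: ReE => -[i []]; rewrite /al /be tE /=.
    exact: (psdReC (@hdot_psd R H)).
  by rewrite aP.
have w0 : w = 0.
  apply: rnorm_eq0; apply/eqP; rewrite -sqrf_eq0 rnorm_sq {2}/w hdotBr ReB wt sub0r oppr_eq0.
  rewrite -normr_le0; apply: cvgS_le0 => e e0.
  have q0 : 0 < e / (rnorm w + 1) by rewrite divr_gt0 // ltr_wpDl ?rnorm_ge0.
  have [g Gg hg] := zG _ q0.
  have -> : Re (hdot w z) = Re (hdot w (z - g)) by rewrite hdotBr ReB (orth g) ?subr0.
  apply: le_trans (Re_le_cabs _) _; apply: le_trans (hdot_CS _ _) _.
  have : rnorm w * rnorm (z - g) <= (rnorm w + 1) * (e / (rnorm w + 1)).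
    by apply: ler_pM; rewrite ?rnorm_ge0 ?lerDl // ltW.
  by rewrite [leRHS]mulrC divfK // gt_eqF // ltr_wpDl ?rnorm_ge0.
have [_ [a _ <-] ha] := zG d d0; exists a => i.
have tz : t = z by apply/eqP; rewrite -subr_eq0 -/w w0.
have hk b : rnorm (pi (sa b a) (v i) - P (v i)) < d.
  apply: le_lt_trans ha; rewrite -tz rnormC.
  by have := hpower_comp (t - act a) (i, b); rewrite !ffunE.
by split; [exact: (hk true) | exact: (hk false)].
Qed.

End Density.

(** * Separable subalgebras *)

(** Starting from a sequence, countably many operations of finite arity
    generate only countably many elements: each is the value of a tree whose
    leaves are indices of the sequence and whose nodes are labelled by
    operations. *)
Lemma countable_closure (T : Type) (J : countType) (g : nat -> T) (op : J -> seq T -> T) :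
  exists f : nat -> T, (forall n, exists m, f m = g n) /\
    (forall j (s : seq nat), exists m, f m = op j (map f s)).
Proof.
pose opn k s := if unpickle k is Some j then op j s else g 0%N.
pose ev := fix ev (t : GenTree.tree nat) : T :=
  match t with GenTree.Leaf n => g n | GenTree.Node k s => opn k (map ev s) end.
pose tr n : GenTree.tree nat := odflt (GenTree.Leaf 0%N) (unpickle n).
have trK t : tr (pickle t) = t by rewrite /tr pickleK.
exists (ev \o tr); split=> [n|j s].
  by exists (pickle (GenTree.Leaf n)); rewrite /= trK.
exists (pickle (GenTree.Node (pickle j) (map tr s))).
by rewrite /= trK /= /opn pickleK -map_comp.
Qed.

Definition ratc (R : realType) (p : rat * rat) : R[i] := (ratr p.1 +i* ratr p.2)%C.

Lemma ratc_dense (R : realType) (z : R[i]) (e : R) : 0 < e -> exists p, cabs (z - ratc R p) < e.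
Proof.
move=> e0; have h (x : R) : exists q : rat, `|x - ratr q| < e / 2.
  have [|q] := @rat_in_itvoo R (x - e / 2) (x + e / 2); first by lra.
  by rewrite in_itv /= => /andP[h1 h2]; exists q; rewrite ltr_norml; lra.
have [p hp] := h (Re z); have [q hq] := h (Im z); exists (p, q).
by apply: le_lt_trans (cabs_le _) _; case: z hp hq => a b /=; lra.
Qed.

Section DenseSubalgebra.
Variables (R : realType) (A : cstarAlgType R) (f : nat -> A).
Hypothesis f_lin : forall p n m, exists l, f l = f n + ratc R p *: f m.
Hypothesis f_mul : forall n m, exists l, f l = cmul (f n) (f m).
Hypothesis f_star : forall n, exists l, f l = cstar (f n).

Let cl x := forall e : R, 0 < e -> exists n, rnorm (x - f n) < e.

Let f0 : exists n, f n = 0.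
Proof.
have [l hl] := f_lin ((-1), 0) 0%N 0%N; exists l.
have -> : f l = f 0%N + (-1) *: f 0%N.
  by rewrite hl; congr (_ + _ *: _); apply: eqC; rewrite /= ?rmorphN1 ?rmorph0 ?oppr0.
by rewrite scaleN1r subrr.
Qed.

Let cl_f n : cl (f n).
Proof. by move=> e e0; exists n; rewrite subrr rnorm0. Qed.

Let cl_closed x : (forall e : R, 0 < e -> exists2 y, cl y & rnorm (x - y) < e) -> cl x.
Proof.
move=> h e /half_gt0 e0; have [y /(_ _ e0)[n hn] hy] := h _ e0; exists n.
by have := rnorm_tri y x (f n); lra.
Qed.

Let clD x y : cl x -> cl y -> cl (x + y).
Proof.
move=> hx hy e /half_gt0 e0; have [n hn] := hx _ e0; have [m hm] := hy _ e0.
have [l hl] := f_lin (1, 0) n m; exists l.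
have -> : f l = f n + f m.
  by rewrite hl -[f m in RHS]scale1r; congr (_ + _ *: _); apply: eqC; rewrite /= ?rmorph1 ?rmorph0.
rewrite opprD addrACA; have := rnormD (x - f n) (y - f m); lra.
Qed.

Let clZ k x : cl x -> cl (k *: x).
Proof.
move=> hx; apply: cl_closed => e e0.
have k0 : 0 < cabs k + 1 by rewrite ltr_wpDl // cabs_ge0.
have [n hn] := hx _ (divr_gt0 e0 k0); exists (k *: f n); last first.
  rewrite -scalerBr rnormZ.
  have : cabs k * rnorm (x - f n) <= cabs k * (e / (cabs k + 1)).
    by apply: ler_wpM2l; [exact: cabs_ge0 | exact: ltW].
  have : (cabs k + 1) * (e / (cabs k + 1)) = e by rewrite mulrC divfK // gt_eqF.
  have := divr_gt0 e0 k0; lra.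
move=> d d0; have n0 : 0 < rnorm (f n) + 1 by rewrite ltr_wpDl // rnorm_ge0.
have [p hp] := ratc_dense k (divr_gt0 d0 n0); have [z hz] := f0.
have [l hl] := f_lin p z n; exists l; rewrite hl hz add0r -scalerBl rnormZ.
have : cabs (k - ratc R p) * rnorm (f n) <= d / (rnorm (f n) + 1) * rnorm (f n).
  by apply: ler_wpM2r; [exact: rnorm_ge0 | exact: ltW].
have : d / (rnorm (f n) + 1) * (rnorm (f n) + 1) = d by rewrite divfK // gt_eqF.
have := divr_gt0 d0 n0; lra.
Qed.

Let clM x y : cl x -> cl y -> cl (cmul x y).
Proof.
have aux (d r : R) : 0 < d -> 0 <= r -> 0 < d / (r + 1) /\ d / (r + 1) * r < d.
  move=> d0 r0; have r1 : 0 < r + 1 by rewrite ltr_wpDl.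
  have h := divr_gt0 d0 r1; split=> //.
  have : d / (r + 1) * (r + 1) = d by rewrite divfK // gt_eqF.
  lra.
move=> hx hy; apply: cl_closed => e e0.
have [q0 qe] := aux e (rnorm x) e0 (rnorm_ge0 x); have [m hm] := hy _ q0.
exists (cmul x (f m)); last first.
  rewrite -cmulBr; apply: le_lt_trans (rnormM _ _) _; apply: le_lt_trans qe.
  by rewrite mulrC; apply: ler_wpM2r; [exact: rnorm_ge0 | exact: ltW].
apply: cl_closed => d d0.
have [p0 pd] := aux d (rnorm (f m)) d0 (rnorm_ge0 _); have [n hn] := hx _ p0.
exists (cmul (f n) (f m)); first by have [l <-] := f_mul n m.
rewrite -cmulBl; apply: le_lt_trans (rnormM _ _) _; apply: le_lt_trans pd.
by apply: ler_wpM2r; [exact: rnorm_ge0 | exact: ltW].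
Qed.

Let cl_star x : cl x -> cl (cstar x).
Proof.
move=> hx e /hx[n hn]; have [l hl] := f_star n; exists l.
by rewrite hl -cstarB rnorm_star.
Qed.

Definition sequence_subalg : cstarSubalg A.
Proof.
refine (@CstarSubalg R A cl _ clD clZ clM cl_star _).
  by have [n <-] := f0.
exact/closed_rnorm.
Defined.

Lemma sequence_subalg_in n : subalg_set sequence_subalg (f n).
Proof. exact: cl_f. Qed.

Lemma sequence_subalg_separable : separable (subalg_type sequence_subalg).
Proof.
pose t n := SubalgType (introT (subalg_predP _ _) (sequence_subalg_in n)).
exists (range t); split.
  exact: card_image_le.
apply/dense_rnorm => x e e0; have /subalg_predP hx := valP x.
have [n hn] := hx e e0; exists (t n) => //; exact: hn.
Qed.

End DenseSubalgebra.

Section Restriction.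
Variables (R : realType) (A : cstarAlgType R) (f : nat -> A).
Hypothesis f_lin : forall p n m, exists l, f l = f n + ratc R p *: f m.
Hypothesis f_mul : forall n m, exists l, f l = cmul (f n) (f m).
Hypothesis f_star : forall n, exists l, f l = cstar (f n).

Let B := sequence_subalg f_lin f_mul f_star.

Variables (H : hilbertType R) (pi : representation A H) (P : H -> H).
Variables (N : nat) (b : 'I_N -> H).
Hypotheses (pP : projection P) (Pb : forall l, P (b l) = b l).
Hypothesis spanb : forall u, exists c : 'I_N -> R[i], P u = \sum_i c i *: b i.

Definition strong_star_close (d : R) (a : A) v :=
  rnorm (pi a v - P v) < d /\ rnorm (pi (cstar a) v - P v) < d.

Hypothesis close : forall k (s : seq nat), exists m, forall l,
  strong_star_close k.+1%:R^-1 (f m) (b l) /\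
  forall n, n \in s -> strong_star_close k.+1%:R^-1 (f m) (pi (f n) (b l)).

Let S : set H := [set v | exists n l, v = pi (f n) (b l)].
Let e := oproj S.

Let closeE (d : R) (s : seq nat) : 0 < d -> exists m, forall l, strong_star_close d (f m) (b l) /\
  forall n, n \in s -> strong_star_close d (f m) (pi (f n) (b l)).
Proof.
move=> d0; have [k hk] := inv_small d0; have [m hm] := close k s; exists m => l.
have w v : strong_star_close k.+1%:R^-1 (f m) v -> strong_star_close d (f m) v.
  by move=> [h1 h2]; split; [apply: lt_trans h1 _ | apply: lt_trans h2 _]; exact: hk.
by have [h1 h2] := hm l; split=> [|n /h2]; exact: w.
Qed.

Let b_in l : cspan S (b l).
Proof.
apply: cspan_closed => d d0; have [m /(_ l)[[h _] _]] := closeE [::] d0.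
exists (pi (f m) (b l)); first by apply: cspan_sub; exists m, l.
by rewrite rnormC -[X in _ - X]Pb.
Qed.

Let S_f n s : S s -> cspan S (pi (f n) s).
Proof.
move=> [m [l ->]]; apply: cspan_sub; have [k hk] := f_mul n m; exists k, l.
by rewrite hk repMu.
Qed.

Let rep_apply_bop v : bop (fun x => pi x v).
Proof.
split; first by move=> k x y; rewrite repD repZ.
by exists (rnorm v) => x; rewrite mulrC rep_contr.
Qed.

Let comm_e x : subalg_set B x -> forall u, pi x (e u) = e (pi x u).
Proof.
move=> Bx u; apply: (@bop_ext _ _ _ (fun x => pi x (e u)) (fun x => e (pi x u)) (range f)).
- exact: rep_apply_bop.
- exact: (bop_comp (rep_apply_bop u) (oproj_bop S)).
- move=> _ [n _ <-]; apply: (oproj_comm (T' := pi (cstar (f n)))).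
  + exact: rep_adj.
  + exact: rep_lin.
  + exact: S_f.
  + by have [l <-] := f_star n; exact: S_f.
- by move=> d d0; have [n hn] := Bx d d0; exists (f n).
Qed.

Let inB (y : subalg_type B) : subalg_set B (\val y).
Proof. exact/subalg_predP/(valP y). Qed.

(** The projection [e] commutes with the subalgebra, so cutting down by it gives
    a representation; only there do the operators of the subalgebra suffice to
    approximate [P]. *)
Definition rep_restrict : representation (subalg_type B) H.
Proof.
refine (@Representation R (subalg_type B) H (fun y u => pi (\val y) (e u)) _ _ _ _ _).
- by move=> y; apply/bopE; apply: (bop_comp (oproj_bop S) (rep_bop pi _)).
- by move=> x y u; rewrite -repD.
- by move=> k x u; rewrite -repZ.
- move=> x y; apply/funext => u /=.
  by rewrite -(comm_e (inB y)) /e oproj_idem -repMu.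
- by move=> x u v; rewrite rep_adj /e oproj_sa -/e -(comm_e (inB (cstar x))).
Defined.

Let rho := rep_restrict.

Let bT_P : bop P. Proof. by have [h _ _] := projection_bop pP. Qed.
Let aP : is_adj P P. Proof. by have [_ _ h] := projection_bop pP. Qed.

Let eP u : e (P u) = P u.
Proof.
have [c ->] := spanb u; have le : linear e by exact: oproj_linear.
rewrite (lin_sum le); apply: eq_bigr => i _.
by rewrite (linZ le) /e oproj_id.
Qed.

Let Pe u : P (e u) = P u.
Proof. by apply: hdot_ext => w; rewrite aP /e oproj_sa -/e eP -aP. Qed.

Let le_small (x C : R) : 0 <= C -> (forall d, 0 < d -> x <= C * d) -> x <= 0.
Proof.
move=> C0 h; apply: cvgS_le0 => d d0; have C1 : 0 < C + 1 by rewrite ltr_wpDl.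
have q0 := divr_gt0 d0 C1; apply: le_trans (h _ q0) _.
have : (C + 1) * (d / (C + 1)) = d by rewrite mulrC divfK // gt_eqF.
lra.
Qed.

(** [P] leaves [T b] fixed because the elements of the subalgebra that
    approximate it strongly-star commute with [T]. *)
Let commutant_fix T l : comm_rep rho T -> P (T (b l)) = T (b l).
Proof.
move=> [bT hT]; have le : linear e by exact: oproj_linear.
pose y n : subalg_type B :=
  SubalgType (introT (subalg_predP _ _) (sequence_subalg_in f_lin f_mul f_star n)).
have Tf n : T (pi (f n) (b l)) = pi (f n) (e (T (b l))).
  have eb : e (b l) = b l by exact: oproj_id (b_in l).
  by rewrite -{1}eb; exact: (hT (y n) (b l)).
have [M M0 hM] := bop_bound bT; pose v := T (b l).
have vapp n d : strong_star_close d (f n) (b l) -> rnorm (v - T (pi (f n) (b l))) <= M * d.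
  move=> [h _]; rewrite -(linB bT.1); apply: le_trans (hM _) _.
  by apply: ler_wpM2l; [exact: ltW | rewrite rnormC -[X in _ - X]Pb ltW].
have v_in : cspan S v.
  apply: cspan_closed => d d0; have q0 : 0 < d / M / 2 by rewrite !divr_gt0.
  have [n /(_ l)[h _]] := closeE [::] q0; exists (T (pi (f n) (b l))).
    rewrite Tf (comm_e (sequence_subalg_in f_lin f_mul f_star n)); exact: oproj_in.
  apply: le_lt_trans (vapp _ _ h) _.
  have -> : M * (d / M / 2) = d / 2 by field; rewrite gt_eqF.
  lra.
have ev : e v = v by exact: oproj_id.
have orth s : S s -> hdot (v - P v) s = 0.
  move=> [n [j ->]]; set s' := pi (f n) (b j).
  apply/cabs_eq0/le_anti; rewrite cabs_ge0 andbT.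
  apply: (@le_small _ (M * rnorm s' + rnorm v)).
    by rewrite addr_ge0 ?mulr_ge0 ?rnorm_ge0 // ltW.
  move=> d d0; have [m hm] := closeE [:: n] d0.
  have [h1 _] := hm l; have [_ /(_ n (mem_head _ _)) [_ h2]] := hm j.
  have -> : hdot (v - P v) s' = hdot (v - T (pi (f m) (b l))) s' +
      hdot v (pi (cstar (f m)) s' - P s').
    rewrite Tf ev -/v !hdotBl hdotBr aP rep_adj.
    by rewrite addrA subrK.
  apply: le_trans (cabsD _ _) _; rewrite mulrDl; apply: lerD.
    apply: le_trans (hdot_CS _ _) _; rewrite mulrAC.
    by apply: ler_wpM2r; [exact: rnorm_ge0 | exact: vapp].
  apply: le_trans (hdot_CS _ _) _.
  by apply: ler_wpM2l; [exact: rnorm_ge0 | exact: ltW].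
apply/esym/eqP; rewrite -subr_eq0; apply/eqP/hdot_eq0.
have win : cspan S (v - P v).
  by rewrite -scaleN1r; apply: cspanD => //; rewrite -eP; exact: oproj_in.
by apply: win => s Ss; apply: hdot_orthC; exact: orth.
Qed.

Lemma restrict_bicommutant : bicommutant (range rho) P.
Proof.
apply/bicommutantE; split=> // T cT u.
have key T' : comm_rep rho T' -> forall w, P (T' (P w)) = T' (P w).
  move=> cT' w; have [c ->] := spanb w.
  rewrite (lin_sum cT'.1.1) (lin_sum bT_P.1); apply: eq_bigr => i _.
  by rewrite !(linZ cT'.1.1) (linZ bT_P.1) commutant_fix.
apply: hdot_ext => w; rewrite aP (adjP cT.1) -(key _ (comm_rep_adj cT)).
by rewrite -aP -(adjP cT.1) -aP key.
Qed.

Lemma restrict_commutator (y : subalg_type B) :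
  opnorm (fun u => P (rho y u) - rho y (P u)) <= opnorm (commutator pi P (\val y)).
Proof.
apply: opnorm_le => [|u]; first exact: opnorm_ge0.
have -> : P (rho y u) - rho y (P u) = commutator pi P (\val y) (e u).
  by rewrite /commutator Pe /= eP.
apply: le_trans (opnorm_bound _ (commutator_bop pi pP _)) _.
by apply: ler_wpM2l; [exact: opnorm_ge0 | exact: oproj_norm].
Qed.

Lemma restrict_compression (y : subalg_type B) : P \o rho y \o P = P \o pi (\val y) \o P.
Proof. by apply/funext => u /=; rewrite eP. Qed.

End Restriction.

Section SeparableSubalgebra.
Variables (R : realType) (A : cstarAlgType R).

(** The data of inner quasidiagonality for one finite list, packed so that they
    can be chosen for all lists at once. *)
Record witness := Witness {
  wit_space : hilbertType R;
  wit_rep : representation A wit_space;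
  wit_proj : wit_space -> wit_space;
  wit_rank : nat;
  wit_basis : 'I_wit_rank -> wit_space
}.

Definition witness_for (xs : seq A) (eps : R) (w : witness) :=
  let: Witness H pi P N b := w in
  [/\ [/\ projection P, bicommutant (range pi) P & forall v, rep_null pi v -> P v = 0],
      forall l, P (b l) = b l,
      forall u, exists c : 'I_N -> R[i], P u = \sum_i c i *: b i
    & forall x, x \in xs -> opnorm (commutator pi P x) < eps /\
                            rnorm x - eps < opnorm (P \o pi x \o P)].

Lemma witness_ex (xs : seq A) (eps : R) : inner_quasidiagonal A -> 0 < eps ->
  exists w, witness_for xs eps w.
Proof.
move=> qA e0.
have [H [pi [P0 [pP0 fP0 bP0 h0]]]] := qA (size xs) (fun j => nth 0 xs j) eps e0.
have [P [[pP [N [b hb]] bP] comm compr nP]] := nondegenerate_part pP0 fP0 bP0.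
have [bopP PP _] := projection_bop pP.
exists (Witness pi P (P \o b)); split=> //.
- by move=> l /=; rewrite PP.
- move=> u; have [c hc] := hb u; exists c; rewrite -[LHS]PP hc (lin_sum bopP.1).
  by apply: eq_bigr => i _; rewrite (linZ bopP.1).
- move=> x /(nthP 0)[j jx <-]; have [h1 h2] := h0 (Ordinal jx); split.
    rewrite (_ : commutator _ _ _ = fun u => P0 (pi (nth 0 xs j) u) - pi (nth 0 xs j) (P0 u)) //.
    by apply/funext => u; exact: comm.
  rewrite (_ : _ \o _ = P0 \o pi (nth 0 xs j) \o P0) //.
  by apply/funext => u; exact: compr.
Qed.

(** [strong_star_density], for the vectors of the basis and their images under
    the elements of [ds]. *)
Lemma witness_close xs eps (w : witness) (ds : seq A) (d : R) :
  witness_for xs eps w -> 0 < d -> exists a,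
  forall l, strong_star_close (wit_rep w) (wit_proj (w:=w)) d a (wit_basis l) /\
  forall c, c \in ds -> strong_star_close (wit_rep w) (wit_proj (w:=w)) d a
                         (wit_rep w c (wit_basis l)).
Proof.
case: w => H pi P N b /= [[pP bP nP] _ _ _] d0.
pose v (k : 'I_N * option 'I_(size ds)) :=
  if k.2 is Some i then pi (nth 0 ds i) (b k.1) else b k.1.
have [a ha] := strong_star_density pP bP nP v d0; exists a => l; split; first exact: ha (l, None).
by move=> c /(nthP 0)[i ic <-]; exact: (ha (l, Some (Ordinal ic))).
Qed.

End SeparableSubalgebra.

Section PartOne.
Variables (R : realType) (A : cstarAlgType R) (qA : inner_quasidiagonal A).
Variable g : nat -> A.

(** Close the given sequence under the algebra operations and under a choice
    of strong-star approximants to the projections witnessing inner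
    quasidiagonality of [A] for the finite lists already obtained. *)
Lemma iqd_hull : exists B : cstarSubalg A, [/\ separable (subalg_type B),
  inner_quasidiagonal (subalg_type B) & forall n, subalg_set B (g n)].
Proof.
have i0 m : 0 < m.+1%:R^-1 :> R by rewrite invr_gt0 ltr0n.
have [W hW] := choice (fun p : seq A * nat => witness_ex p.1 qA (i0 p.2)).
have [sk hsk] := choice (fun p : nat * nat * nat * seq A =>
  witness_close (drop p.1.2 p.2) (hW (take p.1.2 p.2, p.1.1.1)) (i0 p.1.1.2)).
(* An index (m, k, n) asks for approximants, of quality k, to the projection
   that witnesses the first n entries of the list with tolerance m; the other
   entries give the vectors on which to approximate it. *)
pose op (j : (rat * rat) + (bool + nat * nat * nat)) (s : seq A) : A := match j with
  | inl p => nth 0 s 0 + ratc R p *: nth 0 s 1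
  | inr (inl true) => cmul (nth 0 s 0) (nth 0 s 1)
  | inr (inl false) => cstar (nth 0 s 0)
  | inr (inr p) => sk (p, s) end.
have [f [fg fop]] := countable_closure g op.
have f_lin p n m : exists l, f l = f n + ratc R p *: f m by exact: fop (inl p) [:: n; m].
have f_mul n m : exists l, f l = cmul (f n) (f m) by exact: fop (inr (inl true)) [:: n; m].
have f_star n : exists l, f l = cstar (f n) by exact: fop (inr (inl false)) [:: n].
pose B := sequence_subalg f_lin f_mul f_star; exists B; split.
- exact: sequence_subalg_separable.
- move=> n y eps e0; have e5 : 0 < eps / 5 by rewrite divr_gt0.
  have [m /(_ m (leqnn m))] := inv_small e5; set d : R := m.+1%:R^-1 => hm.
  have d0 : 0 < d by exact: i0.
  have hx j : exists k, rnorm (\val (y j) - f k) < d.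
    by have /subalg_predP h := valP (y j); exact: h.
  have [x {}hx] := choice hx; have [xs xsP] : exists xs : seq nat, forall j, x j \in xs.
    by exists [seq x j | j <- enum 'I_n] => j; apply: map_f; exact: mem_enum.
  have close k (s : seq nat) : exists i, forall l,
     strong_star_close (wit_rep (W (map f xs, m))) (wit_proj (w:=W (map f xs, m))) k.+1%:R^-1
       (f i) (wit_basis l) /\
     forall c, c \in s ->
       strong_star_close (wit_rep (W (map f xs, m))) (wit_proj (w:=W (map f xs, m))) k.+1%:R^-1
         (f i) (wit_rep (W (map f xs, m)) (f c) (wit_basis l)).
    have [i hi] := fop (inr (inr (m, k, size xs))) (xs ++ s); exists i.
    have := hsk ((m, k, size xs), map f (xs ++ s)); rewrite /= map_cat.
    rewrite take_size_cat ?size_map // drop_size_cat ?size_map // -map_cat.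
    rewrite -[sk _]/(op (inr (inr (m, k, size xs))) (map f (xs ++ s))) -hi => h l.
    have [h1 h2] := h l; split=> // c cs; apply: h2; exact: map_f.
  have := hW (map f xs, m); case: (W (map f xs, m)) close => H pi P N b /= close.
  move=> [[pP bP nP] Pb spanb hP].
  exists H, (rep_restrict f_lin f_mul f_star pi b), P; split=> //.
  + by exists N, b.
  + exact: restrict_bicommutant.
  + move=> j; have [] := hP (f (x j)) (map_f f (xsP j)); rewrite -/d => h1 h2.
    have hj := hx j; split.
      apply: le_lt_trans (restrict_commutator pP Pb spanb close (y j)) _.
      apply: le_lt_trans (commutator_perturb pi pP _ (f (x j))) _.
      lra.
    rewrite restrict_compression //.
    have := compression_perturb pi pP (f (x j)) (\val (y j)).
    have := rnorm_leB (\val (y j)) (f (x j)); rewrite (rnormC (f (x j))).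
    rewrite -[rnorm (y j)]/(rnorm (\val (y j))); lra.
- move=> n; have [m <-] := fg n; exact: sequence_subalg_in.
Qed.

End PartOne.

Lemma separable_subalg_seq (R : realType) (A : cstarAlgType R) (B : cstarSubalg A) :
  separable (subalg_type B) -> exists g : nat -> A, forall x, subalg_set B x ->
  forall e : R, 0 < e -> exists n, rnorm (x - g n) < e.
Proof.
move=> [D [/countable_injP[h hinj] /dense_rnorm dD]].
pose g n : subalg_type B := xget 0 [set y | D y /\ h y = n].
exists (fun n => \val (g n)) => x Bx e e0.
pose x' := SubalgType (introT (subalg_predP B x) Bx).
have [y Dy hy] := dD x' e e0; exists (h y).
have -> : g (h y) = y; last exact: hy.
have /= [Dg hg] := @xgetPex _ 0 [set z | D z /\ h z = h y] (ex_intro _ y (conj Dy erefl)).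
by apply: hinj => //; apply/mem_set.
Qed.

Theorem proposition6p3 (R : realType) :
  separably_inheritable (@inner_quasidiagonal R).
Proof.
split=> [A B qA sB|A phi L psi _ qA inj lim]; last exact: (limit_iqd qA inj lim).
have [g hg] := separable_subalg_seq sB.
have [B' [sB' qB' gB']] := iqd_hull qA g; exists B'; split=> // x Bx.
have cB := (closed_rnorm (subalg_set B')).1 (@Defs.subalg_closed _ _ B'); apply: (cB _) => e e0.
by have [n hn] := hg x Bx e e0; exists (g n).
Qed.
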